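(* Let $A$ be an NC cell complex and let $m\in\mathbb N$, $m\geq 1$. Let $X$ be a compact Hausdorff space and $Y$ a closed subspace of $X$. Let $\phi\colon A\to C(Y,M_m(\mathbb C))$ be a unital $^*$-homomorphism. Then there exist a closed neighbourhood $Z$ of $Y$ in $X$ and a $^*$-homomorphism $\tilde\phi\colon A\to C(Z,M_m(\mathbb C))$ which lifts $\phi$, in the sense that $\phi(a)=\tilde\phi(a)|_Y$ for all $a\in A$.
   Context: The class of (unital) non-commutative (NC) cell complexes is the smallest class $\mathcal C$ of $\mathrm C^*$-algebras (closed under isomorphism) such that: (i) every finite dimensional $\mathrm C^*$-algebra is in $\mathcal C$; and (ii) if $B\in\mathcal C$, $k,n\in\mathbb N$ ($k\ge 1$), $\phi\colon B\to C(S^{n-1},M_k(\mathbb C))$ is a unital $^*$-homomorphism, and $A$ is the pull-back $A=\{(b,f)\in B\oplus C(D^n,M_k(\mathbb C)) : \phi(b)=f|_{S^{n-1}}\}$, then $A\in\mathcal C$. Here $S^{n-1}$ is the boundary sphere of the closed ball $D^n$ (with $S^{-1}=\varnothing$). *)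

(* Defs.v *)
From HB Require Import structures.
From mathcomp Require Import all_boot all_order all_algebra.
From mathcomp Require Import complex.
From mathcomp Require Import all_classical all_reals all_analysis.

Set Implicit Arguments.
Unset Strict Implicit.
Unset Printing Implicit Defensive.

Import Order.TTheory GRing.Theory Num.Theory.
Import numFieldNormedType.Exports.

Local Open Scope classical_set_scope.
Local Open Scope ring_scope.

(* Naming the complex numbers as a [numClosedFieldType] makes them carry the
   topology and the norm (valued in [Cplx R] itself) that the library puts on
   numeric fields; the concrete type [R[i]] has no topology. *)
Definition Cplx (R : realType) : numClosedFieldType := R[i].

(* Unital star-algebras over the complex numbers. The product is part of the
   mixin because the library's algebras are nonzero rings, whereas the zero
   algebra has to be allowed here: it is C(K, M_m) for empty K. *)
HB.mixin Record isStarAlgebra (R : realType) A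
    & GRing.Lmodule (Cplx R) A := {
  amul : A -> A -> A;
  aone : A;
  star : A -> A;
  amulA : forall x y z : A, amul x (amul y z) = amul (amul x y) z;
  amul1l : forall x : A, amul aone x = x;
  amul1r : forall x : A, amul x aone = x;
  amulDl : forall x y z : A, amul (x + y) z = amul x z + amul y z;
  amulDr : forall x y z : A, amul x (y + z) = amul x y + amul x z;
  amulZl : forall (c : Cplx R) (x y : A), amul (c *: x) y = c *: amul x y;
  amulZr : forall (c : Cplx R) (x y : A), amul x (c *: y) = c *: amul x y;
  starD : forall x y : A, star (x + y) = star x + star y;
  starZ : forall (c : Cplx R) (x : A), star (c *: x) = c^* *: star x;
  starM : forall x y : A, star (amul x y) = amul (star y) (star x);
  starK : forall x : A, star (star x) = x
}.

#[short(type="starAlgType")]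
HB.structure Definition StarAlgebra (R : realType) :=
  {A of GRing.Lmodule (Cplx R) A & isStarAlgebra R A}.

HB.mixin Record isCStarAlgebra (R : realType) A
    & CompleteNormedModule (Cplx R) A & StarAlgebra R A := {
  cstar_normM : forall x y : A, `|amul x y| <= `|x| * `|y|;
  cstar_identity : forall x : A, `|amul (star x) x| = `|x| ^+ 2
}.

#[short(type="cstarType")]
HB.structure Definition CStarAlgebra (R : realType) :=
  {A of CompleteNormedModule (Cplx R) A & StarAlgebra R A
      & isCStarAlgebra R A}.

Definition star_hom (R : realType) (A B : starAlgType R) (f : A -> B) : Prop :=
  [/\ linear f, {morph f : x y / amul x y} & {morph f : x / star x}].

Definition unital_star_hom (R : realType) (A B : starAlgType R) (f : A -> B) :
  Prop := star_hom f /\ f aone = aone.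

Definition star_isomorphic (R : realType) (A B : starAlgType R) : Prop :=
  exists2 f : A -> B, star_hom f & bijective f.

Definition finite_dimensional (R : realType) (A : starAlgType R) : Prop :=
  exists (n : nat) (e : 'I_n -> A),
    forall a : A, exists c : 'I_n -> Cplx R, a = \sum_(i < n) c i *: e i.

Definition adjmx (R : realType) (m : nat) (M : 'M[Cplx R]_m) : 'M[Cplx R]_m :=
  (map_mx (@Num.conj (Cplx R)) M)^T.

(* The star-algebra C(X, M_m), with pointwise operations. *)
Definition contmx (R : realType) (X : topologicalType) (m : nat) : Type :=
  continuousType X 'M[Cplx R]_m.

Section ContMx.
Context {R : realType} {X : topologicalType} {m : nat}.
Local Notation C := (Cplx R).
Local Notation CX := (contmx R X m).
Implicit Types f g h : CX.

Definition contmx_fun f : X -> 'M[C]_m := f.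

HB.instance Definition _ := Choice.copy CX (continuousType X 'M[C]_m).

Lemma contmxP f g : contmx_fun f =1 contmx_fun g -> f = g.
Proof. by move=> fg; apply/continuousEP. Qed.

Lemma contmx_cts f : continuous (contmx_fun f).
Proof. exact: cts_fun. Qed.

Lemma cts_mxP (F : X -> 'M[C]_m) :
  (forall i j, continuous (fun x => F x i j : C)) -> continuous F.
Proof.
move=> Fc x A [P xP PA].
have H : \forall y \near x, forall i j, P i j (F y i j).
  apply: (@filter_forall _ _ (fun i y => forall j, P i j (F y i j)) (nbhs x) _) => i.
  apply: (@filter_forall _ _ (fun j y => P i j (F y i j)) (nbhs x) _) => j.
  exact: (Fc i j x (P i j) (xP i j)).
by apply: filterS H => y Hy; apply: PA.
Qed.

Lemma cts_coord f i j : continuous (fun x => contmx_fun f x i j : C).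
Proof.
move=> x; apply: (@continuous_comp _ _ _ (contmx_fun f) (fun M => M i j : C)).
  exact: cts_fun.
exact: coord_continuous.
Qed.

Lemma contmx_zero_cts : continuous (fun _ : X => 0 : 'M[C]_m).
Proof. exact: cst_continuous. Qed.

Lemma contmx_one_cts : continuous (fun _ : X => 1 : 'M[C]_m).
Proof. exact: cst_continuous. Qed.

Lemma contmx_opp_cts f : continuous (fun x => - contmx_fun f x).
Proof. by move=> x; apply: cvgN; exact: contmx_cts. Qed.

Lemma contmx_add_cts f g :
  continuous (fun x => contmx_fun f x + contmx_fun g x).
Proof. by move=> x; apply: cvgD; exact: contmx_cts. Qed.

Lemma contmx_scale_cts (c : C) f : continuous (fun x => c *: contmx_fun f x).
Proof. by move=> x; apply: cvgZr; exact: contmx_cts. Qed.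

Lemma contmx_mul_cts f g :
  continuous (fun x => contmx_fun f x * contmx_fun g x).
Proof.
apply: cts_mxP => i j.
pose S s (x : X) : C := \sum_(k <- s) contmx_fun f x i k * contmx_fun g x k j.
have Sc s : continuous (S s).
  elim: s => [|k s IH].
    rewrite (_ : S _ = fun=> 0); first exact: cst_continuous.
    by apply/funext => y; rewrite /S big_nil.
  rewrite (_ : S _ = fun y =>
      contmx_fun f y i k * contmx_fun g y k j + S s y); last first.
    by apply/funext => y; rewrite /S big_cons.
  move=> x; apply: cvgD; last exact: IH.
  by apply: cvgM; exact: cts_coord.
rewrite (_ : (fun x => _) = S (index_enum 'I_m)); first exact: Sc.
by apply/funext => y; rewrite mxE.
Qed.

Lemma contmx_star_cts f : continuous (fun x => adjmx (contmx_fun f x)).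
Proof.
apply: cts_mxP => i j x.
rewrite (_ : (fun x => _) = fun x => (contmx_fun f x j i)^*); last first.
  by apply/funext => y; rewrite !mxE.
apply/cvgrPdist_lt => e e0.
have /cvgrPdist_lt /(_ e e0) := @cts_coord f j i x.
by apply: filterS => y; rewrite -rmorphB norm_conjC.
Qed.

Definition contmx_zero : CX := mkcts contmx_zero_cts.
Definition contmx_one : CX := mkcts contmx_one_cts.
Definition contmx_opp f : CX := mkcts (contmx_opp_cts (f := f)).
Definition contmx_add f g : CX := mkcts (contmx_add_cts (f := f) (g := g)).
Definition contmx_scale (c : C) f : CX :=
  mkcts (contmx_scale_cts (c := c) (f := f)).
Definition contmx_mul f g : CX := mkcts (contmx_mul_cts (f := f) (g := g)).
Definition contmx_star f : CX := mkcts (contmx_star_cts (f := f)).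

Lemma contmx_addA : associative contmx_add.
Proof. by move=> f g h; apply: contmxP => x; exact: addrA. Qed.
Lemma contmx_addC : commutative contmx_add.
Proof. by move=> f g; apply: contmxP => x; exact: addrC. Qed.
Lemma contmx_add0 : left_id contmx_zero contmx_add.
Proof. by move=> f; apply: contmxP => x; exact: add0r. Qed.
Lemma contmx_addN : left_inverse contmx_zero contmx_opp contmx_add.
Proof. by move=> f; apply: contmxP => x; exact: addNr. Qed.

HB.instance Definition _ := GRing.isZmodule.Build CX
  contmx_addA contmx_addC contmx_add0 contmx_addN.

Lemma contmx_mulA : associative contmx_mul.
Proof. by move=> f g h; apply: contmxP => x; exact: mulrA. Qed.
Lemma contmx_mul1l : left_id contmx_one contmx_mul.
Proof. by move=> f; apply: contmxP => x; exact: mul1r. Qed.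
Lemma contmx_mul1r : right_id contmx_one contmx_mul.
Proof. by move=> f; apply: contmxP => x; exact: mulr1. Qed.
Lemma contmx_mulDl : left_distributive contmx_mul +%R.
Proof. by move=> f g h; apply: contmxP => x; exact: mulrDl. Qed.
Lemma contmx_mulDr : right_distributive contmx_mul +%R.
Proof. by move=> f g h; apply: contmxP => x; exact: mulrDr. Qed.

Lemma contmx_scaleA (a b : C) f :
  contmx_scale a (contmx_scale b f) = contmx_scale (a * b) f.
Proof. by apply: contmxP => x; exact: scalerA. Qed.
Lemma contmx_scale1 : left_id 1 contmx_scale.
Proof. by move=> f; apply: contmxP => x; exact: scale1r. Qed.
Lemma contmx_scaleDr : right_distributive contmx_scale +%R.
Proof. by move=> c f g; apply: contmxP => x; exact: scalerDr. Qed.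
Lemma contmx_scaleDl f : {morph contmx_scale^~ f : a b / a + b}.
Proof. by move=> a b; apply: contmxP => x; exact: scalerDl. Qed.

HB.instance Definition _ := GRing.Zmodule_isLmodule.Build C CX
  contmx_scaleA contmx_scale1 contmx_scaleDr contmx_scaleDl.

Lemma contmx_scale_mull (c : C) f g : contmx_mul (c *: f) g = c *: contmx_mul f g.
Proof. by apply: contmxP => x; exact/esym/scalemxAl. Qed.
Lemma contmx_scale_mulr (c : C) f g : contmx_mul f (c *: g) = c *: contmx_mul f g.
Proof. by apply: contmxP => x; exact/esym/scalemxAr. Qed.
Lemma contmx_starD f g : contmx_star (f + g) = contmx_star f + contmx_star g.
Proof.
apply: contmxP => x; rewrite /contmx_fun/= /mkcts/=.
by apply/matrixP => i j; rewrite !mxE rmorphD.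
Qed.
Lemma contmx_starZ (c : C) f : contmx_star (c *: f) = c^* *: contmx_star f.
Proof.
apply: contmxP => x; rewrite /contmx_fun/= /mkcts/=.
by apply/matrixP => i j; rewrite !mxE rmorphM.
Qed.
Lemma contmx_starM f g : contmx_star (contmx_mul f g) = contmx_mul (contmx_star g) (contmx_star f).
Proof.
apply: contmxP => x; rewrite /contmx_fun/= /mkcts/=.
by rewrite /adjmx map_mxM trmx_mul.
Qed.
Lemma contmx_starK f : contmx_star (contmx_star f) = f.
Proof.
apply: contmxP => x; rewrite /contmx_fun/= /mkcts/=.
by apply/matrixP => i j; rewrite !mxE conjCK.
Qed.

HB.instance Definition _ := isStarAlgebra.Build R CX
  contmx_mulA contmx_mul1l contmx_mul1r contmx_mulDl contmx_mulDr
  contmx_scale_mull contmx_scale_mulr contmx_starD contmx_starZ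
  contmx_starM contmx_starK.

End ContMx.

Section Restriction.
Context {R : realType} {T : topologicalType} {K L : set T} {m : nat}.

Lemma restr_cts (KL : K `<=` L) (f : contmx R (set_type L) m) :
  continuous (fun x : set_type K => contmx_fun f (subfun KL x)).
Proof.
move=> x; apply: (@continuous_comp _ _ _ (subfun KL) (contmx_fun f)).
  apply/(@continuous_comp_initial (set_type L) (set_type K) T set_val).
  rewrite (_ : _ \o _ = set_val); last first.
    by apply/funext => y; rewrite /subfun !set_valE.
  exact: initial_continuous.
exact: contmx_cts.
Qed.

Definition restr (KL : K `<=` L) (f : contmx R (set_type L) m) : contmx R (set_type K) m :=
  mkcts (restr_cts (KL := KL) (f := f)).

End Restriction.

Definition unit_ball (R : realType) (n : nat) : set 'rV[R]_n :=
  [set x | \sum_(i < n) x 0 i ^+ 2 <= 1].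

(* For n = 0 the sum is empty, so that the sphere is empty and the ball is a
   point. *)
Definition unit_sphere (R : realType) (n : nat) : set 'rV[R]_n :=
  [set x | \sum_(i < n) x 0 i ^+ 2 = 1].

Arguments unit_ball : clear implicits.
Arguments unit_sphere : clear implicits.

Lemma sphere_sub_ball (R : realType) (n : nat) :
  unit_sphere R n `<=` unit_ball R n.
Proof. by move=> x Sx; rewrite /unit_ball /= Sx. Qed.

(* [A] is, up to *-isomorphism, the pull-back of
     phi : B -> C(S^(n-1), M_k)  and  restriction : C(D^n, M_k) -> C(S^(n-1), M_k):
   the *-homomorphism (p, q) is a bijection of A onto
     {(b, f) | phi b = f restricted to S^(n-1)}.
   No condition on norms is needed: a *-isomorphism between C*-algebras is
   isometric. *)
Definition is_pullback (R : realType) (A B : starAlgType R) (k n : nat)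
    (phi : B -> contmx R (set_type (unit_sphere R n)) k) : Prop :=
  exists (p : A -> B) (q : A -> contmx R (set_type (unit_ball R n)) k),
    [/\ star_hom p, star_hom q, injective (fun a => (p a, q a)) &
        range (fun a => (p a, q a)) =
        [set bf | phi bf.1 = restr (@sphere_sub_ball R n) bf.2]].

Inductive nc_cell_complex (R : realType) : cstarType R -> Prop :=
| nc_isomorphic (A B : cstarType R) :
    nc_cell_complex A -> star_isomorphic A B -> nc_cell_complex B
| nc_finite_dimensional (A : cstarType R) :
    finite_dimensional A -> nc_cell_complex A
| nc_pullback (A B : cstarType R) (k n : nat)
    (phi : B -> contmx R (set_type (unit_sphere R n)) k) :
    nc_cell_complex B -> (0 < k)%N -> unital_star_hom phi ->
    is_pullback A phi -> nc_cell_complex A.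

(* Main.v *)
(** The unital representations of A on M_m, with the topology of pointwise
    convergence, form an absolute neighbourhood extensor for separable
    metrizable spaces; as finitely many elements of A nearly determine a
    representation, this carries over to compact Hausdorff spaces, and a
    homomorphism A -> C(Y, M_m) is a map from Y to this space.

    For finite dimensional A nearby representations are unitarily conjugate,
    through the Casimir element of A and polar decomposition.  For the pull-back
    of B and C(D^n, M_k), the radius defines a central element h = (1, |x|) of A.
    Near a representation where h is not scalar, its spectral projections reduce
    the question to smaller m.  Where the spectrum of h lies below t < 1, moving
    the points of the ball towards the mean value of the coordinate functions
    contracts the representations, by a homotopy, onto evaluations at a single
    point followed by a representation of M_k; where it lies above 1/2, pushing
    the points of the ball radially to the sphere contracts them onto
    representations of B.  In both cases the homotopy fixes its final set, and off
    that set h or a coordinate function is not scalar, or h is a scalar below 1;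
    extensors available there are glued to the final set along the homotopy. *)

Require Import Defs.
From HB Require Import structures.
From mathcomp Require Import all_boot all_order all_algebra.
From mathcomp Require Import complex.
From mathcomp Require Import all_classical all_reals all_analysis.
From mathcomp Require Import ring lra.

Set Implicit Arguments.
Unset Strict Implicit.
Unset Printing Implicit Defensive.

Import Order.TTheory GRing.Theory Num.Theory.
Import numFieldNormedType.Exports.

Local Open Scope classical_set_scope.
Local Open Scope ring_scope.

(** * Extending maps from closed subsets *)

(** The obstacle is the representations on which the radius and the coordinate functions are all
    scalar: no spectral projection splits them, yet representations that do split may accumulate
    there. The contractions are made for a neighbourhood of this set. Their target has to depend
    continuously on representations that are not scalar yet, hence the use of normalized traces.
    Extensions found off the set have to be matched with it, and for this the homotopy parameter is
    steered by distances in the source; together with the countable covers used for gluing, this is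
    why separable metrizable sources come first. All estimates are made on representations.
    Deforming the ball while fixing the sphere changes an element of A by one whose component in B
    is zero; for such elements the values on the ball bound the image under every representation,
    with a constant depending on the matrix sizes alone. This gives the joint continuity of the
    homotopies and, after cutting along eigenvectors of h, the separability statement. Splitting
    refers to smaller sizes for the same algebra, so an induction on m is nested in the one over the
    cell complex. *)

Section Metrized.
Context {R : realType}.

(* Continuity of the restriction to K, for a function that is total only to
   avoid subtypes: its values off K are irrelevant. *)
Definition cts_on (X T : topologicalType) (K : set X) (f : X -> T) :=
  forall x, K x -> forall V, nbhs (f x) V -> \forall y \near x, K y -> V (f y).

(** A pseudometric inducing the topology. The sequence [z] is dense, which makes countable covers by
    balls available. *)
Definition metrizes (X : topologicalType) (d : X -> X -> R) :=
  [/\ forall x, d x x = 0, forall x y, d x y = d y x,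
      forall x y z, d x z <= d x y + d y z,
      forall x A, nbhs x A <-> exists2 e, 0 < e & forall y, d x y < e -> A y
    & exists z : nat -> X, forall x e, 0 < e -> exists i, d x (z i) < e].

Lemma cts_on_sub (X T : topologicalType) (K L : set X) (f : X -> T) :
  K `<=` L -> cts_on L f -> cts_on K f.
Proof.
move=> KL cf x Kx V fV; have := cf x (KL _ Kx) V fV.
by apply: filterS => y Vy /KL.
Qed.

Lemma cts_on_ext (X T : topologicalType) (K : set X) (f g : X -> T) :
  (forall x, K x -> f x = g x) -> cts_on K f -> cts_on K g.
Proof.
move=> fg cf x Kx V; rewrite -fg// => /(cf x Kx V).
by apply: filterS => y H Ky; rewrite -fg//; exact: H.
Qed.

Lemma cts_on_comp (X T U : topologicalType) (K : set X) (L : set T)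
    (f : X -> T) (g : T -> U) :
  (forall x, K x -> L (f x)) -> cts_on K f -> cts_on L g -> cts_on K (g \o f).
Proof.
move=> KL cf cg x Kx V /(cg _ (KL _ Kx)) /(cf x Kx).
by apply: filterS => y H Ky; apply: H => //; exact: KL.
Qed.

Lemma cts_on_cts (X T : topologicalType) (K : set X) (f : X -> T) :
  continuous f -> cts_on K f.
Proof.
move=> cf x Kx V /cf fV; have : nbhs x (f @^-1` V) by [].
by apply: filterS => y Vy _.
Qed.

Lemma cts_on_compT (X T U : topologicalType) (K : set X)
    (f : X -> T) (g : T -> U) :
  cts_on K f -> continuous g -> cts_on K (g \o f).
Proof. by move=> cf cg; apply: (@cts_on_comp _ _ _ _ setT) => //; exact: cts_on_cts. Qed.

Lemma cts_on_cst (X T : topologicalType) (K : set X) (t : T) :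
  cts_on K (fun=> t).
Proof. by move=> x Kx V Vt; apply: filterE => y _; exact: nbhs_singleton. Qed.

Lemma cts_on_pair (X T U : topologicalType) (K : set X) (f : X -> T)
    (g : X -> U) :
  cts_on K f -> cts_on K g -> cts_on K (fun x => (f x, g x)).
Proof.
move=> cf cg x Kx V [[P Q] [Pf Qg] PQV].
near=> y => Ky; apply: PQV; split => /=.
  by move: Ky; near: y; exact: cf.
by move: Ky; near: y; exact: cg.
Unshelve. all: by end_near. Qed.

Lemma cts_on_fst (X T U : topologicalType) (K : set X) (f : X -> T * U) :
  cts_on K f -> cts_on K (fun x => (f x).1).
Proof. by move=> cf; apply: (cts_on_compT cf) => -[a b] V Va; exists (V, setT) => [|[? ?] []//]; split => //; exact: filterT. Qed.

Lemma cts_on_snd (X T U : topologicalType) (K : set X) (f : X -> T * U) :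
  cts_on K f -> cts_on K (fun x => (f x).2).
Proof. by move=> cf; apply: (cts_on_compT cf) => -[a b] V Va; exists (setT, V) => [|[? ?] []//]; split => //; exact: filterT. Qed.

Lemma cts_on_open (X T : topologicalType) (O : set X) (f : X -> T) (U : set T) :
  open O -> cts_on O f -> open U -> open (O `&` f @^-1` U).
Proof.
move=> oO cf oU; rewrite openE => x [Ox Ux]; rewrite /interior.
have NO : nbhs x O by exact: open_nbhs_nbhs.
have := cf x Ox U (open_nbhs_nbhs (conj oU Ux)).
by apply: filterS2 NO => y Oy H; split => //; exact: H.
Qed.

Lemma cts_on_closed (X T : topologicalType) (K : set X) (f : X -> T)
    (C : set T) :
  closed K -> cts_on K f -> closed C -> closed (K `&` f @^-1` C).
Proof.
move=> cK cf cC x clx.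
have Kx : K x by apply: cK => A /clx [y [[Ky _] Ay]]; exists y.
split => //=; apply: cC => V /(cf x Kx) /clx [y [[Ky Cy] Vy]].
by exists (f y); split => //; exact: Vy.
Qed.

Lemma cts_on_within (X T : topologicalType) (K : set X) (f : X -> T) :
  cts_on K f <-> {within K, continuous f}.
Proof. by rewrite subspace_continuousP. Qed.

Lemma cts_on_closedU (X T : topologicalType) (O K1 K2 : set X) (f : X -> T) :
  closed K1 -> closed K2 -> cts_on (K1 `&` O) f -> cts_on (K2 `&` O) f ->
  cts_on ((K1 `|` K2) `&` O) f.
Proof.
move=> c1 c2 f1 f2 x [K12x Ox] V fV.
have H K : closed K -> cts_on (K `&` O) f ->
    \forall y \near x, K y -> O y -> V (f y).
  move=> cK fK; have [Kx|nKx] := pselect (K x).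
    by have := fK x (conj Kx Ox) V fV; apply: filterS => y H ? ?; exact: H.
  have : nbhs x (~` K) by apply: open_nbhs_nbhs; split => //; exact: closed_openC.
  by apply: filterS => y nK /nK.
have := H _ c1 f1; have := H _ c2 f2; apply: filterS2 => y H2 H1 [[] ? ?].
  exact: H1.
exact: H2.
Qed.

Section Distance.
Context {X : topologicalType} {d : X -> X -> R}.
Hypothesis dX : metrizes d.

Let d0 x : d x x = 0. Proof. by case: dX. Qed.
Let dC x y : d x y = d y x. Proof. by case: dX. Qed.
Let dD y x z : d x z <= d x y + d y z. Proof. by case: dX. Qed.

Lemma metrized_nbhsP x A :
  nbhs x A <-> exists2 e, 0 < e & forall y, d x y < e -> A y.
Proof. by case: dX. Qed.

Lemma metrized_ge0 x y : 0 <= d x y.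
Proof. by have := dD y x x; rewrite d0 (dC y x); lra. Qed.

(* Truncating at 1 makes the distance to the empty set equal to 1. *)
Definition setdist (A : set X) x := inf ([set d x a | a in A] `|` [set 1]).

Let sd_inf A x : has_inf ([set d x a | a in A] `|` [set 1]).
Proof.
split; first by exists 1; right.
exists 0 => _ [[a _ <-]|->]; last exact: ler01.
exact: metrized_ge0.
Qed.

Lemma setdist_le A x a : A a -> setdist A x <= d x a.
Proof. by move=> Aa; apply: ge_inf; [case: (sd_inf A x)|left; exists a]. Qed.

Lemma setdist_le1 A x : setdist A x <= 1.
Proof. by apply: ge_inf; [case: (sd_inf A x)|right]. Qed.

Lemma setdist_ge0 A x : 0 <= setdist A x.
Proof.
apply: lb_le_inf; first by case: (sd_inf A x).
by move=> _ [[a _ <-]|->]; [exact: metrized_ge0|exact: ler01].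
Qed.

Lemma setdist_lt A x e : e <= 1 -> setdist A x < e -> exists2 a, A a & d x a < e.
Proof.
move=> e1 /(inf_lt (sd_inf A x).1) [_ [[a Aa <-]|->] lte]; first by exists a.
by move: lte; rewrite ltNge e1.
Qed.

Lemma setdist_lip A x y : setdist A x <= setdist A y + d x y.
Proof.
rewrite -lerBlDr; apply: lb_le_inf; first by case: (sd_inf A y).
move=> _ [[a Aa <-]|->].
  have := setdist_le x Aa; have := dD y x a; lra.
have := setdist_le1 A x; have := metrized_ge0 x y; lra.
Qed.

Lemma setdist_eq0 A x : closed A -> setdist A x = 0 -> A x.
Proof.
move=> cA s0; apply: cA => V /metrized_nbhsP[e e0 eV].
have [||a Aa xa] := @setdist_lt A x (Num.min e 1); first by rewrite ge_min lexx orbT.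
  by rewrite s0 lt_min e0 ltr01.
by exists a; split => //; apply: eV; apply: (lt_le_trans xa); rewrite ge_min lexx.
Qed.

Lemma setdist_self A x : A x -> setdist A x = 0.
Proof.
by move=> Ax; apply/eqP; rewrite eq_le setdist_ge0 andbT -(d0 x) setdist_le.
Qed.

Lemma setdist_gt0 A x : closed A -> ~ A x -> 0 < setdist A x.
Proof.
move=> cA nA; rewrite lt_neqAle setdist_ge0 andbT; apply/eqP => s0.
by apply: nA; apply: setdist_eq0.
Qed.

Lemma metrized_near x e : 0 < e -> \forall y \near x, d x y < e.
Proof. by move=> e0; apply/metrized_nbhsP; exists e. Qed.

Lemma setdist_cts A : continuous (setdist A).
Proof.
move=> x; apply/(@cvgrPdist_lt _ R^o) => e e0; have := metrized_near x e0.
apply: filterS => y xy; rewrite ltr_norml.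
by have := setdist_lip A x y; have := setdist_lip A y x; rewrite (dC y x); lra.
Qed.

Lemma metrized_dist_cts x : continuous (d x).
Proof.
move=> y; apply/(@cvgrPdist_lt _ R^o) => e e0; have := metrized_near y e0.
apply: filterS => z yz; rewrite ltr_norml.
by have := dD y x z; have := dD z x y; rewrite (dC z y); lra.
Qed.

Lemma metrized_normal : normal_space X.
Proof.
apply/(@normal_openP R) => A B cA cB AB.
exists [set x | setdist A x < setdist B x], [set x | setdist B x < setdist A x].
have op (f g : X -> R) : continuous f -> continuous g -> open [set x | f x < g x].
  move=> cf cg; have -> : [set x | f x < g x] = (fun x => g x - f x) @^-1` [set y | 0 < y].
    by apply/funext => x /=; rewrite subr_gt0.
  apply: open_comp; last exact: open_gt.
  by move=> x _; apply: cvgB; [exact: cg|exact: cf].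
split; [exact/op/setdist_cts/setdist_cts|exact/op/setdist_cts/setdist_cts| | |].
- move=> x Ax /=; rewrite (setdist_self Ax) setdist_gt0// => Bx.
  by have : set0 x by rewrite -AB.
- move=> x Bx /=; rewrite (setdist_self Bx) setdist_gt0// => Ax.
  by have : set0 x by rewrite -AB.
- by rewrite -subset0 => x [/= h1]; move/(lt_trans h1); rewrite ltxx.
Qed.

(** Comparing the distance to [K] with the distance to the complement of the interior of [G] cuts
    out such a set. *)
Lemma closed_nbhd_between (K G : set X) : closed K ->
  (forall x, K x -> nbhs x G) ->
  exists E, [/\ closed E, E `<=` G & forall x, K x -> nbhs x E].
Proof.
move=> cK KG; pose C := ~` (interior G).
have cC : closed C by apply: open_closedC; exact: open_interior.
exists [set x | setdist K x <= setdist C x]; split.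
- have -> : [set x | setdist K x <= setdist C x] =
     (fun x => setdist C x - setdist K x) @^-1` [set y | 0 <= y].
    by apply/funext => x /=; rewrite subr_ge0.
  apply: closed_comp; last exact: closed_ge.
  by move=> x _; apply: cvgB; exact: setdist_cts.
- move=> x /= sx; apply: interior_subset; apply: contrapT => nG.
  have sC : setdist C x = 0 by rewrite setdist_self.
  apply: nG; apply: KG; apply: setdist_eq0 => //.
  by apply/eqP; rewrite eq_le setdist_ge0 -sC sx.
- move=> x Kx; have : 0 < setdist C x.
    by apply: setdist_gt0 => // nG; apply: nG; exact: KG.
  move=> s0; have := metrized_near x (divr_gt0 s0 (ltr0n R 2)).
  apply: filterS => y /= xy.
  have := setdist_le y Kx; have := setdist_lip C x y; rewrite (dC y x); lra.
Qed.

End Distance.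
End Metrized.

(** * Absolute neighbourhood extensors *)

Definition ane (R : realType) (T : topologicalType) (S : set T) :=
  forall (X : topologicalType) (d : X -> X -> R), metrizes d ->
  forall (K : set X) (f : X -> T),
    closed K -> cts_on K f -> (forall x, K x -> S (f x)) ->
  exists (O : set X) (g : X -> T),
    [/\ open O, K `<=` O, cts_on O g, forall x, K x -> g x = f x
      & forall x, O x -> S (g x)].
Arguments ane R {T} S.

Definition loc_ane (R : realType) (T : topologicalType) (S : set T) :=
  forall s, S s -> exists U, [/\ open U, U s & ane R (S `&` U)].
Arguments loc_ane R {T} S.

Section ANE.
Context {R : realType}.

Lemma ane_open (T : topologicalType) (S U : set T) :
  ane R S -> open U -> ane R (S `&` U).
Proof.
move=> aS oU X d dX K f cK cf KS.
have [ O [g [ oO KO cg gf OS]]] := aS X d dX K f cK cf (fun x Kx => (KS x Kx).1).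
exists (O `&` g @^-1` U), g; split.
- exact: cts_on_open.
- by move=> x Kx; split; [exact: KO|rewrite /= gf//; exact: (KS x Kx).2].
- by apply: cts_on_sub cg => x [].
- exact: gf.
- by move=> x [Ox Ux]; split => //; exact: OS.
Qed.

(** The retraction [r] lands in [SB] but possibly outside [U], so the extension [r \o g] is cut back
    to the preimage of [U]. *)
Lemma ane_retract (T T' : topologicalType) (SB U : set T) (S' : set T')
    (i : T -> T') (r : T' -> T) :
  ane R S' -> open U -> cts_on (SB `&` U) i ->
  (forall s, SB s -> U s -> S' (i s)) -> cts_on S' r ->
  (forall s, S' s -> SB (r s)) -> (forall s, SB s -> U s -> r (i s) = s) ->
  ane R (SB `&` U).
Proof.
move=> aS' oU ci iS' cr rS ri X d dX K f cK cf KS.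
have [| |O [g [ oO KO cg gf OS]]] := aS' X d dX K (i \o f) cK.
- exact: (cts_on_comp KS cf ci).
- by move=> x Kx; apply: iS'; have [] := KS x Kx.
have crg : cts_on O (r \o g) by exact: (cts_on_comp OS cg cr).
exists (O `&` (r \o g) @^-1` U), (r \o g); split.
- exact: cts_on_open.
- move=> x Kx; split; first exact: KO.
  by have [? ?] := KS x Kx; rewrite /= gf//= ri.
- by apply: cts_on_sub crg => x [].
- by move=> x Kx /=; have [? ?] := KS x Kx; rewrite gf//= ri.
- by move=> x [Ox Ux]; split => //; apply: rS; exact: OS.
Qed.

Lemma ane_retractT (T T' : topologicalType) (S : set T) (S' : set T')
    (i : T -> T') (r : T' -> T) :
  ane R S' -> cts_on S i -> (forall s, S s -> S' (i s)) -> cts_on S' r ->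
  (forall s, S' s -> S (r s)) -> (forall s, S s -> r (i s) = s) ->
  ane R S.
Proof.
move=> aS' ci iS' cr rS ri; rewrite -(setIT S).
have ci' : cts_on (S `&` setT) i by rewrite setIT.
exact: (ane_retract aS' openT ci' (fun s Ss _ => iS' s Ss) cr rS
  (fun s Ss _ => ri s Ss)).
Qed.

Lemma ane_setX (T T' : topologicalType) (S : set T) (S' : set T') :
  ane R S -> ane R S' -> ane R (S `*` S').
Proof.
move=> aS aS' X d dX K f cK cf KS.
have [|O [g [ oO KO cg gf OS]]] := aS X d dX K _ cK (cts_on_fst cf).
  by move=> x /KS[].
have [|O' [g' [oO' KO' cg' gf' OS']]] := aS' X d dX K _ cK (cts_on_snd cf).
  by move=> x /KS[].
exists (O `&` O'), (fun x => (g x, g' x)); split.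
- exact: openI.
- by move=> x Kx; split; [exact: KO|exact: KO'].
- apply: (@cts_on_pair _ _ _ _ g g').
    by apply: cts_on_sub cg => x [].
  by apply: cts_on_sub cg' => x [].
- by move=> x Kx; rewrite gf// gf'//; case: (f x).
- by move=> x [Ox O'x]; split => /=; [exact: OS|exact: OS'].
Qed.

Lemma ane_set0 (T : topologicalType) : ane R (set0 : set T).
Proof.
move=> X d dX K f cK cf KS; exists set0, f.
by split => //; exact: open0.
Qed.

(** * Gluing local extensions *)

Section Gluing.
Context {X : topologicalType} {d : X -> X -> R}.
Hypothesis dX : metrizes d.
Context {T : topologicalType} {S : set T}.
Hypothesis aneS : loc_ane R S.
Context {Om K : set X} {f : X -> T}.
Hypotheses (oOm : open Om) (cK : closed K) (cf : cts_on (K `&` Om) f).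
Hypothesis KS : forall x, K x -> Om x -> S (f x).

(** By separability, countably many balls suffice, each so small that it stays in [Om] and that [f]
    maps its part of [K] into one set [U n] with the extension property. *)
Let cover : exists (c : nat -> X) (e : nat -> R) (U : nat -> set T),
  [/\ forall n, open (U n), forall n, ane R (S `&` U n),
      forall n x, d (c n) x <= e n -> Om x,
      forall n x, K x -> d (c n) x <= e n -> U n (f x)
    & forall x, K x -> Om x -> exists n, d (c n) x < e n].
Proof.
have [d0 dC dD _ [z zP]] := dX.
pose good (c : X) (e : R) (U : set T) := [/\ open U, ane R (S `&` U),
  forall x, d c x <= e -> Om x & forall x, K x -> d c x <= e -> U (f x)].
(* The index [n] codes a centre from the dense sequence together with a radius 1/(k+1). *)
pose c n := z (odflt (0%N, 0%N) (unpickle n)).1.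
pose r n : R := (odflt (0%N, 0%N) (unpickle n)).2.+1%:R^-1.
have : forall n, exists p : R * set T, good (c n) p.1 p.2 /\
    ((exists U, good (c n) (r n) U) -> p.1 = r n).
  move=> n; have [[U gU]|ng] := pselect (exists U, good (c n) (r n) U).
    by exists (r n, U).
  (* A negative radius makes the ball empty when no suitable [U] exists, so the conditions on its
     points hold vacuously. *)
  exists (-1, set0); split => //; split => //=; [exact: open0| | |].
  - by rewrite setI0; exact: ane_set0.
  - by move=> x; have := metrized_ge0 dX (c n) x; lra.
  - by move=> x _; have := metrized_ge0 dX (c n) x; lra.
move=> /choice[p pP]; exists c, (fun n => (p n).1), (fun n => (p n).2); split.
- by move=> n; have [[]] := pP n.
- by move=> n; have [[]] := pP n.
- by move=> n; have [[]] := pP n.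
- by move=> n; have [[]] := pP n.
move=> x Kx Ox; have [U [ oU Ufx aU]] := aneS (KS Kx Ox).
have : \forall y \near x, Om y /\ (K y -> U (f y)).
  apply: filterS2 (open_nbhs_nbhs (conj oOm Ox)) (cf (conj Kx Ox) (open_nbhs_nbhs (conj oU Ufx))).
  by move=> y Oy H; split => // Ky; exact: H.
move=> /(metrized_nbhsP dX)[e e0 eP].
have [k ke] : exists k, k.+1%:R^-1 < e / 2 :> R.
  have e20 : 0 < e / 2 by rewrite divr_gt0.
  exists (Num.truncn (e / 2)^-1).
  by rewrite -[ltRHS]invrK ltf_pV2 ?posrE ?invr_gt0// truncnS_gt.
have k0 : 0 < k.+1%:R^-1 :> R by rewrite invr_gt0 ltr0n.
have [i xi] := zP x _ k0.
have cE : c (pickle (i, k)) = z i by rewrite /c pickleK.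
have rE : r (pickle (i, k)) = k.+1%:R^-1 by rewrite /r pickleK.
have near_x y : d (z i) y <= k.+1%:R^-1 -> d x y < e.
  move=> h; apply: (le_lt_trans (dD x (z i) y)).
  by rewrite [ltRHS]splitr ltrD// ?(le_lt_trans h)// (lt_trans xi).
exists (pickle (i, k)); have [_ ->] := pP (pickle (i, k)).
  by rewrite cE rE dC.
exists U; split => //; rewrite cE rE => y; first by move=> /near_x/eP[].
by move=> Ky /near_x/eP[_ /(_ Ky)].
Qed.

(** The sets [C n], balls with the earlier open balls removed, form a locally finite closed cover of
    the union [Om'] of the open balls. The map is extended over one [C n] after another; the
    invariant that points of [C j] are always sent into [U j] keeps every later extension problem
    solvable. *)
Lemma loc_ane_extension : exists (O : set X) (g : X -> T),
  [/\ open O, O `<=` Om, K `&` Om `<=` O, cts_on O g &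
     (forall x, K x -> Om x -> g x = f x) /\ forall x, O x -> S (g x)].
Proof.
have [c [e [U [ oU aU cOm cU cov]]]] := cover.
have [d0 dC dD _ _] := dX.
pose C n := [set x | d (c n) x <= e n /\ forall j, (j < n)%N -> e j <= d (c j) x].
pose Om' := [set x | exists n, d (c n) x < e n].
have cC n : closed (C n).
  have -> : C n = [set x | d (c n) x <= e n] `&`
      \bigcap_(j in [set j | (j < n)%N]) [set x | e j <= d (c j) x].
    by apply/funext => x; apply/propext; split.
  apply: closedI; last apply: closed_bigI => j _.
  - apply: (@closed_comp _ _ (d (c n)) [set y | y <= e n]); last exact: closed_le.
    by move=> x _; exact: metrized_dist_cts.
  - apply: (@closed_comp _ _ (d (c j)) [set y | e j <= y]); last exact: closed_ge.
    by move=> x _; exact: metrized_dist_cts.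
have oOm' : open Om'.
  have -> : Om' = \bigcup_n [set x | d (c n) x < e n].
    by apply/funext => x; apply/propext; split => [[n]|[n _]]; exists n.
  apply: bigcup_open => n _.
  apply: (@open_comp _ _ (d (c n)) [set y | y < e n]); last exact: open_lt.
  by move=> x _; exact: metrized_dist_cts.
have Om'Om x : Om' x -> Om x by move=> [n /ltW]; exact: cOm.
have Ccov x : Om' x -> exists n, C n x.
  move=> xO; have := ex_minnP xO => -[n n1 n2]; exists n; split; first exact: ltW.
  move=> j jn; rewrite leNgt; apply/negP => /n2.
  by rewrite leqNgt jn.
have Clf x : Om' x -> exists n, \forall y \near x, forall i, (n < i)%N -> ~ C i y.
  move=> [n nx]; exists n.
  have : nbhs x [set y | d (c n) y < e n].
    apply: open_nbhs_nbhs; split => //.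
    apply: (@open_comp _ _ (d (c n)) [set y | y < e n]); last exact: open_lt.
    by move=> y _; exact: metrized_dist_cts.
  by apply: filterS => y /= ny i ni [_ /(_ _ ni)]; rewrite leNgt ny.
pose valid (s : set X * (X -> T)) := [/\ closed s.1, cts_on (s.1 `&` Om') s.2,
  forall j x, s.1 x -> C j x -> Om' x /\ U j (s.2 x) &
  forall x, s.1 x -> Om' x -> S (s.2 x)].
(* That [E] is a neighbourhood of the old domain inside [C n] is what makes the union of all domains
   a neighbourhood of [K]&[Om]. *)
pose step n (s s' : set X * (X -> T)) := (forall x, s.1 x -> s'.2 x = s.2 x) /\
  exists2 E, s'.1 = s.1 `|` (C n `&` E) & forall x, s.1 x -> C n x -> nbhs x E.
have stepP n s : valid s -> exists s', valid s' /\ step n s s'.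
  case: s => K1 g1 [/= cK1 cg1 K1C K1S].
  have [| | |O [g [ oO KO cg gf OS]]] := aU n X d dX (K1 `&` C n) g1.
  - exact: closedI.
  - by apply: cts_on_sub cg1 => x [Kx /(K1C n x Kx)[]].
  - by move=> x [Kx Cx]; have [xO Ux] := K1C n x Kx Cx; split => //; exact: K1S.
  (* Local finiteness of the [C j] reduces the infinitely many conditions in [G] to finitely many
     near each point. *)
  pose G := [set x | [/\ O x, Om' x & forall j, C j x -> U j (g x)]].
  have KG x : (K1 `&` C n) x -> nbhs x G.
    move=> KCx; have [Kx Cx] := KCx; have [xO' _] := K1C n x Kx Cx.
    have [n0 n0P] := Clf x xO'.
    have xO : O x by exact: KO.
    have : \forall y \near x, forall j : 'I_n0.+1, C j y -> O y -> U j (g y).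
      apply: filter_forall => j; have [Cj|nCj] := pselect (C j x).
        have : nbhs (g x) (U j).
          apply: open_nbhs_nbhs; split => //; rewrite gf//.
          by have [] := K1C j x Kx Cj.
        by move=> /(cg x xO); apply: filterS => y H _ /H.
      have : nbhs x (~` C j).
        by apply: open_nbhs_nbhs; split => //; exact: closed_openC.
      by apply: filterS => y /= H /H.
    apply: filterS3 n0P (filterI (open_nbhs_nbhs (conj oO xO)) (open_nbhs_nbhs (conj oOm' xO'))) .
    move=> y yn [yO yO'] yj; split => // j Cj.
    have [jn|nj] := ltnP j n0.+1; first exact: (yj (Ordinal jn)).
    by have := yn j nj.
  have [E [cE EG KE]] := closed_nbhd_between dX (closedI cK1 (cC n)) KG.
  pose g' x := if pselect (K1 x) then g1 x else g x.
  have g'1 x : K1 x -> g' x = g1 x by rewrite /g'; case: pselect.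
  have g'g x : C n x -> E x -> g' x = g x.
    by rewrite /g'; case: pselect => // Kx Cx _; rewrite gf.
  exists (K1 `|` (C n `&` E), g'); split; last first.
    by split => //=; exists E => // x Kx Cx; exact: KE.
  split => /=.
  - by apply: closedU => //; exact: closedI.
  - apply: cts_on_closedU => //; first exact: closedI.
      by apply: cts_on_ext cg1 => x [/g'1].
    apply: (@cts_on_ext _ _ _ g) => [x [[Cx Ex] _]|]; first by rewrite g'g.
    by apply: cts_on_sub cg => x [[_ /EG[]]].
  - move=> j x [Kx|[Cx Ex]] Cj; first by rewrite g'1//; exact: K1C.
    by rewrite g'g//; have [Ox O'x H] := EG x Ex; split => //; exact: H.
  - move=> x [Kx|[Cx Ex]] xO; first by rewrite g'1//; exact: K1S.
    by rewrite g'g//; have [Ox _ _] := EG x Ex; have [] := OS x Ox.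
have v0 : valid (K, f).
  split => //=.
  - by apply: cts_on_sub cf => x [? /Om'Om].
  - move=> j x Kx [Cj _]; split; last exact: cU Cj.
    by have [|n nx] := cov x Kx; [exact: cOm Cj|exists n].
  - by move=> x Kx /Om'Om; exact: KS.
have : forall ns : nat * {s | valid s}, exists s' : {s | valid s},
    step ns.1 (sval ns.2) (sval s').
  by move=> [n [s vs]]; have [s' [vs' ss']] := stepP n s vs; exists (exist _ s' vs').
move=> /choice[F FP].
pose s := fix s n : {s | valid s} := if n is n'.+1 then F (n', s n') else exist _ (K, f) v0.
pose KK n := (sval (s n)).1; pose gg n := (sval (s n)).2.
have vs n : valid (KK n, gg n) by have := svalP (s n); rewrite /KK /gg; case: (sval _).
have stp n : step n (sval (s n)) (sval (s n.+1)) by exact: (FP (n, s n)).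
have KK1 n : KK n `<=` KK n.+1.
  by have [_ [E + _]] := stp n; rewrite /KK => -> x; left.
have KKm n p : (n <= p)%N -> KK n `<=` KK p.
  elim: p => [|p IH]; first by rewrite leqn0 => /eqP ->.
  by rewrite leq_eqVlt => /predU1P[->//|/IH]; move=> h x /h/KK1.
have ggm n p x : (n <= p)%N -> KK n x -> gg p x = gg n x.
  elim: p => [|p IH]; first by rewrite leqn0 => /eqP ->.
  rewrite leq_eqVlt => /predU1P[->//|np Kx]; rewrite -(IH np Kx).
  by have [+ _] := stp p; apply; exact: KKm Kx.
(* Points added after stage [n] lie in some later [C i]. Near a given point of [Om'] there are none
   of these, so the domains and the maps are locally constant from some stage on. *)
have KKloc n p x : KK p x -> ~ KK n x -> exists2 i, (n <= i)%N & C i x.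
  elim: p => [K0 nK|p IH Kp1 nK].
    by exfalso; apply: nK; exact: (@KKm 0%N).
  have [Kp|nKp] := pselect (KK p x); first exact: IH.
  have [_ [E EP _]] := stp p; have : KK p.+1 x by [].
  rewrite /KK EP => -[//|[Cp _]].
  exists p => //; rewrite leqNgt; apply/negP => pn; apply: nK.
  exact: (KKm p.+1).
pose NN x := xget 0%N [set n | KK n x].
pose G x := gg (NN x) x.
have GE n x : KK n x -> G x = gg n x.
  move=> Kx; have KN : KK (NN x) x.
    by rewrite /NN; case: xgetP => [y _ //|/(_ n)]; case.
  rewrite /G; have [/ggm->//|/ltnW/ggm->//] := leqP (NN x) n.
pose OO := interior (Om' `&` \bigcup_n KK n).
have OOP x : OO x -> Om' x /\ (\bigcup_n KK n) x by exact: (@interior_subset _ (Om' `&` _)).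
exists OO, G; split.
- exact: open_interior.
- by move=> x /OOP[/Om'Om].
- move=> x [Kx Ox].
  have xO : Om' x by exact: cov.
  have [n0 n0P] := Clf x xO.
  have : \forall y \near x, forall j : 'I_n0.+1, C j y -> KK j.+1 y.
    apply: filter_forall => j; have [Cj|nCj] := pselect (C j x).
      have [_ [E EP KE]] := stp j.
      have := KE x (KKm 0%N j (leq0n _) x Kx) Cj.
      by apply: filterS => y Ey Cy; rewrite /KK EP; right.
    have : nbhs x (~` C j).
      by apply: open_nbhs_nbhs; split => //; exact: closed_openC.
    by apply: filterS => y /= H /H.
  rewrite /OO /interior/=; apply: filterS3 n0P (open_nbhs_nbhs (conj oOm' xO)).
  move=> y yn yO yj; split => //; have [j Cj] := Ccov y yO.
  have [jn|nj] := ltnP j n0.+1; first by exists j.+1 => //; exact: (yj (Ordinal jn)).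
  by have := yn j nj.
- move=> x OOx; have [xO [n1 _ xn1]] := OOP x OOx.
  have [n0 n0P] := Clf x xO.
  have K0 y : (forall i, (n0 < i)%N -> ~ C i y) -> (\bigcup_n KK n) y -> KK n0.+1 y.
    move=> yn [p _ Kp]; apply: contrapT => /(KKloc _ _ _ Kp)[i ni Ci].
    exact: yn Ci.
  have xK : KK n0.+1 x by apply: K0; [exact: nbhs_singleton n0P|exists n1].
  rewrite (GE _ _ xK) => V gV.
  have [_ cg _ _] := vs n0.+1.
  have := cg x (conj xK xO) V gV.
  apply: filterS2 n0P => y yn H /OOP[yO yK].
  by have Ky := K0 y yn yK; rewrite (GE _ _ Ky); exact: H.
- split.
    by move=> x Kx Ox; rewrite (GE 0%N).
  move=> x /OOP[xO [n _ Kx]]; rewrite (GE n)//.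
  by have [_ _ _ /(_ x Kx xO)] := vs n.
Qed.

End Gluing.

Lemma ane_of_local (T : topologicalType) (S : set T) :
  loc_ane R S -> ane R S.
Proof.
move=> aS X d dX K f cK cf KS.
have [| |O [g [ oO OT KO cg [gf OS]]]] :=
  loc_ane_extension dX aS openT cK (f := f).
- by rewrite setIT.
- by move=> x Kx _; exact: KS.
exists O, g; split => //; first by move=> x Kx; exact: KO.
by move=> x Kx; exact: gf.
Qed.

End ANE.

(** * Gluing along a homotopy *)

Section Cone.
Context {R : realType}.

(* Local extensors extend [f] off the preimage of K0, to values close to those of
   [f]; as one moves away from K, [kap] slides this extension into K0, where an
   extension with values in [N `&` K0] takes over. *)
Lemma ane_cone (T : topologicalType) (S U K0 : set T) (kap : R -> T -> T)
    (E : nat -> T -> R) (N := S `&` U) :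
  open U -> closed K0 -> ane R (N `&` K0) -> loc_ane R (N `&` ~` K0) ->
  (forall j, cts_on N (E j)) ->
  (forall s, N s -> forall V, nbhs s V -> exists n e, 0 < e /\
    forall t, N t -> (forall j, (j < n)%N -> `|E j t - E j s| < e) -> V t) ->
  cts_on [set z : R * T | 0 <= z.1 <= 1 /\ N z.2] (fun z => kap z.1 z.2) ->
  (forall c s, 0 <= c <= 1 -> N s -> S (kap c s)) ->
  (forall s, N s -> kap 1 s = s) ->
  (forall s, N s -> (N `&` K0) (kap 0 s)) ->
  (forall c s, 0 <= c <= 1 -> (N `&` K0) s -> kap c s = s) ->
  ane R N.
Proof.
move=> oU cK0 aN0 aN1 cE genE ckap kS k1 k0 kid X d dX K f cK cf KN.
have [d0 dC dD _ _] := dX.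
(* Every [kap c] fixes [s]; compactness of [0, 1] then gives one neighbourhood of [s] that works for
   all [c]. *)
have tube s V : (N `&` K0) s -> nbhs s V ->
    \forall t \near s, forall c, 0 <= c <= 1 -> N t -> V (kap c t).
  move=> N0s Vs.
  have /compact_near_coveringP := @segment_compact R 0 1.
  move=> /(_ T (nbhs s) (fun t c => 0 <= c <= 1 -> N t -> V (kap c t)) _) H.
  have : \forall t \near s, `[0, 1]%classic `<=` (fun c => 0 <= c <= 1 -> N t -> V (kap c t)).
    apply: H => c; rewrite /= in_itv/= => c01.
    have Vk : nbhs (kap (c, s).1 (c, s).2) V by rewrite /= (kid c s c01).
    have := ckap (c, s) (conj c01 (proj1 N0s)) V Vk.
    by apply: filterS => -[c' t] /= H' c01' Nt; apply: H'.
  by apply: filterS => t H' c c01; apply: (H' c); rewrite /= ?in_itv.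
pose Y0 := K `&` f @^-1` K0.
have cY0 : closed Y0 by exact: cts_on_closed.
have N0f y : Y0 y -> (N `&` K0) (f y) by move=> [Ky K0y]; split => //; exact: KN.
have [| |W [g [ oW WO KW cg [gf WN]]]] :=
  loc_ane_extension dX aN1 (closed_openC cY0) cK (f := f).
- by apply: cts_on_sub cf => x [].
- by move=> x Kx nY0; split; [exact: KN|move=> K0x; exact: nY0].
pose de y := setdist (d := d) Y0 y.
(* As [T] carries no metric, nearness of [g x] to [f y] is measured by the coordinates [E j]: more
   of them, and to a finer precision, as [y] approaches [Y0]. This makes [g] on [W1] and [f] on [Y0]
   fit together continuously. *)
pose close x y := [/\ K y, ~ Y0 y, d x y < de y / 2 &
  forall j, j%:R * de y <= 1 -> `|E j (g x) - E j (f y)| < de y].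
pose W1 := [set x | W x /\ exists y, close x y].
have oW1 : open W1.
  rewrite openE => x [Wx [y [Ky nY0y xy Ej]]].
  have de0 : 0 < de y by exact: setdist_gt0.
  have n1 : \forall z \near x, d z y < de y / 2.
    have /(metrized_near dX x) : 0 < de y / 2 - d x y by rewrite subr_gt0.
    by apply: filterS => z; have := dD z x y; rewrite (dC z x); lra.
  pose M := (Num.truncn (de y)^-1).+1.
  have n2 : \forall z \near x, forall j : 'I_M, j%:R * de y <= 1 -> W z ->
       `|E j (g z) - E j (f y)| < de y.
    apply: filter_forall => j.
    have [jd|nj] := pselect (j%:R * de y <= 1); last first.
      by apply: nearW => z /nj.
    have cEg : cts_on W (E j \o g).
      by apply: (cts_on_comp (L := N)) => // z /WN[].
    have : nbhs ((E j \o g) x) [set r | `|r - E j (f y)| < de y].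
      apply: (@open_nbhs_nbhs R); split => /=; last exact: Ej.
      have -> : [set r | `|r - E j (f y)| < de y] = ball (E j (f y)) (de y).
        by apply/funext => r; rewrite /ball/= distrC.
      exact: ball_open.
    by move=> /(cEg x Wx); apply: filterS => z /= H _ /H.
  apply: filterS3 n1 n2 (open_nbhs_nbhs (conj oW Wx)) => z z1 z2 Wz.
  split => //; exists y; split => // j jd.
  have jM : (j < M)%N.
    rewrite -(ltr_nat R); apply: le_lt_trans (truncnS_gt _).
    by rewrite -[leRHS]mul1r ler_pdivlMr.
  exact: (z2 (Ordinal jM)).
have KW1 x : K x -> ~ Y0 x -> W1 x.
  move=> Kx nY; have Wx : W x by exact: KW.
  have de0 : 0 < de x by exact: setdist_gt0.
  split => //; exists x; split => //; first by rewrite d0 divr_gt0.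
  by move=> j _; rewrite gf// subrr normr0.
pose u := setdist (d := d) (~` W1); pose v := setdist (d := d) K.
have u0 x : W1 x -> 0 < u x.
  by move=> Wx; apply: setdist_gt0 => //; exact: open_closedC.
have v0 x : ~ K x -> 0 < v x by exact: setdist_gt0.
have u_ge0 x : 0 <= u x by exact: setdist_ge0.
have v_ge0 x : 0 <= v x by exact: setdist_ge0.
have uW1 x : 0 < u x -> W1 x.
  move=> ux; apply: contrapT => nW; move: ux.
  by rewrite /u setdist_self// ltxx.
have vK x : K x -> v x = 0 by exact: setdist_self.
(* A closed set that contains [K] and lies in the union of [Y0] and [W1]: off [K] one has [v > 0],
   so [v <= u] forces [u > 0]. *)
pose W' := [set x | v x <= u x].
have cW' : closed W'.
  have -> : W' = (fun x => u x - v x) @^-1` [set y | 0 <= y].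
    by apply/funext => x /=; rewrite subr_ge0.
  apply: closed_comp; last exact: closed_ge.
  by move=> x _; apply: cvgB; exact: setdist_cts.
have W'P x : W' x -> Y0 x \/ W1 x.
  move=> xW; have [Kx|/v0 vx] := pselect (K x).
    by have [?|/(KW1 _ Kx)] := pselect (Y0 x); [left|right].
  by right; apply: uW1; exact: lt_le_trans xW.
pose G1 x := if pselect (W x) then g x else f x.
have G1g x : W1 x -> G1 x = g x by rewrite /G1 => -[Wx _]; case: pselect.
have G1f x : Y0 x -> G1 x = f x.
  by move=> Yx; rewrite /G1; case: pselect => // Wx; case: (WO x Wx).
have G1K x : K x -> G1 x = f x.
  by move=> Kx; rewrite /G1; case: pselect => // Wx; rewrite gf//; exact: (WO x Wx).
have G1N x : W' x -> N (G1 x).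
  move=> W'x; have [Yx|W1x] := W'P x W'x.
    by rewrite G1f//; apply: KN; case: Yx.
  by rewrite G1g//; case: W1x => Wx _; case: (WN x Wx).
have cG1 : cts_on W' G1.
  move=> x W'x V Vx; have [Y0x|W1x] := W'P x W'x; last first.
    rewrite G1g// in Vx.
    apply: filterS2 (open_nbhs_nbhs (conj oW1 W1x)) (cg x W1x.1 V Vx) => z W1z H _.
    by rewrite G1g//; apply: H; case: W1z.
  rewrite G1f// in Vx; have [Kx K0x] := Y0x.
  have [n [e [e0 eV]]] := genE _ (KN x Kx) V Vx.
  have n1 : \forall y \near x, forall j : 'I_n, K y -> `|E j (f y) - E j (f x)| < e / 2.
    apply: filter_forall => j.
    have cEf : cts_on K (E j \o f) by exact: (cts_on_comp KN).
    have : nbhs ((E j \o f) x) [set r | `|r - E j (f x)| < e / 2].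
      have : nbhs (E j (f x)) (ball (E j (f x)) (e / 2)) by apply: nbhsx_ballx; rewrite divr_gt0.
      by apply: filterS => r; rewrite /ball/= distrC.
    by move=> /(cEf x Kx); apply: filterS => y /= H /H.
  have [e1 e10 e1P] := (metrized_nbhsP dX _ _).1 n1.
  have [e2 e20 e2P] : exists2 e2 : R, 0 < e2 & [/\ e2 < e1, e2 < e / 2 & n%:R * e2 < 1].
    exists (Num.min (e1 / 2) (Num.min (e / 4) (n.+1%:R^-1 / 2))).
      by rewrite !lt_min !divr_gt0 ?invr_gt0.
    have h1 : Num.min (e1 / 2) (Num.min (e / 4) (n.+1%:R^-1 / 2)) <= e1 / 2.
      by rewrite ge_min lexx.
    have h2 : Num.min (e1 / 2) (Num.min (e / 4) (n.+1%:R^-1 / 2)) <= e / 4.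
      by rewrite !ge_min lexx orbT.
    have h3 : Num.min (e1 / 2) (Num.min (e / 4) (n.+1%:R^-1 / 2)) <= n.+1%:R^-1 / 2.
      by rewrite !ge_min lexx !orbT.
    have ninv : n%:R * n.+1%:R^-1 <= 1 :> R.
      by rewrite ler_pdivrMr ?ltr0n// mul1r ler_nat.
    split; [lra|lra|apply: (@le_lt_trans _ _ (n%:R * (n.+1%:R^-1 / 2)))].
      exact: ler_wpM2l.
    by rewrite mulrA ltr_pdivrMr// mul1r (le_lt_trans ninv)// ltr1n.
  have [e2e1 e2e ne2] := e2P.
  have := metrized_near dX x (divr_gt0 e20 (ltr0n R 2)); apply: filterS => z /= xz W'z.
  have xz1 : d x z < e1 by lra.
  have ee : e / 2 < e by lra.
  have [Y0z|W1z] := W'P z W'z.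
    have Kz : K z by case: Y0z.
    rewrite G1f//; apply: eV; first exact: KN.
    by move=> j jn; apply: (@lt_trans _ _ (e / 2)); [exact: (e1P z xz1 (Ordinal jn))|].
  rewrite G1g//; have [Wz [y [Ky nY0y zy Ej]]] := W1z.
  have dey : de y <= d y x by exact: setdist_le.
  have dxy : d x y < e2.
    by have := dD x z y; have := dD y z x; rewrite (dC y z) (dC z x) (dC y x) in dey *; lra.
  apply: eV; first by have [] := WN z Wz.
  move=> j jn; rewrite (dC y x) in dey.
  have jd : j%:R * de y <= 1.
    apply: le_trans (ltW ne2); apply: ler_pM => //; first exact: setdist_ge0.
      by rewrite ler_nat ltnW.
    lra.
  have h1 := Ej j jd; have h2 := e1P y (lt_trans dxy e2e1) (Ordinal jn) Ky.
  rewrite /= in h2.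
  have := ler_normD (E j (g z) - E j (f y)) (E j (f y) - E j (f x)).
  rewrite addrA subrK; lra.
have c0 : cts_on W' (kap 0 \o G1).
  have cp : cts_on W' (fun x => (0, G1 x) : R * T).
    by apply: (@cts_on_pair _ _ _ _ (fun=> 0)) => //; exact: cts_on_cst.
  apply: (cts_on_comp (f := fun x => (0, G1 x) : R * T) (g := fun z => kap z.1 z.2) _ cp ckap).
  by move=> x W'x /=; split; [rewrite lexx ler01|exact: G1N].
(* The end of the homotopy takes values in [N]&[K0] and therefore extends off [W']. *)
have [|O [G0 [ oO WO' cG0 G0E G0N]]] := aN0 X d dX W' (kap 0 \o G1) cW' c0.
  by move=> x W'x; apply: k0; exact: G1N.
(* The parameter is 1 on [K] off [Y0] and 0 where [u = v]. On [Y0] it reads 0/0, with value 0; any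
   value would do there, since [kap] fixes the points of [N]&[K0]. *)
pose c x := (u x - v x) / (u x + v x).
have c01 x : W' x -> 0 <= c x <= 1.
  rewrite /W'/= => vu; apply/andP; split.
    by apply: divr_ge0; [rewrite subr_ge0|exact: addr_ge0].
  rewrite /c; have [->|uv0] := eqVneq (u x + v x) 0; first by rewrite invr0 mulr0.
  rewrite ler_pdivrMr; last by rewrite lt_neqAle eq_sym uv0 (addr_ge0 (u_ge0 x) (v_ge0 x)).
  by have := v_ge0 x; lra.
have cc x : u x + v x != 0 -> {for x, continuous c}.
  move=> uv0; have cu : {for x, continuous u} by exact: setdist_cts.
  have cv : {for x, continuous v} by exact: setdist_cts.
  by apply: cvgM; [exact: cvgB|apply: cvgV => //; exact: cvgD].
pose F x := if pselect (W' x) then kap (c x) (G1 x) else G0 x.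
have FW x : W' x -> F x = kap (c x) (G1 x) by rewrite /F; case: pselect.
have FO x : ~ W' x -> F x = G0 x by rewrite /F; case: pselect.
have KW' x : K x -> W' x by move=> Kx; rewrite /W'/= vK.
have FK x : K x -> F x = f x.
  move=> Kx; have W'x := KW' x Kx; rewrite FW// G1K//.
  have [Yx|/(KW1 _ Kx)/u0 ux] := pselect (Y0 x).
    by rewrite kid//; [exact: c01|exact: N0f].
  by rewrite /c vK// subr0 addr0 divff ?gt_eqF// k1//; exact: KN.
have FS x : O x -> S (F x).
  move=> Ox; have [W'x|nW'] := pselect (W' x).
    by rewrite FW//; apply: kS; [exact: c01|exact: G1N].
  by rewrite FO//; have [[]] := G0N x Ox.
have cF : cts_on O F.
  move=> x Ox V VF.
  have [W'x|nW'] := pselect (W' x); last first.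
    rewrite FO// in VF.
    apply: filterS2 (cG0 x Ox V VF) (open_nbhs_nbhs (conj (closed_openC cW') nW')) => z H nW'z Oz.
    by rewrite FO//; exact: H.
  (* Where [v < u] fails, or on [Y0], the homotopy has reached its end, so that [F x = G0 x] and
     [G0] continues [F] beyond [W']. *)
  have out : nbhs (G0 x) V \/ (\forall z \near x, W' z).
    have [Y0x|W1x] := W'P x W'x.
      left; rewrite G0E//= G1f// kid ?lexx ?ler01//; last exact: N0f.
      by rewrite FK// in VF; case: Y0x.
    have [vu|] := ltP (v x) (u x).
      right; have H : (fun z => u z - v z) @ x --> u x - v x.
        by apply: cvgB; exact: setdist_cts.
      have : nbhs x [set z | 0 < u z - v z].
        by apply: (H [set y : R | 0 < y]); apply: open_nbhs_nbhs; split; [exact: open_gt|rewrite /= subr_gt0].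
      by apply: filterS => z /=; rewrite subr_gt0 => /ltW.
    move=> uv; left; rewrite G0E//=.
    have -> : 0 = c x.
      by have -> : c x = 0; rewrite // /c; have -> : u x = v x; rewrite ?subrr ?mul0r//; apply/eqP; rewrite eq_le uv.
    by rewrite -FW.
  have inn : \forall z \near x, W' z -> V (F z).
    have [Y0x|W1x] := W'P x W'x.
      rewrite FK// in VF; last by case: Y0x.
      have := tube _ V (N0f _ Y0x) VF; rewrite -(G1f x)// => /(cG1 x W'x).
      by apply: filterS => z H W'z; rewrite FW//; apply: H => //; [exact: c01|exact: G1N].
    have cx : {for x, continuous c}.
      by apply: cc; rewrite gt_eqF// ltr_pwDl// u0.
    have cp : nbhs x [set z | W' z -> V (kap (c z) (G1 z))].
      rewrite FW// in VF.
      have := ckap (c x, G1 x) (conj (c01 _ W'x) (G1N _ W'x)) V VF.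
      move=> [[P Q] [/= Pc QG] PQV].
      have cP : nbhs x (c @^-1` P) := cx P Pc.
      apply: filterS2 cP (cG1 x W'x Q QG) => z Pz Qz W'z.
      apply: (PQV (c z, G1 z)); first by split => //=; exact: Qz.
      by split => /=; [exact: c01|exact: G1N].
    by apply: filterS cp => z H W'z; rewrite FW//; exact: H.
  case: out => [VG|W'n].
    apply: filterS2 inn (cG0 x Ox V VG) => z Hi Ho Oz.
    have [W'z|nW'z] := pselect (W' z); first exact: Hi.
    by rewrite FO//; exact: Ho.
  by apply: filterS2 inn W'n => z Hi W'z _; exact: Hi.
(* Intermediate stages of [kap] stay in [S] but may leave [U]; the domain is shrunk accordingly. *)
exists (O `&` F @^-1` U), F; split.
- exact: cts_on_open.
- by move=> x Kx; split; [exact/WO'/KW'|rewrite /= FK//; have [] := KN x Kx].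
- by apply: cts_on_sub cF => x [].
- exact: FK.
- by move=> x [Ox Ux]; split => //; exact: FS.
Qed.

End Cone.

(** * Matrices *)

Section ComplexNorm.
Context {R : realType}.
Local Notation C := (Cplx R).

Definition toC (r : R) : C := real_complex R r.
Definition cRe (z : C) : R := complex.Re z.
Definition cIm (z : C) : R := complex.Im z.
Definition cnorm (z : C) : R := complex.Re `|z|.

HB.instance Definition _ := GRing.RMorphism.copy toC (real_complex R).

Lemma toCK r : cRe (toC r) = r. Proof. by []. Qed.
Lemma toC_inj : injective toC. Proof. by move=> x y []. Qed.
Lemma normCE (z : C) : `|z| = toC (cnorm z). Proof. by []. Qed.
Lemma toC_le (x y : R) : (toC x <= toC y) = (x <= y). Proof. exact: lecR. Qed.
Lemma toC_lt (x y : R) : (toC x < toC y) = (x < y). Proof. exact: ltcR. Qed.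
Lemma cRe_is_additive : {morph cRe : x y / x - y}.
Proof. by case=> [a b] [c d]. Qed.
Lemma cIm_is_additive : {morph cIm : x y / x - y}.
Proof. by case=> [a b] [c d]. Qed.
Lemma toC_conj r : (toC r)^* = toC r.
Proof. exact: conjc_real. Qed.
Lemma complex_ext (z w : C) : cRe z = cRe w -> cIm z = cIm w -> z = w.
Proof. by case: z w => [a b] [c d] /= -> ->. Qed.
Lemma toC_Re_real (z : C) : z^* = z -> toC (cRe z) = z.
Proof.
case: z => a b [bE]; apply: complex_ext => //; rewrite /cIm/=.
by move: bE; lra.
Qed.

Lemma cnorm_ge0 z : 0 <= cnorm z.
Proof. by rewrite -toC_le -normCE normr_ge0. Qed.
Lemma cnorm0 : cnorm 0 = 0.
Proof. by apply: toC_inj; rewrite -normCE normr0 rmorph0. Qed.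
Lemma cnormD x y : cnorm (x + y) <= cnorm x + cnorm y.
Proof. by rewrite -toC_le rmorphD /= -!normCE ler_normD. Qed.
Lemma cnormN x : cnorm (- x) = cnorm x.
Proof. by apply: toC_inj; rewrite -!normCE normrN. Qed.
Lemma cnormB x y : cnorm (x - y) = cnorm (y - x).
Proof. by rewrite -cnormN opprB. Qed.
Lemma cnormM x y : cnorm (x * y) = cnorm x * cnorm y.
Proof. by apply: toC_inj; rewrite rmorphM /= -!normCE normrM. Qed.
Lemma cnorm_conj x : cnorm x^* = cnorm x.
Proof. by apply: toC_inj; rewrite -!normCE norm_conjC. Qed.
Lemma cnorm_eq0 x : (cnorm x == 0) = (x == 0).
Proof. by rewrite -(normr_eq0 x) normCE -(inj_eq toC_inj) rmorph0. Qed.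
Lemma cnorm_toC r : cnorm (toC r) = `|r|.
Proof. by rewrite /cnorm /toC /real_complex_def /= expr0n addr0 sqrtr_sqr. Qed.
Lemma cnorm_conjM x : x^* * x = toC (cnorm x ^+ 2).
Proof. by rewrite rmorphXn /= -normCE normCK mulrC. Qed.
Lemma cnorm_sqr x : cnorm x ^+ 2 = cRe x ^+ 2 + cIm x ^+ 2.
Proof. by case: x => a b; rewrite /cnorm/= sqr_sqrtr// addr_ge0 ?sqr_ge0. Qed.
Lemma cRe_le x : `|cRe x| <= cnorm x.
Proof.
by rewrite -(ler_pXn2r (isT : (0 < 2)%N)) ?nnegrE ?cnorm_ge0// real_normK ?num_real// cnorm_sqr lerDl sqr_ge0.
Qed.
Lemma cIm_le x : `|cIm x| <= cnorm x.
Proof.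
by rewrite -(ler_pXn2r (isT : (0 < 2)%N)) ?nnegrE ?cnorm_ge0// real_normK ?num_real// cnorm_sqr lerDr sqr_ge0.
Qed.
Lemma cnorm_le_ReIm x : cnorm x <= `|cRe x| + `|cIm x|.
Proof.
rewrite -(ler_pXn2r (isT : (0 < 2)%N)) ?nnegrE ?cnorm_ge0 ?addr_ge0//.
rewrite cnorm_sqr -(real_normK (num_real (cRe x))) -(real_normK (num_real (cIm x))) sqrrD.
by have := mulr_ge0 (normr_ge0 (cRe x)) (normr_ge0 (cIm x)); lra.
Qed.

Lemma nbhs_complexP (z : C) V :
  nbhs z V <-> exists2 e : R, 0 < e & forall w, cnorm (w - z) < e -> V w.
Proof.
split=> [/nbhs_ballP[e /= e0 eV]|[e e0 eV]].
  have eE : toC (cRe e) = e.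
    by apply: toC_Re_real; apply/CrealP; exact: gtr0_real.
  exists (cRe e); first by rewrite -toC_lt eE rmorph0.
  by move=> w wz; apply: eV; rewrite /ball/= -eE normCE toC_lt cnormB.
apply/nbhs_ballP; exists (toC e); first by rewrite /= -(rmorph0 toC) toC_lt.
by move=> w; rewrite /ball/= normCE toC_lt cnormB; exact: eV.
Qed.

(** The entrywise l1-norm: real-valued, submultiplicative for rectangular products and invariant
    under adjoints. *)
Definition mxn m n (M : 'M[C]_(m, n)) : R := \sum_i \sum_j cnorm (M i j).

Lemma mxn_ge0 m n (M : 'M[C]_(m, n)) : 0 <= mxn M.
Proof. by apply: sumr_ge0 => i _; apply: sumr_ge0 => j _; exact: cnorm_ge0. Qed.
Lemma mxn_coord m n (M : 'M[C]_(m, n)) i j : cnorm (M i j) <= mxn M.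
Proof.
rewrite /mxn (bigD1 i)//= (bigD1 j)//= -addrA lerDl addr_ge0//.
  by apply: sumr_ge0 => *; exact: cnorm_ge0.
by apply: sumr_ge0 => *; apply: sumr_ge0 => *; exact: cnorm_ge0.
Qed.
Lemma mxn_le m n (M : 'M[C]_(m, n)) e :
  (forall i j, cnorm (M i j) <= e) -> mxn M <= (m * n)%:R * e.
Proof.
move=> Me; apply: (@le_trans _ _ (\sum_(i < m) \sum_(j < n) e)).
  by apply: ler_sum => i _; apply: ler_sum => j _.
by rewrite !sumr_const !card_ord -mulrnA mulnC mulr_natl.
Qed.
Lemma mxn0 m n : mxn (0 : 'M[C]_(m, n)) = 0.
Proof. by rewrite /mxn big1// => i _; rewrite big1// => j _; rewrite mxE cnorm0. Qed.
Lemma mxn_eq0 m n (M : 'M[C]_(m, n)) : mxn M <= 0 -> M = 0.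
Proof.
move=> M0; apply/matrixP => i j; rewrite mxE; apply/eqP; rewrite -cnorm_eq0.
by rewrite eq_le cnorm_ge0 andbT (le_trans (mxn_coord M i j)).
Qed.
Lemma mxnD m n (M N : 'M[C]_(m, n)) : mxn (M + N) <= mxn M + mxn N.
Proof.
rewrite /mxn -big_split/=; apply: ler_sum => i _; rewrite -big_split/=.
by apply: ler_sum => j _; rewrite mxE cnormD.
Qed.
Lemma mxnN m n (M : 'M[C]_(m, n)) : mxn (- M) = mxn M.
Proof. by apply: eq_bigr => i _; apply: eq_bigr => j _; rewrite mxE cnormN. Qed.
Lemma mxnB m n (M N : 'M[C]_(m, n)) : mxn (M - N) = mxn (N - M).
Proof. by rewrite -mxnN opprB. Qed.
Lemma mxnZ m n c (M : 'M[C]_(m, n)) : mxn (c *: M) = cnorm c * mxn M.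
Proof.
rewrite /mxn mulr_sumr; apply: eq_bigr => i _; rewrite mulr_sumr.
by apply: eq_bigr => j _; rewrite mxE cnormM.
Qed.
Lemma mxn_sum m n (I : Type) (s : seq I) (P : pred I) (F : I -> 'M[C]_(m, n)) :
  mxn (\sum_(i <- s | P i) F i) <= \sum_(i <- s | P i) mxn (F i).
Proof.
elim/big_ind2: _ => [|x1 x2 y1 y2 h1 h2|//]; first by rewrite mxn0.
by apply: le_trans (mxnD _ _) _; exact: lerD.
Qed.
Lemma cnorm_sum (I : Type) (s : seq I) (P : pred I) (F : I -> C) :
  cnorm (\sum_(i <- s | P i) F i) <= \sum_(i <- s | P i) cnorm (F i).
Proof.
elim/big_ind2: _ => [|x1 x2 y1 y2 h1 h2|//]; first by rewrite cnorm0.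
by apply: le_trans (cnormD _ _) _; exact: lerD.
Qed.
Lemma mxnM m n p (M : 'M[C]_(m, n)) (N : 'M[C]_(n, p)) :
  mxn (M *m N) <= mxn M * mxn N.
Proof.
rewrite {2}/mxn mulr_suml /mxn; apply: ler_sum => i _.
rewrite mulr_suml.
apply: (@le_trans _ _ (\sum_j \sum_k cnorm (M i k) * cnorm (N k j))).
  apply: ler_sum => j _; rewrite mxE; apply: le_trans (cnorm_sum _ _ _) _.
  by apply: ler_sum => k _; rewrite cnormM.
rewrite exchange_big/=; apply: ler_sum => k _; rewrite -mulr_sumr.
apply: ler_wpM2l; first exact: cnorm_ge0.
rewrite (bigD1 k)//= lerDl; apply: sumr_ge0 => k' _.
by apply: sumr_ge0 => j _; exact: cnorm_ge0.
Qed.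
Lemma nbhs_mxnP m n (M : 'M[C]_(m, n)) V :
  nbhs M V <-> exists2 e : R, 0 < e & forall N, mxn (N - M) < e -> V N.
Proof.
split=> [[P xP PV]|[e e0 eV]].
  have : forall ij : 'I_m * 'I_n, exists e : R, 0 < e /\ forall w, cnorm (w - M ij.1 ij.2) < e -> P ij.1 ij.2 w.
    by move=> [i j]; have /nbhs_complexP[e e0 eP] := xP i j; exists e.
  move=> /choice[e eP].
  exists (\big[Num.min/1]_ij e ij).
    by apply: lt_bigmin => [|ij _]; [exact: ltr01|exact: (eP ij).1].
  move=> N NM; apply: PV => i j; apply: (eP (i, j)).2.
  have := le_lt_trans (mxn_coord (N - M) i j) NM; rewrite !mxE => /lt_le_trans; apply.
  exact: bigmin_le_cond.
have d0 : 0 < e / (m * n).+1%:R by rewrite divr_gt0.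
exists (fun i j => [set w | cnorm (w - M i j) < e / (m * n).+1%:R]).
  by move=> i j; apply/nbhs_complexP; exists (e / (m * n).+1%:R).
move=> N NP; apply: eV; apply: (@le_lt_trans _ _ ((m * n)%:R * (e / (m * n).+1%:R))).
  by apply: mxn_le => i j; rewrite !mxE; apply/ltW/NP.
by rewrite mulrCA gtr_pMr// ltr_pdivrMr// mul1r ltr_nat.
Qed.

Lemma cts_on_mxnP (X : topologicalType) (K : set X) m n (f : X -> 'M[C]_(m, n)) :
  cts_on K f <-> (forall x, K x -> forall e, 0 < e ->
     \forall y \near x, K y -> mxn (f y - f x) < e).
Proof.
split=> [cf x Kx e e0|cf x Kx V /nbhs_mxnP[e e0 eV]].
  have : nbhs (f x) [set N | mxn (N - f x) < e] by apply/nbhs_mxnP; exists e.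
  by move=> /(cf x Kx).
by have := cf x Kx e e0; apply: filterS => y H Ky; apply: eV; exact: H.
Qed.

Lemma cts_on_complexP (X : topologicalType) (K : set X) (f : X -> C) :
  cts_on K f <-> (forall x, K x -> forall e, 0 < e ->
     \forall y \near x, K y -> cnorm (f y - f x) < e).
Proof.
split=> [cf x Kx e e0|cf x Kx V /nbhs_complexP[e e0 eV]].
  have : nbhs (f x) [set N | cnorm (N - f x) < e] by apply/nbhs_complexP; exists e.
  by move=> /(cf x Kx).
by have := cf x Kx e e0; apply: filterS => y H Ky; apply: eV; exact: H.
Qed.

Lemma cts_on_realP (X : topologicalType) (K : set X) (f : X -> R) :
  cts_on K f <-> (forall x, K x -> forall e, 0 < e ->
     \forall y \near x, K y -> `|f y - f x| < e).
Proof.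
split=> [cf x Kx e e0|cf x Kx V /nbhs_ballP[e e0 eV]].
  have : nbhs (f x) (ball (f x) e) by exact: nbhsx_ballx.
  by move=> /(cf x Kx); apply: filterS => y H Ky; rewrite distrC; exact: H.
have := cf x Kx e e0; apply: filterS => y H Ky; apply: eV.
by rewrite /ball/= distrC; exact: H.
Qed.

Lemma cts_on_mx_coord (X : topologicalType) (K : set X) m n
    (f : X -> 'M[C]_(m, n)) i j : cts_on K f -> cts_on K (fun x => f x i j).
Proof.
move=> /cts_on_mxnP cf; apply/cts_on_complexP => x Kx e e0.
have := cf x Kx e e0; apply: filterS => y H Ky.
by have := le_lt_trans (mxn_coord _ i j) (H Ky); rewrite !mxE.
Qed.

Lemma cts_on_mx (X : topologicalType) (K : set X) m n (f : X -> 'M[C]_(m, n)) :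
  (forall i j, cts_on K (fun x => f x i j)) -> cts_on K f.
Proof.
move=> cf x Kx V [P fP PV].
have H : \forall y \near x, forall i j, K y -> P i j (f y i j).
  apply: filter_forall => i; apply: filter_forall => j.
  exact: cf i j x Kx _ (fP i j).
by apply: filterS H => y H Ky; apply: PV => i j; exact: H.
Qed.

Lemma cts_on_cRe (X : topologicalType) (K : set X) (f : X -> C) :
  cts_on K f -> cts_on K (cRe \o f).
Proof.
move=> /cts_on_complexP cf; apply/cts_on_realP => x Kx e e0.
have := cf x Kx e e0; apply: filterS => y H Ky /=.
by rewrite -cRe_is_additive; exact: le_lt_trans (cRe_le _) (H Ky).
Qed.

Lemma cts_on_cIm (X : topologicalType) (K : set X) (f : X -> C) :
  cts_on K f -> cts_on K (cIm \o f).
Proof.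
move=> /cts_on_complexP cf; apply/cts_on_realP => x Kx e e0.
have := cf x Kx e e0; apply: filterS => y H Ky /=.
by rewrite -cIm_is_additive; exact: le_lt_trans (cIm_le _) (H Ky).
Qed.

Lemma cts_on_Complex (X : topologicalType) (K : set X) (f g : X -> R) :
  cts_on K f -> cts_on K g -> cts_on K (fun x => Complex (f x) (g x) : C).
Proof.
move=> /cts_on_realP cf /cts_on_realP cg; apply/cts_on_complexP => x Kx e e0.
have e20 : 0 < e / 2 by rewrite divr_gt0.
apply: filterS2 (cf x Kx _ e20) (cg x Kx _ e20) => y Hf Hg Ky.
apply: le_lt_trans (cnorm_le_ReIm _) _.
by rewrite [ltRHS]splitr cRe_is_additive cIm_is_additive ltrD//; [exact: Hf|exact: Hg].
Qed.

End ComplexNorm.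

(** * The topology of pointwise convergence *)

Section Pointwise.

Lemma ptws_cvg (A : Type) (V : topologicalType) (F : set_system (A -> V))
    (p : {ptws A -> V}) : Filter F ->
  (forall a W, nbhs (p a) W -> F [set q | W (q a)]) -> forall W, nbhs p W -> F W.
Proof.
move=> FF Fp; suff: F --> p by [].
apply/cvg_sup => a W [B [[U oU UB] Bp BW]].
have : F [set q | U (q a)].
  by apply: Fp; apply: open_nbhs_nbhs; split => //; move: Bp; rewrite -UB.
by apply: filterS => q Uq; apply: BW; rewrite -UB.
Qed.

Lemma ptws_eval (A : Type) (V : topologicalType) (a : A) :
  continuous (fun p : {ptws A -> V} => p a).
Proof.
move=> p; have /cvg_sup /(_ a) H : nbhs p --> p by exact: cvg_id.
move=> W Wp; have : nbhs (p a) W by [].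
rewrite (@nbhsE V) => -[U [oU Up] UW]; apply: H; rewrite nbhsE.
exists ((fun q : A -> V => q a) @^-1` U); first by split => //; exists U.
by move=> q Uq; exact: UW.
Qed.

Lemma cts_on_ptws (X : topologicalType) (K : set X) (A : Type)
    (V : topologicalType) (f : X -> {ptws A -> V}) :
  cts_on K f <-> forall a, cts_on K (fun x => f x a).
Proof.
split=> [cf a|cf x Kx W fW].
  exact: (cts_on_compT cf (@ptws_eval A V a)).
have FF : Filter [set W : set {ptws A -> V} | \forall y \near x, K y -> W (f y)].
  split; first by apply: nearW.
    by move=> P Q /= HP HQ; apply: filterS2 HP HQ => y P1 Q1 Ky; split; [exact: P1|exact: Q1].
  by move=> P Q PQ /=; apply: filterS => y H Ky; apply: PQ; exact: H.
apply: (ptws_cvg FF _ fW) => a W' fW'.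
exact: cf a x Kx W' fW'.
Qed.

End Pointwise.

(** * Matrix and vector spaces are extensors *)

Section Tietze.
Context {R : realType}.
Local Notation C := (Cplx R).

(** Tietze's theorem for bounded functions applies to [s \o f], where [s] maps the line onto (-1, 1)
    with inverse [t]. The extension may take the values 1 and -1, so undoing [s] leaves only a
    neighbourhood of [K]. *)
Lemma tietze_real (X : topologicalType) (d : X -> X -> R) (K : set X)
    (f : X -> R) : metrizes d -> closed K -> cts_on K f ->
  exists (O : set X) (g : X -> R), [/\ open O, K `<=` O, cts_on O g
    & forall x, K x -> g x = f x].
Proof.
move=> dX cK cf; pose s (y : R) := y / (1 + `|y|).
have n0 (y : R) : 0 < 1 + `|y| by have := normr_ge0 y; lra.
have s1 y : `|s y| < 1.
  by rewrite normrM normfV (gtr0_norm (n0 y)) ltr_pdivrMr// mul1r ltrDr.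
have cs : continuous s.
  move=> y; apply: cvgM; first exact: cvg_id.
  apply: cvgV; first by rewrite gt_eqF.
  by apply: cvgD; [exact: cvg_cst|exact: (@norm_continuous R R)].
have [| |g [gf cg g1]] := @continuous_bounded_extension X R (metrized_normal dX) K cK (s \o f) 1 ltr01.
- by apply/cts_on_within; exact: cts_on_compT.
- by move=> x _; exact/ltW/s1.
pose t (y : R) := y / (1 - `|y|).
have st y : t (s y) = y.
  have h := n0 y; rewrite /t /s normrM normfV (gtr0_norm h).
  rewrite -[1 - _](_ : (1 + `|y|)^-1 = _); last first.
    by apply: (mulIf (lt0r_neq0 h)); rewrite mulVf ?gt_eqF// mulrBl mul1r divfK ?gt_eqF//; lra.
  by rewrite invrK divfK// gt_eqF.
exists [set x | `|g x| < 1], (t \o g); split.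
- have -> : [set x | `|g x| < 1] = (fun x => `|g x|) @^-1` [set y : R | y < 1] by [].
  apply: open_comp; last exact: open_lt.
  by move=> x _; apply: (@cvg_norm R R); exact: cg.
- by move=> x Kx /=; rewrite -gf ?inE//=; exact: s1.
- move=> x gx1 V Vt; rewrite /= in gx1.
  have ct : (t \o g) @ x --> (t \o g) x.
    apply: cvgM; first exact: cg.
    apply: cvgV; first by rewrite /= gt_eqF// subr_gt0.
    by apply: cvgB; [exact: cvg_cst|apply: (@cvg_norm R R); exact: cg].
  have : nbhs x ((t \o g) @^-1` V) := ct V Vt.
  by apply: filterS.
- by move=> x Kx /=; rewrite -gf ?inE//= st.
Qed.

Lemma tietze_family (I : finType) (X : topologicalType) (d : X -> X -> R)
    (K : set X) (f : I -> X -> R) : metrizes d -> closed K ->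
  (forall i, cts_on K (f i)) ->
  exists (O : set X) (g : I -> X -> R), [/\ open O, K `<=` O,
    forall i, cts_on O (g i) & forall i x, K x -> g i x = f i x].
Proof.
move=> dX cK cf.
have : forall i, exists p : set X * (X -> R), [/\ open p.1, K `<=` p.1,
    cts_on p.1 p.2 & forall x, K x -> p.2 x = f i x].
  move=> i; have [ O [g [oO KO cg gf]]] := tietze_real dX cK (cf i).
  by exists (O, g).
move=> /choice[p pP]; exists [set x | forall i, (p i).1 x], (fun i => (p i).2); split.
- rewrite openE => x px; apply: (@filter_forall _ _ (fun i y => (p i).1 y) (nbhs x) _) => i.
  by apply: open_nbhs_nbhs; split => //; have [] := pP i.
- by move=> x Kx i; have [_ + _ _] := pP i; exact.
- move=> i; have [_ _ + _] := pP i; apply: cts_on_sub => x; exact.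
- by move=> i; have [] := pP i.
Qed.

Lemma ane_mx m n : ane R [set: 'M[C]_(m, n)].
Proof.
move=> X d dX K f cK cf _.
pose F (ijb : 'I_m * 'I_n * bool) x : R :=
  let: (i, j, b) := ijb in if b then cRe (f x i j) else cIm (f x i j).
have [|O [g [ oO KO cg gf]]] := tietze_family (f := F) dX cK.
  move=> [[i j] []].
    exact: (cts_on_cRe (cts_on_mx_coord cf)).
  exact: (cts_on_cIm (cts_on_mx_coord cf)).
exists O, (fun x => \matrix_(i, j) (Complex (g (i, j, true) x) (g (i, j, false) x) : C)); split => //.
- apply: cts_on_mx => i j.
  have := @cts_on_Complex _ _ _ _ _ (cg (i, j, true)) (cg (i, j, false)).
  by apply: cts_on_ext => x _; rewrite mxE.
- by move=> x Kx; apply/matrixP => i j; rewrite mxE !gf//; exact: complex_ext.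
Qed.

Lemma cts_on_rV (X : topologicalType) (K : set X) n (f : X -> 'rV[R]_n) :
  (forall j, cts_on K (fun x => f x 0 j)) -> cts_on K f.
Proof.
move=> cf x Kx V [P fP PV].
have H : \forall y \near x, forall i j, K y -> P i j (f y i j).
  apply: filter_forall => i; apply: filter_forall => j; rewrite ord1.
  exact: cf j x Kx _ (fP 0 j).
by apply: filterS H => y H Ky; apply: PV => i j; exact: H.
Qed.

Lemma ane_rV n : ane R [set: 'rV[R]_n].
Proof.
move=> X d dX K f cK cf _.
have [|O [g [ oO KO cg gf]]] := tietze_family (f := fun j x => f x 0 j) dX cK.
  move=> j; apply: (cts_on_compT cf (g := fun v : 'rV[R]_n => v 0 j)).
  exact: coord_continuous.
exists O, (fun x => \row_j g j x); split => //.
- apply: cts_on_rV => j; have := cg j.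
  by apply: cts_on_ext => x _; rewrite mxE.
- by move=> x Kx; apply/rowP => j; rewrite mxE gf.
Qed.

End Tietze.

(** * The sequence space, and the passage to compact Hausdorff spaces *)

Section SequenceSpace.
Context {R : realType}.
Local Notation W := {ptws nat -> R}.

Let dj (x y : W) j := Num.min `|x j - y j| j.+1%:R^-1.

(** The cap 1/(j+1) leaves only finitely many coordinates relevant to a given precision, so the
    distance induces the product topology. *)
Definition seqdist (x y : W) : R := sup (range (dj x y)).

Let dj_ge0 x y j : 0 <= dj x y j.
Proof. by rewrite /dj le_min normr_ge0 invr_ge0 ler0n. Qed.

Let dj_le1 x y j : dj x y j <= 1.
Proof. by rewrite /dj ge_min invf_le1 ?ltr0n// ler1n orbT. Qed.

Let seqdist_sup x y : has_sup (range (dj x y)).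
Proof.
by split; [exists (dj x y 0%N), 0%N|exists 1 => _ [j _ <-]; exact: dj_le1].
Qed.

Let seqdist_ge x y j : dj x y j <= seqdist x y.
Proof. by apply: ub_le_sup; [have [] := seqdist_sup x y|exists j]. Qed.

Let seqdist_le x y e : (forall j, dj x y j <= e) -> seqdist x y <= e.
Proof.
move=> H; apply: ge_sup; first by have [] := seqdist_sup x y.
by move=> _ [j _ <-].
Qed.

Lemma seqdist_metrizes : metrizes seqdist.
Proof.
have dD x y z : seqdist x z <= seqdist x y + seqdist y z.
  apply: seqdist_le => j.
  apply: le_trans (lerD (seqdist_ge x y j) (seqdist_ge y z j)); rewrite /dj.
  have := ler_normD (x j - y j) (y j - z j); rewrite addrA subrK.
  have : 0 < j.+1%:R^-1 :> R by rewrite invr_gt0.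
  have := normr_ge0 (x j - y j); have := normr_ge0 (y j - z j).
  move: (`|x j - z j|) (`|x j - y j|) (`|y j - z j|) (j.+1%:R^-1).
  by move=> a b c k ? ? ? ?; case: (leP a k) => ?; case: (leP b k) => ?; case: (leP c k) => ?; lra.
have dC x y : seqdist x y = seqdist y x.
  by congr sup; apply/funext => r; congr image; apply/funext => j; rewrite /dj distrC.
have small (e : R) : 0 < e -> exists n : nat, forall j, (n <= j)%N -> j.+1%:R^-1 < e.
  move=> e0; exists (Num.truncn e^-1) => j nj.
  rewrite -[ltRHS]invrK ltf_pV2 ?posrE ?invr_gt0//.
  by apply: lt_le_trans (truncnS_gt _) _; rewrite ler_nat.
have dlt x y n e : (forall j, (n <= j)%N -> j.+1%:R^-1 < e / 2) ->
   (forall j, (j < n)%N -> `|x j - y j| < e / 2) -> 0 < e -> seqdist x y < e.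
  move=> nP h e0; apply: (@le_lt_trans _ _ (e / 2)); last by lra.
  apply: seqdist_le => j; rewrite /dj ge_min; have [jn|nj] := ltnP j n.
    by rewrite ltW// h.
  by rewrite (ltW (nP _ nj)) orbT.
split => //.
- move=> x; apply/eqP; rewrite eq_le; apply/andP; split.
    by apply: seqdist_le => j; rewrite /dj subrr normr0 ge_min lexx.
  by apply: le_trans (seqdist_ge x x 0%N); exact: dj_ge0.
- move=> x A; split => [xA|[e e0 eA]].
    suff : [set B : set W | exists2 e, 0 < e & forall y, seqdist x y < e -> B y] A by [].
    apply: ptws_cvg xA.
      split; first by exists 1.
        move=> P Q [e e0 eP] [e' e'0 e'Q]; exists (Num.min e e'); first by rewrite lt_min e0.
        by move=> y; rewrite lt_min => /andP[/eP ? /e'Q].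
      by move=> P Q PQ [e e0 eP]; exists e => // y /eP/PQ.
    move=> j B /nbhs_ballP[e /= e0 eB].
    exists (Num.min e j.+1%:R^-1); first by rewrite lt_min e0 invr_gt0 ltr0n.
    move=> y /(le_lt_trans (seqdist_ge x y j)) H; apply: eB; rewrite /ball/=.
    move: H; rewrite /dj; case: (leP `|x j - y j| j.+1%:R^-1) => _; rewrite lt_min => /andP[]// _.
    by rewrite ltxx.
  have [n nP] := small _ (divr_gt0 e0 (ltr0n R 2)).
  have : nbhs (x : W) [set y : W | forall j : 'I_n, `|x j - y j| < e / 2].
    apply: (@filter_forall _ _ (fun (j : 'I_n) (y : W) => `|x j - y j| < e / 2) (nbhs (x : W)) _) => j; have e20 : 0 < e / 2 by rewrite divr_gt0.
    exact: (@ptws_eval nat R j x (ball (x j) (e / 2)) (nbhsx_ballx _ _ e20)).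
  apply: filterS => y H; apply: eA; apply: (dlt _ _ n) => // j jn.
  exact: (H (Ordinal jn)).
(* Finite sequences of rationals, continued by 0, are countable and dense. *)
- pose z n : W := fun j => nth 0 (map (@ratr R) (odflt [::] (unpickle n))) j.
  exists z => x e e0; have [n nP] := small _ (divr_gt0 e0 (ltr0n R 2)).
  have : forall j, exists q : rat, `|x j - ratr q| < e / 2.
    move=> j; have e2 : 0 < e / 2 by rewrite divr_gt0.
    have [|q] := @rat_in_itvoo R (x j - e / 2) (x j + e / 2); first lra.
    rewrite in_itv/= => /andP[q1 q2].
    by exists q; rewrite ltr_norml; lra.
  move=> /choice[q qP]; exists (pickle (mkseq q n)).
  apply: (dlt _ _ n) => // j jn.
  by rewrite /z pickleK /= (nth_map 0) ?size_mkseq// nth_mkseq.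
Qed.

Lemma hausdorff_seqspace : hausdorff_space W.
Proof.
have [d0 dC dD nb _] := seqdist_metrizes.
move=> x y xy; apply/funext => j; apply/eqP; rewrite -subr_eq0 -normr_eq0.
rewrite eq_le normr_ge0 andbT leNgt; apply/negP => n0.
pose e := dj x y j / 2.
have e0 : 0 < e by rewrite divr_gt0// lt_min n0 invr_gt0 ltr0n.
have nx : nbhs x [set z | seqdist x z < e] by apply/nb; exists e.
have ny : nbhs y [set z | seqdist y z < e] by apply/nb; exists e.
have [z [/= xz yz]] := xy _ _ nx ny.
have := seqdist_ge x y j; have := dD x z y; rewrite (dC z y) /e in xz yz *; lra.
Qed.

End SequenceSpace.

(** In other words, [E] embeds [S] into the space of real sequences. *)
Definition cgen (R : realType) (T : topologicalType) (S : set T)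
    (E : nat -> T -> R) :=
  [/\ forall j, cts_on S (E j),
      forall s, S s -> forall V, nbhs s V -> exists n e, 0 < e /\ forall t, S t ->
        (forall j, (j < n)%N -> `|E j t - E j s| < e) -> V t
    & forall s t, S s -> S t -> (forall j, E j s = E j t) -> s = t].

(** Each coordinate [E j \o f] extends to all of [X] by Tietze's theorem; together they map [X] to
    the metrizable sequence space. On [Y] the map [f] factors through the compact image of [Y]
    there, the factor extends to a neighbourhood of the image, and composing with the coordinates
    gives [g]. *)
Lemma ane_compact_hausdorff (R : realType) (T : topologicalType) (S : set T)
    (E : nat -> T -> R) (X : topologicalType) (Y : set X) (f : X -> T) :
  ane R S -> cgen S E -> compact [set: X] -> hausdorff_space X -> closed Y ->
  cts_on Y f -> (forall y, Y y -> S (f y)) ->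
  exists (Z : set X) (g : X -> T), [/\ closed Z, Y `<=` interior Z, cts_on Z g,
    forall y, Y y -> g y = f y & forall z, Z z -> S (g z)].
Proof.
move=> aS [cE genE sepE] cX hX cY cf YS.
pose e (s : T) : {ptws nat -> R} := fun j => E j s.
have ce : cts_on S e by apply/cts_on_ptws.
have cef : cts_on Y (e \o f) by exact: (cts_on_comp YS).
have compY : compact Y by rewrite -(setTI Y); exact: compact_closedI.
have nX : normal_space X by exact: compact_normal.
have : forall j, exists F : X -> R, continuous F /\ forall y, Y y -> F y = E j (f y).
  move=> j; have cj : cts_on Y (E j \o f) by exact: (cts_on_comp YS).
  have [M M0 MP] : exists2 M : R, 0 < M & forall y, Y y -> `|(E j \o f) y| <= M.
    have := continuous_compact ((cts_on_within _ _).1 cj) compY.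
    move=> /(@compact_bounded R R)[M [_ MP]].
    have [M0|M0] := ltP 0 (M + 1).
      exists (M + 1) => // y Yy; apply: (MP (M + 1)); first by rewrite ltrDl.
      by exists y.
    exists 1 => // y Yy; apply: (MP 1); first lra.
    by exists y.
  have [F [FE cF _]] := @continuous_bounded_extension X R nX Y cY (E j \o f) M M0
    ((cts_on_within _ _).1 cj) MP.
  by exists F; split => // y Yy; rewrite -FE// inE.
move=> /choice[F FP].
pose F' x : {ptws nat -> R} := fun j => F j x.
have cF' : continuous F'.
  move=> x V VF; have H : cts_on [set: X] F'.
    by apply/cts_on_ptws => j; apply: cts_on_cts; have [] := FP j.
  have : nbhs x (F' @^-1` V) by have := H x I V VF; apply: filterS => y; exact.
  by [].
have F'Y y : Y y -> F' y = e (f y) by move=> Yy; apply/funext => j; apply: (FP j).2.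
pose K := F' @` Y.
have cK : closed K.
  apply: (compact_closed hausdorff_seqspace).
  by apply: continuous_compact => //; exact: continuous_subspaceT.
(* A point of [X] supplies the default value [f x0] of [h] off [K]. *)
have [[x0 _]|noX] := pselect (exists x : X, True); last first.
  exists set0, f; split => //; first exact: closed0.
    by move=> y _; case: noX; exists y.
have : forall k, exists t : T, K k -> S t /\ e t = k.
  move=> k; have [[y Yy <-]|nK] := pselect (K k); last by exists (f x0).
  by exists (f y) => _; split; [exact: YS|rewrite F'Y].
move=> /choice[h hP].
have hF y : Y y -> h (F' y) = f y.
  move=> Yy; have Ky : K (F' y) by exists y.
  have [Sh eh] := hP _ Ky; apply: sepE => //; first exact: YS.
  by move=> j; move: eh; rewrite F'Y// => /(congr1 (fun s : {ptws nat -> R} => s j)).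
have ch : cts_on K h.
  move=> k Kk V Vh; have [Sk ek] := hP k Kk.
  have [n [r [r0 rV]]] := genE _ Sk V Vh.
  have : nbhs (k : {ptws nat -> R}) [set l : {ptws nat -> R} | forall j : 'I_n, `|l j - k j| < r].
    apply: (@filter_forall _ _ (fun (j : 'I_n) (l : {ptws nat -> R}) => `|l j - k j| < r) (nbhs (k : {ptws nat -> R})) _) => j; have H := @ptws_eval nat R j k (ball (k j) r) (nbhsx_ballx _ _ r0).
    have : nbhs k [set l : {ptws nat -> R} | ball (k j) r (l j)] by [].
    by apply: filterS => l; rewrite /ball/= distrC.
  apply: filterS => l H Kl; have [Sl el] := hP l Kl; apply: rV => // j jn.
  have el' : E j (h l) = l j by exact: (congr1 (fun s : {ptws nat -> R} => s j) el).
  have ek' : E j (h k) = k j by exact: (congr1 (fun s : {ptws nat -> R} => s j) ek).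
  by rewrite el' ek'; exact: (H (Ordinal jn)).
have [|O [g [ oO KO cg gh OS]]] := aS _ _ seqdist_metrizes K h cK ch.
  by move=> k /hP[].
have oFO : open (F' @^-1` O) by apply: open_comp => // x _; exact: cF'.
have YFO : Y `<=` F' @^-1` O by move=> y Yy; apply: KO; exists y.
have /nX : closed Y by [].
move=> /(_ (F' @^-1` O)) [|Z YZ ZO].
  by apply/set_nbhsP; exists (F' @^-1` O); split.
exists (closure Z), (g \o F'); split.
- exact: closed_closure.
- move=> y Yy; have /set_nbhsP[U [oU YU UZ]] := YZ.
  have : nbhs y U by apply: open_nbhs_nbhs; split => //; exact: YU.
  by apply: filterS => z /UZ; exact: subset_closure.
- have KO' : forall z, closure Z z -> O (F' z) by move=> z Zz; exact: (ZO z Zz).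
  exact: (cts_on_comp KO' (cts_on_cts cF') cg).
- by move=> y Yy /=; rewrite gh ?hF//; exists y.
- by move=> z /ZO; exact: OS.
Qed.

(** * Functional calculus of Hermitian matrices and polar decomposition *)

Section Spectral.
Context {R : realType}.
Local Notation C := (Cplx R).

Definition ctr m n (M : 'M[C]_(m, n)) : 'M[C]_(n, m) :=
  (map_mx (@Num.conj C) M)^T.

Lemma ctrM m n p (A : 'M[C]_(m, n)) (B : 'M[C]_(n, p)) :
  ctr (A *m B) = ctr B *m ctr A.
Proof. by rewrite /ctr map_mxM trmx_mul. Qed.
Lemma ctrK m n (A : 'M[C]_(m, n)) : ctr (ctr A) = A.
Proof. by apply/matrixP => i j; rewrite !mxE conjCK. Qed.
Lemma ctrD m n (A B : 'M[C]_(m, n)) : ctr (A + B) = ctr A + ctr B.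
Proof. by apply/matrixP => i j; rewrite !mxE rmorphD. Qed.
Lemma ctrZ m n c (A : 'M[C]_(m, n)) : ctr (c *: A) = c^* *: ctr A.
Proof. by apply/matrixP => i j; rewrite !mxE rmorphM. Qed.
Lemma ctr1 m : ctr (1%:M : 'M[C]_m) = 1%:M.
Proof. by rewrite /ctr map_mx1 trmx1. Qed.
Lemma ctr_scalar m (c : C) : ctr (c%:M : 'M[C]_m) = (c^*)%:M.
Proof. by rewrite /ctr map_scalar_mx tr_scalar_mx. Qed.
Lemma ctr_diag m (d : 'I_m -> R) :
  ctr (diag_mx (\row_i toC (d i))) = diag_mx (\row_i toC (d i)).
Proof.
apply/matrixP => i j; rewrite !mxE eq_sym.
by have [->|_] := eqVneq i j; rewrite ?mulr1n ?mulr0n ?toC_conj ?rmorph0.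
Qed.
Lemma mxn_ctr m n (M : 'M[C]_(m, n)) : mxn (ctr M) = mxn M.
Proof.
rewrite /mxn exchange_big/=; apply: eq_bigr => i _; apply: eq_bigr => j _.
by rewrite !mxE cnorm_conj.
Qed.
Lemma ctr_mul_diag m n (v : 'M[C]_(m, n)) i :
  (v *m ctr v) i i = toC (\sum_j cnorm (v i j) ^+ 2).
Proof.
rewrite mxE rmorph_sum; apply: eq_bigr => j _.
by rewrite !mxE mulrC cnorm_conjM.
Qed.

Definition mpow m (H : 'M[C]_m) i : 'M[C]_m := iter i (mulmx H) 1%:M.
Lemma mpowS m (H : 'M[C]_m) i : mpow H i.+1 = H *m mpow H i.
Proof. by []. Qed.

Definition mhorner m (p : {poly R}) (H : 'M[C]_m) : 'M[C]_m :=
  \sum_(i < size p) toC p`_i *: mpow H i.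

(** For Hermitian [H] the rows are orthonormal eigenvectors, for the action [v *m H] on row
    vectors. *)
Definition eigbasis m (H : 'M[C]_m) : 'M[C]_m := spectralmx H.
Definition eigval m (H : 'M[C]_m) (i : 'I_m) : R := cRe (spectral_diag H 0 i).
(* Sealed: otherwise rewriting with associativity of the product unfolds it. *)
Fact fcalc_key : unit. Proof. exact: tt. Qed.
Definition fcalc (f : R -> R) m (H : 'M[C]_m) : 'M[C]_m :=
  locked_with fcalc_key
    (ctr (eigbasis H) *m diag_mx (\row_i toC (f (eigval H i))) *m eigbasis H).

Lemma fcalcE f m (H : 'M[C]_m) : fcalc f H =
  ctr (eigbasis H) *m diag_mx (\row_i toC (f (eigval H i))) *m eigbasis H.
Proof. exact: locked_withE. Qed.

Lemma eigbasis_unitary m (H : 'M[C]_m) :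
  eigbasis H *m ctr (eigbasis H) = 1%:M /\ ctr (eigbasis H) *m eigbasis H = 1%:M.
Proof.
have /unitarymxP := spectral_unitarymx H; rewrite -map_trmx => h1.
by split => //; apply: mulmx1C.
Qed.

Lemma fcalc_id m (H : 'M[C]_m) : ctr H = H -> fcalc id H = H.
Proof.
move=> Hh.
have Hn : H \is normalmx by apply/normalmxP; rewrite -map_trmx -/(ctr H) Hh.
have Hherm : H \is hermsymmx.
  by apply/is_hermitianmxP; rewrite expr0 scale1r -map_trmx -/(ctr H) Hh.
have [h1 h2] := eigbasis_unitary H.
rewrite [RHS](orthomx_spectralP Hn) -/(eigbasis H).
have -> : invmx (eigbasis H) = ctr (eigbasis H).
  by rewrite -[RHS]mulmx1 -(mulmxV (spectral_unit H)) mulmxA h2 mul1mx.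
rewrite fcalcE; congr (mulmx (mulmx _ (diag_mx _)) _); apply/rowP => i; rewrite mxE /eigval.
have /mxOverP/(_ 0 i) := hermitian_spectral_diag_real Hherm.
by move=> /CrealP; exact: toC_Re_real.
Qed.

Lemma fcalc_ext m (H : 'M[C]_m) f g : (forall i, f (eigval H i) = g (eigval H i)) ->
  fcalc f H = fcalc g H.
Proof.
move=> fg; rewrite !fcalcE (_ : \row_i toC (f (eigval H i)) = \row_i toC (g (eigval H i)))//.
by apply/rowP => i; rewrite !mxE fg.
Qed.

Lemma fcalcM m (H : 'M[C]_m) f g :
  fcalc f H *m fcalc g H = fcalc (fun x => f x * g x) H.
Proof.
have [h1 h2] := eigbasis_unitary H.
rewrite !fcalcE; set D1 := diag_mx _; set D2 := diag_mx _; set D3 := diag_mx _.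
have -> : D3 = D1 *m D2.
  by rewrite mulmx_diag /D3; congr diag_mx; apply/rowP => i; rewrite !mxE -rmorphM.
move: (eigbasis H) h1 D1 D2 {D3 h2} => U UU D1 D2.
by rewrite !mulmxA -(mulmxA _ U (ctr U)) UU mulmx1.
Qed.

Lemma fcalcB m (H : 'M[C]_m) f g :
  fcalc f H - fcalc g H = fcalc (fun x => f x - g x) H.
Proof.
rewrite !fcalcE; set D1 := diag_mx _; set D2 := diag_mx _; set D3 := diag_mx _.
have -> : D3 = D1 - D2; last by rewrite mulmxBr mulmxBl.
apply/matrixP => i j; rewrite !mxE; case: (i == j); rewrite ?mulr0n ?subrr// !mulr1n.
by rewrite rmorphB.
Qed.

Lemma scalar_mx0 m : (0 : C)%:M = 0 :> 'M[C]_m.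
Proof. by apply/matrixP => i j; rewrite !mxE mul0rn. Qed.

Lemma fcalc_cst m (H : 'M[C]_m) c : fcalc (fun=> c) H = (toC c)%:M.
Proof.
have [h1 h2] := eigbasis_unitary H.
rewrite !fcalcE; have -> : diag_mx (\row_i toC c) = (toC c)%:M :> 'M[C]_m.
  by apply/matrixP => i j; rewrite !mxE.
by rewrite mul_mx_scalar -scalemxAl h2 scalemx1.
Qed.

Lemma fcalc_herm m (H : 'M[C]_m) f : ctr (fcalc f H) = fcalc f H.
Proof. by rewrite !fcalcE !ctrM ctrK ctr_diag mulmxA. Qed.

Lemma fcalcZ m (H : 'M[C]_m) c f : toC c *: fcalc f H = fcalc (fun x => c * f x) H.
Proof. by rewrite -[RHS](@fcalcM _ _ (fun=> c)) fcalc_cst mul_scalar_mx. Qed.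

Lemma fcalcD m (H : 'M[C]_m) f g :
  fcalc f H + fcalc g H = fcalc (fun x => f x + g x) H.
Proof.
have -> : fcalc f H = fcalc (fun x => (f x + g x) - g x) H.
  by apply: fcalc_ext => i; rewrite addrK.
by rewrite -fcalcB subrK.
Qed.

Lemma mpow_fcalc m (H : 'M[C]_m) i : ctr H = H -> mpow H i = fcalc (fun x => x ^+ i) H.
Proof.
move=> Hh; elim: i => [|i IH]; first by rewrite fcalc_cst rmorph1.
rewrite mpowS IH -{1}(fcalc_id Hh) fcalcM.
by apply: fcalc_ext => j; rewrite exprS.
Qed.

Lemma fcalc_horner m (H : 'M[C]_m) p : ctr H = H -> fcalc (horner p) H = mhorner p H.
Proof.
move=> Hh; rewrite /mhorner.
have E n (a : nat -> R) : fcalc (fun x => \sum_(i < n) a i * x ^+ i) H =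
    \sum_(i < n) toC (a i) *: mpow H i.
  elim: n => [|n IH].
    have -> : \sum_(i < 0) toC (a i) *: mpow H i = fcalc (fun=> 0) H.
      by rewrite big_ord0 fcalc_cst !rmorph0.
    by apply: fcalc_ext => i; rewrite big_ord0.
  rewrite big_ord_recr/= -IH mpow_fcalc// fcalcZ fcalcD.
  by apply: fcalc_ext => i; rewrite big_ord_recr.
by rewrite -E; apply: fcalc_ext => i; rewrite horner_coef.
Qed.

Lemma row_fcalc m (H : 'M[C]_m) f i :
  row i (eigbasis H) *m fcalc f H = toC (f (eigval H i)) *: row i (eigbasis H).
Proof.
have [h1 h2] := eigbasis_unitary H.
rewrite !fcalcE !mulmxA -row_mul h1 row1 -rowE.
apply/rowP => j; rewrite !mxE (bigD1 i)//= !mxE eqxx mulr1n big1 ?addr0// => k ki.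
by rewrite !mxE eq_sym (negbTE ki) mulr0n mul0r.
Qed.

Lemma row_eigbasis m (H : 'M[C]_m) i : ctr H = H ->
  row i (eigbasis H) *m H = toC (eigval H i) *: row i (eigbasis H).
Proof. by move=> /fcalc_id {2}<-; rewrite row_fcalc. Qed.

Lemma row_eigbasis_norm m (H : 'M[C]_m) i :
  \sum_j cnorm (eigbasis H i j) ^+ 2 = 1.
Proof.
have [h1 h2] := eigbasis_unitary H.
by apply: toC_inj; rewrite -ctr_mul_diag h1 mxE eqxx rmorph1.
Qed.

Lemma row_eigbasis_neq0 m (H : 'M[C]_m) i : row i (eigbasis H) != 0.
Proof.
apply/eqP => r0; have := row_eigbasis_norm H i.
rewrite big1 => [/esym/eqP|j _]; first by rewrite oner_eq0.
by have /rowP/(_ j) := r0; rewrite !mxE => ->; rewrite cnorm0 expr0n.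
Qed.

Lemma eigbasis_eq0 m (H : 'M[C]_m) n (M : 'M[C]_(m, n)) :
  (forall i, row i (eigbasis H) *m M = 0) -> M = 0.
Proof.
have [h1 h2] := eigbasis_unitary H => M0.
rewrite -[M]mul1mx -h2 -mulmxA [X in _ *m X](_ : _ = 0) ?mulmx0//.
by apply/row_matrixP => i; rewrite row_mul M0 row0.
Qed.

Lemma mxn_eigbasis m (H : 'M[C]_m) : mxn (eigbasis H) <= (m * m)%:R.
Proof.
rewrite -[leRHS]mulr1; apply: mxn_le => i j.
have := row_eigbasis_norm H i; rewrite (bigD1 j)//= => h.
rewrite -(ler_pXn2r (isT : (0 < 2)%N)) ?nnegrE ?cnorm_ge0// expr1n -h lerDl.
by apply: sumr_ge0 => k _; exact: sqr_ge0.
Qed.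

(** Each unitary factor has l1-norm at most m * m, and the diagonal factor at most m times the
    largest value. *)
Definition fcalc_bound m : R := (m * m)%:R * m%:R * (m * m)%:R.

Lemma fcalc_le m (H : 'M[C]_m) f e : 0 <= e -> (forall i, `|f (eigval H i)| <= e) ->
  mxn (fcalc f H) <= fcalc_bound m * e.
Proof.
move=> e0 fe; rewrite fcalcE; apply: le_trans (mxnM _ _) _.
rewrite /fcalc_bound mulrAC; apply: ler_pM; try exact: mxn_ge0; last exact: mxn_eigbasis.
apply: le_trans (mxnM _ _) _; rewrite -mulrA; apply: ler_pM; try exact: mxn_ge0.
  by rewrite mxn_ctr; exact: mxn_eigbasis.
apply: (@le_trans _ _ (\sum_(i < m) e)); last by rewrite sumr_const card_ord mulr_natl.
apply: ler_sum => i _; rewrite (bigD1 i)//= !mxE eqxx mulr1n cnorm_toC big1 ?addr0// => j ji.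
by rewrite !mxE eq_sym (negbTE ji) mulr0n cnorm0.
Qed.

Lemma interpolation (f : R -> R) (s : seq R) :
  exists p : {poly R}, forall x, x \in s -> p.[x] = f x.
Proof.
elim: s => [|a s [p pP]]; first by exists 0.
have [as_|nas] := boolP (a \in s).
  by exists p => x; rewrite inE => /predU1P[->|]; exact: pP.
pose q := \prod_(y <- s) ('X - y%:P).
have qa : q.[a] != 0.
  rewrite /q horner_prod prodf_seq_neq0; apply/allP => y ys /=.
  by rewrite hornerXsubC subr_eq0; apply: contraNneq nas => ->.
exists (p + ((f a - p.[a]) / q.[a]) *: q) => x; rewrite inE hornerD hornerZ.
move=> /predU1P[->|xs]; first by rewrite divfK// addrC subrK.
have -> : q.[x] = 0.
  by rewrite /q horner_prod (big_rem x)//= hornerXsubC subrr mul0r.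
by rewrite mulr0 addr0 pP.
Qed.

(** One polynomial agrees with [f] on both spectra, so intertwining relations between [H] and [H']
    pass to functions of them. *)
Lemma fcalc_interpolate m n (H : 'M[C]_m) (H' : 'M[C]_n) f : ctr H = H -> ctr H' = H' ->
  exists p, fcalc f H = mhorner p H /\ fcalc f H' = mhorner p H'.
Proof.
move=> Hh H'h; have [p pP] := interpolation f (codom (eigval H) ++ codom (eigval H')).
exists p; split.
  rewrite -(fcalc_horner p Hh); apply: fcalc_ext => i.
  by rewrite pP// mem_cat codom_f.
rewrite -(fcalc_horner p H'h); apply: fcalc_ext => i.
by rewrite pP// mem_cat codom_f orbT.
Qed.

Lemma fcalc_comm m n (H : 'M[C]_m) (H' : 'M[C]_n) (X : 'M[C]_(n, m)) f :
  ctr H = H -> ctr H' = H' -> X *m H = H' *m X -> X *m fcalc f H = fcalc f H' *m X.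
Proof.
move=> Hh H'h XH; have [p [-> ->]] := fcalc_interpolate f Hh H'h.
rewrite /mhorner mulmx_sumr mulmx_suml; apply: eq_bigr => i _.
rewrite -scalemxAr -scalemxAl; congr (_ *: _).
elim: (val i) => [|k IH]; first by rewrite /mpow/= mulmx1 mul1mx.
by rewrite !mpowS (mulmxA X) XH -(mulmxA H') IH mulmxA.
Qed.

Lemma cts_on_cD (X : topologicalType) (K : set X) (f g : X -> C) :
  cts_on K f -> cts_on K g -> cts_on K (fun x => f x + g x : C).
Proof.
move=> cf cg.
exact: (cts_on_compT (cts_on_pair cf cg) (@add_continuous C^o)).
Qed.

Lemma cts_on_cM (X : topologicalType) (K : set X) (f g : X -> C) :
  cts_on K f -> cts_on K g -> cts_on K (fun x => f x * g x : C).
Proof.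
move=> cf cg.
exact: (cts_on_compT (cts_on_pair cf cg) (@mul_continuous C)).
Qed.

Lemma cts_on_csum (X : topologicalType) (K : set X) (I : Type) (s : seq I)
    (f : I -> X -> C) :
  (forall i, cts_on K (f i)) -> cts_on K (fun x => \sum_(i <- s) f i x : C).
Proof.
move=> cf; elim: s => [|i s IH].
  have : cts_on K (fun _ : X => 0 : C) by exact: cts_on_cst.
  by apply: cts_on_ext => x _; rewrite big_nil.
by have := cts_on_cD (cf i) IH; apply: cts_on_ext => x _; rewrite big_cons.
Qed.

Lemma cts_on_cconj (X : topologicalType) (K : set X) (f : X -> C) :
  cts_on K f -> cts_on K (fun x => (f x)^* : C).
Proof.
move=> /cts_on_complexP cf; apply/cts_on_complexP => x Kx e e0.
by have := cf x Kx e e0; apply: filterS => y H Ky; rewrite -rmorphB cnorm_conj; exact: H.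
Qed.

Lemma cts_on_mulmx (X : topologicalType) (K : set X) m n p
    (f : X -> 'M[C]_(m, n)) (g : X -> 'M[C]_(n, p)) :
  cts_on K f -> cts_on K g -> cts_on K (fun x => f x *m g x).
Proof.
move=> cf cg; apply: cts_on_mx => i j.
have : cts_on K (fun x => \sum_k f x i k * g x k j : C).
  by apply: cts_on_csum => k; apply: cts_on_cM; exact: cts_on_mx_coord.
by apply: cts_on_ext => x _; rewrite mxE.
Qed.

Lemma cts_on_addmx (X : topologicalType) (K : set X) m n
    (f g : X -> 'M[C]_(m, n)) :
  cts_on K f -> cts_on K g -> cts_on K (fun x => f x + g x).
Proof.
move=> cf cg; apply: cts_on_mx => i j.
have := cts_on_cD (cts_on_mx_coord (i := i) (j := j) cf) (cts_on_mx_coord (i := i) (j := j) cg).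
by apply: cts_on_ext => x _; rewrite mxE.
Qed.

Lemma cts_on_summx (X : topologicalType) (K : set X) m n (I : Type) (s : seq I)
    (f : I -> X -> 'M[C]_(m, n)) :
  (forall i, cts_on K (f i)) -> cts_on K (fun x => \sum_(i <- s) f i x : 'M[C]_(m, n)).
Proof.
move=> cf; elim: s => [|i s IH].
  have : cts_on K (fun _ : X => 0 : 'M[C]_(m, n)) by exact: cts_on_cst.
  by apply: cts_on_ext => x _; rewrite big_nil.
by have := cts_on_addmx (cf i) IH; apply: cts_on_ext => x _; rewrite big_cons.
Qed.

Lemma cts_on_scalemx (X : topologicalType) (K : set X) m n (c : X -> C)
    (f : X -> 'M[C]_(m, n)) :
  cts_on K c -> cts_on K f -> cts_on K (fun x => c x *: f x).
Proof.
move=> cc cf; apply: cts_on_mx => i j.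
have := cts_on_cM cc (cts_on_mx_coord (i := i) (j := j) cf).
by apply: cts_on_ext => x _; rewrite mxE.
Qed.

Lemma cts_on_ctr (X : topologicalType) (K : set X) m n (f : X -> 'M[C]_(m, n)) :
  cts_on K f -> cts_on K (fun x => ctr (f x)).
Proof.
move=> cf; apply: cts_on_mx => i j.
have := (cts_on_cconj (cts_on_mx_coord (i := j) (j := i) cf)).
by apply: cts_on_ext => x _; rewrite !mxE.
Qed.

Lemma cts_on_mhorner (X : topologicalType) (K : set X) m p (f : X -> 'M[C]_m) :
  cts_on K f -> cts_on K (fun x => mhorner p (f x)).
Proof.
move=> cf; apply: cts_on_summx => i.
apply: cts_on_scalemx; first exact: cts_on_cst.
elim: (val i) => [|k IH]; first exact: cts_on_cst.
exact: cts_on_mulmx.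
Qed.

Lemma mhorner_near m (H0 : 'M[C]_m) p e : 0 < e ->
  \forall H \near H0, mxn (mhorner p H - mhorner p H0) < e.
Proof.
move=> e0; have cid : cts_on setT (@id 'M[C]_m) by move=> x _ V; apply: filterS.
have /cts_on_mxnP := cts_on_mhorner (p := p) cid.
by move=> /(_ H0 I e e0); apply: filterS => H; exact.
Qed.

(** The polynomial whose roots are the eigenvalues of [H0] kills [H0], hence is small at nearby [H].
    An eigenvalue of [H] at distance at least [dl] from all these roots would give it norm at least
    [dl ^+ m]. *)
Lemma eigval_near m (H0 : 'M[C]_m) (O : set R) : ctr H0 = H0 ->
  (forall i, nbhs (eigval H0 i) O) ->
  \forall H \near H0, ctr H = H -> forall i, O (eigval H i).
Proof.
move=> H0h HO.
have [dl dl0 dlO] : exists2 dl : R, 0 < dl &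
    forall i x, `|x - eigval H0 i| < dl -> O x.
  have : forall i, exists e : R, 0 < e /\ forall x, `|x - eigval H0 i| < e -> O x.
    move=> i; have /nbhs_ballP[e /= e0 eO] := HO i; exists e; split => // x xe.
    by apply: eO; rewrite /ball/= distrC.
  move=> /choice[e eP]; exists (\big[Num.min/1]_i e i).
    by apply: lt_bigmin => [|i _]; [exact: ltr01|exact: (eP i).1].
  by move=> i x /lt_le_trans H; apply: (eP i).2; apply: H; exact: bigmin_le_cond.
pose p := \prod_i ('X - (eigval H0 i)%:P).
have p0 : mhorner p H0 = 0.
  rewrite -fcalc_horner// (@fcalc_ext _ _ _ (fun=> 0)) ?fcalc_cst ?rmorph0 ?scalar_mx0//.
  by move=> i; rewrite /p horner_prod (bigD1 i)//= hornerXsubC subrr mul0r.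
have := mhorner_near H0 p (exprn_gt0 m dl0); apply: filterS => H; rewrite p0 subr0 => HH Hh j.
apply: contrapT => nO; have : dl ^+ m <= `|p.[eigval H j]|.
  rewrite /p horner_prod normr_prod.
  rewrite (_ : dl ^+ m = \prod_(i < m) dl); last by rewrite prodr_const card_ord.
  apply: ler_prod => i _; rewrite (ltW dl0)/= hornerXsubC leNgt.
  by apply/negP => /dlO.
apply/negP; rewrite -ltNge; apply: le_lt_trans HH.
have v0 : 0 < mxn (row j (eigbasis H)).
  rewrite lt_neqAle mxn_ge0 andbT eq_sym; apply: contra_neq (row_eigbasis_neq0 H j) => h.
  by apply: mxn_eq0; rewrite h.
rewrite -(ler_pM2r v0) -cnorm_toC -mxnZ -row_fcalc fcalc_horner//.
by rewrite mulrC; exact: mxnM.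
Qed.

(** Let [p] interpolate [f] on the spectrum of [H0]. Then [mhorner p] is continuous, and [f - p] is
    small on the spectrum of nearby [H], which stays close to that of [H0]. *)
Lemma fcalc_near m (H0 : 'M[C]_m) f e : ctr H0 = H0 ->
  (forall i, {for eigval H0 i, continuous f}) -> 0 < e ->
  \forall H \near H0, ctr H = H -> mxn (fcalc f H - fcalc f H0) < e.
Proof.
move=> H0h cf e0.
have [p [pE _]] := fcalc_interpolate f H0h H0h.
have fp i : f (eigval H0 i) = p.[eigval H0 i].
  have : row i (eigbasis H0) *m fcalc f H0 = row i (eigbasis H0) *m mhorner p H0 by rewrite pE.
  rewrite -(fcalc_horner p H0h) !row_fcalc => /eqP; rewrite -subr_eq0 -scalerBl scaler_eq0.
  rewrite (negbTE (row_eigbasis_neq0 H0 i)) orbF subr_eq0 => /eqP.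
  exact: toC_inj.
pose K := fcalc_bound m.
have K0 : 0 <= K by rewrite /K /fcalc_bound !mulr_ge0.
pose t := e / (2 * (K + 1)).
have t0 : 0 < t by rewrite divr_gt0// mulr_gt0// ltr_wpDl.
have near1 : \forall H \near H0, ctr H = H -> forall i, `|f (eigval H i) - p.[eigval H i]| < t.
  apply: (@eigval_near _ _ [set x | `|f x - p.[x]| < t]) => // i.
  have : (fun x => f x - p.[x]) @ eigval H0 i --> f (eigval H0 i) - p.[eigval H0 i].
    by apply: cvgB; [exact: cf|exact: continuous_horner].
  rewrite fp subrr => /cvgrPdist_lt/(_ t t0).
  by apply: filterS => x; rewrite sub0r normrN.
have near2 := mhorner_near H0 p (divr_gt0 e0 (ltr0n R 2)).
apply: filterS2 near1 near2 => H H1 H2 Hh.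
have -> : fcalc f H - fcalc f H0 = (fcalc f H - mhorner p H) + (mhorner p H - mhorner p H0).
  by rewrite pE addrA subrK.
apply: (le_lt_trans (mxnD _ _)); rewrite [ltRHS]splitr; apply: ler_ltD; last exact: H2.
rewrite -(fcalc_horner p Hh) fcalcB; apply: le_trans (fcalc_le (ltW t0) _) _.
  by move=> i; exact/ltW/H1.
rewrite -/K /t mulrCA ler_pM2l// invfM mulrCA ler_piMr// ler_pdivrMr ?mul1r ?lerDl//.
by rewrite ltr_wpDl.
Qed.

Lemma cts_on_fcalc (X : topologicalType) (K : set X) m (H : X -> 'M[C]_m) f :
  (forall x, K x -> ctr (H x) = H x) ->
  (forall x i, K x -> {for eigval (H x) i, continuous f}) ->
  cts_on K H -> cts_on K (fun x => fcalc f (H x)).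
Proof.
move=> Hh cf cH; apply/cts_on_mxnP => x Kx e e0.
have := fcalc_near (Hh x Kx) (fun i => cf x i Kx) e0.
move=> /(cH x Kx); apply: filterS => y Hy Ky; apply: Hy => //.
exact: Hh.
Qed.

Definition polar m (x : 'M[C]_m) : 'M[C]_m :=
  locked_with fcalc_key (x *m fcalc (fun t => (Num.sqrt t)^-1) (ctr x *m x)).

Lemma polarE m (x : 'M[C]_m) :
  polar x = x *m fcalc (fun t => (Num.sqrt t)^-1) (ctr x *m x).
Proof. exact: locked_withE. Qed.

Lemma ctr_gram m n (x : 'M[C]_(m, n)) : ctr (ctr x *m x) = ctr x *m x.
Proof. by rewrite ctrM ctrK. Qed.

Lemma eigval_gram_ge0 m n (x : 'M[C]_(m, n)) i : 0 <= eigval (ctr x *m x) i.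
Proof.
set y := ctr x *m x; set v := row i (eigbasis y).
have vy : v *m y = toC (eigval y i) *: v by apply: row_eigbasis; exact: ctr_gram.
have : (v *m y *m ctr v) 0 0 = toC (eigval y i).
  rewrite vy -scalemxAl mxE ctr_mul_diag -rmorphM.
  under eq_bigr do rewrite mxE.
  by rewrite row_eigbasis_norm mulr1.
rewrite /y mulmxA -mulmxA.
have -> : x *m ctr v = ctr (v *m ctr x) by rewrite ctrM ctrK.
rewrite ctr_mul_diag => /toC_inj <-.
by apply: sumr_ge0 => j _; exact: sqr_ge0.
Qed.

Lemma eigval_gram_gt0 m (x : 'M[C]_m) i : x \in unitmx -> 0 < eigval (ctr x *m x) i.
Proof.
move=> ux; rewrite lt_neqAle eigval_gram_ge0 andbT; apply/eqP => /esym e0.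
set y := ctr x *m x in e0; set v := row i (eigbasis y).
have vy : v *m y = toC (eigval y i) *: v by apply: row_eigbasis; exact: ctr_gram.
have uy : y \in unitmx by rewrite /y unitmx_mul ux andbT unitmx_tr map_unitmx.
have : v = 0 by rewrite -(mulmxK uy v) vy e0 rmorph0 scale0r mul0mx.
by apply/eqP; exact: row_eigbasis_neq0.
Qed.

Lemma unitmx_gram m (x : 'M[C]_m) : (forall i, 0 < eigval (ctr x *m x) i) -> x \in unitmx.
Proof.
move=> y0; have : fcalc GRing.inv (ctr x *m x) *m (ctr x *m x) = 1%:M.
  rewrite -{2}(fcalc_id (ctr_gram x)) fcalcM -(rmorph1 toC) -(fcalc_cst (ctr x *m x)).
  by apply: fcalc_ext => i; rewrite mulVf// gt_eqF.
by rewrite mulmxA => /mulmx1_unit[].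
Qed.

Lemma polar_unitary m (x : 'M[C]_m) : x \in unitmx -> ctr (polar x) *m polar x = 1%:M.
Proof.
move=> ux; rewrite polarE ctrM fcalc_herm; set G := fcalc _ _.
have -> : G *m ctr x *m (x *m G) = G *m fcalc id (ctr x *m x) *m G.
  by rewrite (fcalc_id (ctr_gram x)) !mulmxA.
rewrite /G !fcalcM -(rmorph1 toC) -(fcalc_cst (ctr x *m x)).
apply: fcalc_ext => i; have y0 := eigval_gram_gt0 i ux.
have s0 : Num.sqrt (eigval (ctr x *m x) i) != 0 by rewrite gt_eqF// sqrtr_gt0.
have := sqr_sqrtr (ltW y0); move: s0; set s := Num.sqrt _ => s0 sE.
by rewrite -sE expr2 mulKf// mulfV.
Qed.

Lemma unitary_C m (u : 'M[C]_m) : ctr u *m u = 1%:M -> u *m ctr u = 1%:M.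
Proof. exact: mulmx1C. Qed.

Lemma polar_id m (u : 'M[C]_m) : ctr u *m u = 1%:M -> polar u = u.
Proof.
move=> uu; rewrite polarE uu.
have -> : fcalc (fun t => (Num.sqrt t)^-1) (1%:M : 'M[C]_m) = 1%:M; last exact: mulmx1.
rewrite -(rmorph1 toC) -[RHS](fcalc_cst (toC 1)%:M); apply: fcalc_ext => i.
have := @row_eigbasis _ 1%:M i (ctr1 m); rewrite mulmx1 => /eqP.
rewrite -[X in X == _]scale1r -subr_eq0 -scalerBl scaler_eq0.
rewrite (negbTE (row_eigbasis_neq0 _ i)) orbF subr_eq0 -(rmorph1 toC) => /eqP/toC_inj <-.
by rewrite sqrtr1 invr1.
Qed.

Lemma open_unitmx m : open [set x : 'M[C]_m | x \in unitmx].
Proof.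
rewrite openE => x /= ux.
have cg : cts_on setT (fun x : 'M[C]_m => ctr x *m x).
  have cid : cts_on setT (@id 'M[C]_m) by move=> y _ V; apply: filterS.
  exact: (cts_on_mulmx (cts_on_ctr cid) cid).
have gt0 i : nbhs (eigval (ctr x *m x) i) [set t | 0 < t].
  by apply: open_nbhs_nbhs; split; [exact: open_gt|exact: eigval_gram_gt0].
have := eigval_near (ctr_gram x) gt0.
move=> /(cg x I); apply: filterS => y /(_ I) H.
by apply: unitmx_gram; exact: H (ctr_gram y).
Qed.

Lemma cts_on_polar (X : topologicalType) (K : set X) m (f : X -> 'M[C]_m) :
  (forall x, K x -> f x \in unitmx) -> cts_on K f -> cts_on K (fun x => polar (f x)).
Proof.
move=> fu cf; apply: (@cts_on_ext _ _ _ (fun x => f x *m fcalc (fun t => (Num.sqrt t)^-1) (ctr (f x) *m f x))) => [x _|].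
  by rewrite polarE.
apply: (cts_on_mulmx cf); apply: cts_on_fcalc.
- by move=> x _; exact: ctr_gram.
- move=> x i Kx; have y0 := eigval_gram_gt0 i (fu x Kx).
  by apply: cvgV; [rewrite gt_eqF// sqrtr_gt0|exact: sqrt_continuous].
- exact: (cts_on_mulmx (cts_on_ctr cf) cf).
Qed.

Definition unitaries m : set 'M[C]_m := [set u | ctr u *m u = 1%:M].

(** Polar decomposition retracts the open set of invertible matrices onto the unitaries. *)
Lemma ane_unitaries m : ane R (@unitaries m).
Proof.
have aGL := ane_open (@ane_mx R m m) (@open_unitmx m).
apply: (ane_retractT (i := id) (r := @polar m) aGL).
- by move=> x _ V; apply: filterS.
- by move=> u /= uu; split => //=; have /mulmx1_unit[] := uu.
- apply: (@cts_on_polar _ _ _ id) => [x []//|x _ V].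
  by apply: filterS.
- by move=> x [_ ux]; exact: polar_unitary.
- by move=> u; exact: polar_id.
Qed.

End Spectral.

(** * Spaces of representations *)

Section Representations.
Context {R : realType}.
Local Notation C := (Cplx R).

Definition rep (A : starAlgType R) m (p : A -> 'M[C]_m) : Prop :=
  [/\ linear p, forall x y, p (amul x y) = p x *m p y,
      forall x, p (star x) = ctr (p x) & p aone = 1%:M].

Definition reps (A : starAlgType R) m : set {ptws A -> 'M[C]_m} :=
  [set p | rep p].

Section Theory.
Context {A : starAlgType R} {m : nat} {p : A -> 'M[C]_m}.
Hypothesis pP : rep p.

Lemma repM x y : p (amul x y) = p x *m p y. Proof. by case: pP. Qed.
Lemma repS x : p (star x) = ctr (p x). Proof. by case: pP. Qed.
Lemma rep1 : p aone = 1%:M. Proof. by case: pP. Qed.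
Lemma repD x y : p (x + y) = p x + p y.
Proof. by case: pP => lp _ _ _; rewrite -[x]scale1r lp !scale1r. Qed.
Lemma rep0 : p 0 = 0.
Proof. by apply: (addrI (p 0)); rewrite -repD !addr0. Qed.
Lemma repZ c x : p (c *: x) = c *: p x.
Proof. by case: pP => lp _ _ _; rewrite -[c *: x]addr0 lp rep0 addr0. Qed.
Lemma repN x : p (- x) = - p x.
Proof. by rewrite -scaleN1r repZ scaleN1r. Qed.
Lemma repB x y : p (x - y) = p x - p y.
Proof. by rewrite repD repN. Qed.
Lemma rep_sum (I : Type) (s : seq I) (F : I -> A) :
  p (\sum_(i <- s) F i) = \sum_(i <- s) p (F i).
Proof.
elim: s => [|i s IH]; first by rewrite !big_nil rep0.
by rewrite !big_cons repD IH.
Qed.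

(** The second hypothesis says that the row space of [V] is invariant under [p], which makes
    compression to it multiplicative. *)
Lemma rep_compress r (V : 'M[C]_(r, m)) :
  V *m ctr V = 1%:M -> (forall a, V *m p a *m ctr V *m V = V *m p a) ->
  rep (fun a => V *m p a *m ctr V).
Proof.
move=> VV Vp; split.
- by move=> c x y; rewrite repD repZ mulmxDr mulmxDl -scalemxAr -scalemxAl.
- by move=> x y; rewrite repM !mulmxA Vp.
- by move=> x; rewrite repS !ctrM ctrK mulmxA.
- by rewrite rep1 mulmx1 VV.
Qed.

Lemma rep_conj (u : 'M[C]_m) : ctr u *m u = 1%:M ->
  rep (fun a => u *m p a *m ctr u).
Proof.
move=> uu; apply: rep_compress; first exact: mulmx1C.
by move=> a; rewrite -mulmxA uu mulmx1.
Qed.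

End Theory.

Lemma rep_dsum (A : starAlgType R) m r s (p1 : A -> 'M[C]_r) (p2 : A -> 'M[C]_s)
    (V1 : 'M[C]_(r, m)) (V2 : 'M[C]_(s, m)) : rep p1 -> rep p2 ->
  V1 *m ctr V1 = 1%:M -> V2 *m ctr V2 = 1%:M -> V1 *m ctr V2 = 0 ->
  ctr V1 *m V1 + ctr V2 *m V2 = 1%:M ->
  rep (fun a => ctr V1 *m p1 a *m V1 + ctr V2 *m p2 a *m V2).
Proof.
move=> r1 r2 V11 V22 V12 V1122.
have V21 : V2 *m ctr V1 = 0.
  by rewrite -[LHS]ctrK ctrM ctrK V12; apply/matrixP => i j; rewrite !mxE rmorph0.
split.
- move=> c x y; rewrite !repD// !repZ// !mulmxDr !mulmxDl -!scalemxAr -!scalemxAl.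
  by rewrite scalerDr addrACA.
- move=> x y; rewrite !repM// mulmxDr !mulmxDl !mulmxA.
  rewrite -(mulmxA _ V1 (ctr V1)) -(mulmxA _ V2 (ctr V1)) -(mulmxA _ V1 (ctr V2)) -(mulmxA _ V2 (ctr V2)).
  by rewrite V11 V22 V12 V21 !mulmx0 !mulmx1 !mul0mx addr0 add0r.
- by move=> x; rewrite !repS// ctrD !ctrM !ctrK !mulmxA.
- by rewrite (rep1 r1) (rep1 r2) !mulmx1.
Qed.

Lemma cts_on_eval (A : starAlgType R) m (S : set {ptws A -> 'M[C]_m}) a :
  cts_on S (fun p : {ptws A -> 'M[C]_m} => p a).
Proof. exact/cts_on_cts/ptws_eval. Qed.

(* The Casimir element gives an intertwiner [X p] between p0 and p that is the
   identity for p = p0; its polar part conjugates p0 to p. *)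
Lemma ane_casimir (F : starAlgType R) n (a b : 'I_n -> F) :
  \sum_i amul (a i) (b i) = aone ->
  (forall m (p p0 : F -> 'M[C]_m), rep p -> rep p0 -> forall x,
    \sum_i p (amul x (a i)) *m p0 (b i) = \sum_i p (a i) *m p0 (amul (b i) x)) ->
  forall m, ane R (@reps F m).
Proof.
move=> ab1 cas m; apply: ane_of_local => p0 p0P.
pose X (p : {ptws F -> 'M[C]_m}) := \sum_i p (a i) *m p0 (b i) : 'M[C]_m.
have cX S : cts_on S X.
  by apply: cts_on_summx => i; apply: cts_on_mulmx; [exact: cts_on_eval|exact: cts_on_cst].
have X0 : X p0 = 1%:M.
  by rewrite /X -(rep1 p0P) -ab1 rep_sum//; apply: eq_bigr => i _; rewrite repM.
pose U := [set p | X p \in unitmx].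
have oU : open U.
  have -> : U = setT `&` X @^-1` [set x | x \in unitmx] by rewrite setTI.
  by apply: cts_on_open; [exact: openT|exact: cX|exact: open_unitmx].
exists U; split => //; first by rewrite /U/= X0 unitmx1.
have inter p x : rep p -> p x *m X p = X p *m p0 x.
  move=> pP; rewrite /X mulmx_sumr mulmx_suml.
  under eq_bigr do rewrite mulmxA -repM//.
  by rewrite cas//; apply: eq_bigr => i _; rewrite repM// mulmxA.
apply: (ane_retract (i := fun p => polar (X p))
  (r := fun u => (fun x => u *m p0 x *m ctr u) : {ptws F -> 'M[C]_m}) (@ane_unitaries R m)) => //.
- by apply: cts_on_polar; [move=> p []|exact: cX].
- by move=> p _ Up; exact: polar_unitary.
- apply/cts_on_ptws => x.
  have cid : cts_on (@unitaries R m) (@id 'M[C]_m) by move=> u _ V; apply: filterS.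
  apply: cts_on_mulmx; last exact: cts_on_ctr cid.
  by apply: (cts_on_mulmx cid); exact: cts_on_cst.
- by move=> u uu; exact: rep_conj.
(* As [p] and [p0] preserve adjoints, [ctr (X p) *m X p] commutes with [p0], and so does its inverse
   square root; hence the polar part of [X p] is again an intertwiner. *)
- move=> p pP Up; apply/funext => x.
  rewrite -[RHS]mulmx1 -(unitary_C (polar_unitary Up)) mulmxA; congr (_ *m _).
  rewrite polarE mulmxA inter// -!mulmxA; congr (_ *m _).
  have yh := ctr_gram (X p).
  apply/esym; apply: fcalc_comm => //.
  rewrite -mulmxA -inter// !mulmxA; congr (_ *m _).
  by rewrite -[p0 x]ctrK -(repS p0P) -ctrM -inter// (repS pP) ctrM ctrK.
Qed.

Definition eigrows m (H : 'M[C]_m) (J : {set 'I_m}) : 'M[C]_(#|J|, m) :=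
  \matrix_(a, b) eigbasis H (enum_val a) b.

Lemma eigbasis_inner m (H : 'M[C]_m) a b :
  \sum_k eigbasis H a k * (eigbasis H b k)^* = (a == b)%:R.
Proof.
have [/matrixP/(_ a b) + _] := eigbasis_unitary H; rewrite !mxE => <-.
by apply: eq_bigr => k _; rewrite !mxE.
Qed.

Lemma eigrows_unit m (H : 'M[C]_m) J : eigrows H J *m ctr (eigrows H J) = 1%:M.
Proof.
apply/matrixP => a b; rewrite !mxE; under eq_bigr do rewrite !mxE.
by rewrite eigbasis_inner (inj_eq enum_val_inj).
Qed.

Lemma eigrows_proj m (H : 'M[C]_m) (J : {set 'I_m}) f :
  (forall k, f (eigval H k) = (k \in J)%:R) ->
  ctr (eigrows H J) *m eigrows H J = fcalc f H.
Proof.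
move=> fJ; rewrite fcalcE; apply/matrixP => a b; rewrite !mxE.
under eq_bigr do rewrite !mxE.
rewrite -(big_enum_val (fun k => (eigbasis H k a)^* * eigbasis H k b)).
under [RHS]eq_bigr => k _.
  rewrite !mxE (bigD1 k)//= big1 => [|l lk]; last first.
    by rewrite !mxE (negbTE lk) mulr0n mulr0.
  rewrite !mxE eqxx mulr1n addr0 fJ; over.
rewrite big_mkcond; apply: eq_bigr => k _.
by case: (k \in J); rewrite ?rmorph1 ?mulr1// rmorph0 mulr0 mul0r.
Qed.

(** * Splitting representations along a central element *)

Section Splitting.
Context {A : starAlgType R} {m : nat}.
Hypothesis IH : forall r, (r < m)%N -> ane R (@reps A r).

Lemma eigval_gap (H : 'M[C]_m) i j : eigval H i < eigval H j ->
  exists t, [/\ eigval H i < t, t < eigval H j & forall k, eigval H k != t].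
Proof.
(* The least eigenvalue above the one at [i]; the gap value [t] is taken halfway. *)
move=> ij; pose e := \big[Num.min/eigval H j]_(k | eigval H i < eigval H k) eigval H k.
have ei : eigval H i < e by apply: lt_bigmin.
have ej : e <= eigval H j by apply: bigmin_le_cond.
exists ((eigval H i + e) / 2); split; [lra|lra|move=> k].
have [ki|ik] := leP (eigval H k) (eigval H i); first by rewrite lt_eqF//; lra.
have : e <= eigval H k by apply: bigmin_le_cond.
by move=> ek; rewrite gt_eqF//; lra.
Qed.

Let step (t x : R) : R := (t < x)%R%:R.

Let step_cts t x : x != t -> {for x, continuous (step t)}.
Proof.
move=> xt V Vx; have : nbhs (step t x) V by []; move=> /nbhs_singleton Vs.
have : \forall y \near x, step t y = step t x.
  have [tx|tx|xtE] := ltgtP t x.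
  - have : nbhs x [set y | t < y] by apply: open_nbhs_nbhs; split => //; exact: open_gt.
    by apply: filterS => y /= ty; rewrite /step ty tx.
  - have : nbhs x [set y | y < t] by apply: open_nbhs_nbhs; split => //; exact: open_lt.
    by apply: filterS => y /= ty; rewrite /step !ltNge !(ltW ty) (ltW tx).
  - by rewrite xtE eqxx in xt.
by apply: filterS => y /= ->.
Qed.

(** The standard intertwiner of two projections: it is 1 when they coincide, hence invertible when
    they are close. *)
Let proj_intertwine (P P0 : 'M[C]_m) : P *m P = P -> P0 *m P0 = P0 ->
  P *m (P *m P0 + (1%:M - P) *m (1%:M - P0)) =
  (P *m P0 + (1%:M - P) *m (1%:M - P0)) *m P0.
Proof.
move=> PP PP0; have PnP : P *m (1%:M - P) = 0 by rewrite mulmxBr mulmx1 PP subrr.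
have nPP0 : (1%:M - P0) *m P0 = 0 by rewrite mulmxBl mul1mx PP0 subrr.
rewrite mulmxDr (mulmxDl (P *m P0)) !mulmxA PP PnP mul0mx addr0.
by rewrite -(mulmxA P) -(mulmxA (1%:M - P)) PP0 nPP0 mulmx0 addr0.
Qed.

Let conj1B (u P : 'M[C]_m) : ctr u *m u = 1%:M ->
  u *m (1%:M - P) *m ctr u = 1%:M - u *m P *m ctr u.
Proof. by move=> /unitary_C uu; rewrite mulmxBr mulmxBl mulmx1 uu. Qed.

Let comm1B (P M : 'M[C]_m) : M *m P = P *m M -> (1%:M - P) *m M = M *m (1%:M - P).
Proof. by move=> MP; rewrite mulmxBl mulmxBr MP mul1mx mulmx1. Qed.

Let pinch (P M : 'M[C]_m) : P *m P = P -> M *m P = P *m M ->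
  P *m M *m P + (1%:M - P) *m M *m (1%:M - P) = M.
Proof.
move=> PP MP; rewrite (comm1B MP) -!mulmxA MP !mulmxA PP -mulmxA.
have -> : (1%:M - P) *m (1%:M - P) = 1%:M - P.
  by rewrite mulmxBl mul1mx mulmxBr mulmx1 PP subrr subr0.
by rewrite mulmxBr mulmx1 MP addrC subrK.
Qed.

(** The spectral projection of [p c] above a gap [t] moves continuously with [p], and it commutes
    with [p] because [c] is central. A unitary depending on [p] carries the projection of [p0] to
    that of [p]; after conjugation [p] is a sum of two smaller representations in fixed frames. So,
    near [p0], representations are a retract of the unitaries times two spaces covered by
    induction. *)
Lemma rep_split_ane (p0 : {ptws A -> 'M[C]_m}) (c : A) i j : rep p0 ->
  (forall x, amul c x = amul x c) -> star c = c ->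
  eigval (p0 c) i < eigval (p0 c) j ->
  exists U : set {ptws A -> 'M[C]_m}, [/\ open U, U p0 & ane R (@reps A m `&` U)].
Proof.
move=> p0P cC cS ij; have [t [it tj tP]] := eigval_gap ij.
have herm p : rep p -> ctr (p c) = p c by move=> pP; rewrite -(repS pP) cS.
set H0 := p0 c in ij it tj tP; have H0h : ctr H0 = H0 := herm _ p0 p0P.
pose I1 := [set k | t < eigval H0 k]%SET.
pose V1 := eigrows H0 I1.
pose V2 := eigrows H0 (~: I1)%SET.
have rm : (#|I1| < m)%N.
  rewrite -[X in (_ < X)%N]card_ord -cardsT; apply/proper_card/properP; split; first exact: finset.subsetT.
  by exists i => //; rewrite inE -leNgt ltW.
have sm : (#|(~: I1)%SET| < m)%N.
  rewrite -[X in (_ < X)%N]card_ord -cardsT; apply/proper_card/properP; split; first exact: finset.subsetT.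
  by exists j => //; rewrite !inE negbK.
have V11 : V1 *m ctr V1 = 1%:M by exact: eigrows_unit.
have V22 : V2 *m ctr V2 = 1%:M by exact: eigrows_unit.
have V12 : V1 *m ctr V2 = 0.
  apply/matrixP => a b; rewrite !mxE; under eq_bigr do rewrite !mxE.
  rewrite eigbasis_inner; case: eqP => // ab; have := enum_valP b; rewrite -ab finset.in_setC.
  by rewrite (enum_valP a).
pose P0 := fcalc (step t) H0.
have P0E : ctr V1 *m V1 = P0.
  by apply: eigrows_proj => k; rewrite /step inE.
have P0E' : ctr V2 *m V2 = 1%:M - P0.
  rewrite (@eigrows_proj _ _ _ (fun x => 1 - step t x)); last first.
    by move=> k; rewrite /step !inE; case: (t < _); rewrite /= ?subrr ?subr0.
  by rewrite -fcalcB fcalc_cst rmorph1.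
pose P (p : A -> 'M[C]_m) := fcalc (step t) (p c).
have PP p : P p *m P p = P p.
  by rewrite /P fcalcM; apply: fcalc_ext => k; rewrite /step; case: (t < _); rewrite ?mulr1 ?mulr0.
have Ph p : ctr (P p) = P p by exact: fcalc_herm.
have Pcomm p a : rep p -> p a *m P p = P p *m p a.
  by move=> pP; apply: fcalc_comm; rewrite ?herm// -!repM// cC.
pose X p := P p *m P0 + (1%:M - P p) *m (1%:M - P0).
have X0 : X p0 = 1%:M.
  rewrite /X (_ : P0 = P p0)// mulmxBl mul1mx mulmxBr mulmx1 PP subrr subr0.
  by rewrite addrC subrK.
have XP p : P p *m X p = X p *m P0.
  exact: (proj_intertwine (PP p) (PP p0)).
pose good := [set p : {ptws A -> 'M[C]_m} | rep p -> (forall k, eigval (p c) k != t) /\ X p \in unitmx].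
have cP (S : set {ptws A -> 'M[C]_m}) : (forall p, S p -> rep p /\ forall k, eigval (p c) k != t) ->
    cts_on S (fun p : {ptws A -> 'M[C]_m} => P p).
  move=> SP; apply: cts_on_fcalc.
  - by move=> p /SP[/herm].
  - by move=> p k /SP[_ pt]; apply: step_cts.
  - exact: cts_on_eval.
have cX (S : set {ptws A -> 'M[C]_m}) : (forall p, S p -> rep p /\ forall k, eigval (p c) k != t) ->
    cts_on S (fun p : {ptws A -> 'M[C]_m} => X p).
  move=> /cP cPS; have c1 : cts_on S (fun p : {ptws A -> 'M[C]_m} => 1%:M - P p).
    apply: cts_on_addmx; first exact: cts_on_cst.
    have := cts_on_scalemx (@cts_on_cst _ C S (-1)) cPS.
    by apply: cts_on_ext => p _; rewrite scaleN1r.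
  exact: (cts_on_addmx (cts_on_mulmx cPS (@cts_on_cst _ _ _ P0)) (cts_on_mulmx c1 (@cts_on_cst _ _ _ (1%:M - P0)))).
pose S1 := [set p : {ptws A -> 'M[C]_m} | rep p /\ forall k, eigval (p c) k != t].
have near_spec : nbhs p0 [set p : {ptws A -> 'M[C]_m} | rep p -> forall k, eigval (p c) k != t].
  have no i' : nbhs (eigval H0 i') [set x | x != t].
    have -> : [set x | x != t] = ~` [set t].
      by apply/funext => x /=; rewrite propeqE; split => /eqP.
    apply: open_nbhs_nbhs; split; last exact/eqP.
    exact: closed_openC.
  have := eigval_near H0h no.
  move=> /(@cts_on_eval A m setT c (p0 : {ptws A -> 'M[C]_m}) I); apply: filterS => p H pP k.
  by apply: H => //; exact: herm.
have near_good : nbhs p0 good.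
  have p0S1 : S1 p0 by [].
  have : nbhs (X p0) [set x | x \in unitmx].
    by apply: open_nbhs_nbhs; split; [exact: open_unitmx|rewrite X0/= unitmx1].
  move=> /(cX S1 (fun p => id) p0 p0S1) H.
  apply: filterS (filterI near_spec H) => p [Hs HX] pP.
  by split; [exact: Hs|apply: HX; split => //; exact: Hs].
exists (interior good); split; [exact: open_interior|exact: near_good|].
have goodP p : (@reps A m `&` interior good) p ->
    [/\ rep p, forall k, eigval (p c) k != t & X p \in unitmx].
  by move=> [pP /interior_subset/(_ pP)[]].
pose u p := polar (X p).
have uP p : X p \in unitmx -> P p *m u p = u p *m P0.
  move=> uX; rewrite /u polarE mulmxA XP -!mulmxA; congr (_ *m _).
  apply: fcalc_comm; rewrite ?ctr_gram//.
  have XP' : ctr (X p) *m P p = P0 *m ctr (X p).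
    by rewrite -[LHS]ctrK ctrM ctrK Ph XP ctrM fcalc_herm.
  by rewrite mulmxA -XP' -!mulmxA XP.
(* The unitary [u p] carries [P0] to [P p], so [p], conjugated back by it, is block diagonal for
   [V1] and [V2]; [ii] records the unitary and the blocks, and [rr] reassembles them. *)
pose ii (p : {ptws A -> 'M[C]_m}) := (u p : 'M[C]_m,
  ((fun a => (V1 *m ctr (u p)) *m p a *m ctr (V1 *m ctr (u p))) : {ptws A -> 'M[C]_(#|I1|)},
   (fun a => (V2 *m ctr (u p)) *m p a *m ctr (V2 *m ctr (u p))) : {ptws A -> 'M[C]_(#|(~: I1)%SET|)})).
pose rr (z : 'M[C]_m * ({ptws A -> 'M[C]_(#|I1|)} * {ptws A -> 'M[C]_(#|(~: I1)%SET|)})) :=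
  (fun a => z.1 *m (ctr V1 *m z.2.1 a *m V1 + ctr V2 *m z.2.2 a *m V2) *m ctr z.1) : {ptws A -> 'M[C]_m}.
have aE := ane_setX (@ane_unitaries R m) (ane_setX (IH rm) (IH sm)).
apply: (ane_retract (i := ii) (r := rr) aE).
- exact: open_interior.
- have cu : cts_on (@reps A m `&` interior good) (fun p : {ptws A -> 'M[C]_m} => u p).
    apply: cts_on_polar; first by move=> p /goodP[].
    by apply: cX => p /goodP[].
  have cV r' (V : 'M[C]_(r', m)) a : cts_on (@reps A m `&` interior good)
      (fun p : {ptws A -> 'M[C]_m} => (V *m ctr (u p)) *m p a *m ctr (V *m ctr (u p))).
    have c1 : cts_on (@reps A m `&` interior good) (fun p : {ptws A -> 'M[C]_m} => V *m ctr (u p)).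
      exact: (cts_on_mulmx (@cts_on_cst _ _ _ V) (cts_on_ctr cu)).
    exact: (cts_on_mulmx (cts_on_mulmx c1 (@cts_on_eval A m _ a)) (cts_on_ctr c1)).
  apply: cts_on_pair; first exact: cu.
  by apply: cts_on_pair; apply/cts_on_ptws => a; exact: cV.
- move=> p pP gp; have [_ pt uX] := goodP p (conj pP gp).
  have uu := polar_unitary uX.
  have comp r' (V : 'M[C]_(r', m)) Q : V *m ctr V = 1%:M -> ctr V *m V = Q ->
      (forall a, u p *m Q *m ctr (u p) *m p a = p a *m (u p *m Q *m ctr (u p))) ->
      rep (fun a => (V *m ctr (u p)) *m p a *m ctr (V *m ctr (u p))).
    move=> VV VQ Qc; apply: rep_compress => //.
      by rewrite ctrM ctrK mulmxA -(mulmxA V) uu mulmx1.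
    move=> a; rewrite ctrM ctrK -!mulmxA (mulmxA (ctr V)) VQ (mulmxA (u p)) -Qc.
    rewrite -VQ !mulmxA -(mulmxA _ (ctr (u p)) (u p)) uu mulmx1.
    by rewrite VV mul1mx.
  have E1 : u p *m P0 *m ctr (u p) = P p by rewrite -uP// -mulmxA unitary_C// mulmx1.
  have E2 : u p *m (1%:M - P0) *m ctr (u p) = 1%:M - P p.
    by rewrite (conj1B P0 uu); congr (_ - _).
  split; first exact: uu.
  split => /=; first by apply: (comp _ _ P0 V11 P0E) => a; rewrite E1 Pcomm.
  by apply: (comp _ _ (1%:M - P0) V22 P0E') => a; rewrite E2; apply: comm1B; exact: Pcomm.
- pose T' := ('M[C]_m * ({ptws A -> 'M[C]_(#|I1|)} * {ptws A -> 'M[C]_(#|(~: I1)%SET|)}))%type.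
  apply/cts_on_ptws => a; set S := _ `*` _.
  have cid : cts_on S (@id T') by move=> z _ V; apply: filterS.
  have cz1 : cts_on S (fun z : T' => z.1) by exact: cts_on_fst cid.
  have cz21 : cts_on S (fun z : T' => z.2.1 a).
    exact: (cts_on_compT (cts_on_fst (cts_on_snd cid)) (@ptws_eval A _ a)).
  have cz22 : cts_on S (fun z : T' => z.2.2 a).
    exact: (cts_on_compT (cts_on_snd (cts_on_snd cid)) (@ptws_eval A _ a)).
  apply: (cts_on_mulmx _ (cts_on_ctr cz1)); apply: (cts_on_mulmx cz1); apply: cts_on_addmx.
    exact: (cts_on_mulmx (cts_on_mulmx (@cts_on_cst _ _ _ _) cz21) (@cts_on_cst _ _ _ _)).
  exact: (cts_on_mulmx (cts_on_mulmx (@cts_on_cst _ _ _ _) cz22) (@cts_on_cst _ _ _ _)).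
- move=> [v [p1 p2]] [/= vv [/= r1 r2]].
  have rd := rep_dsum r1 r2 V11 V22 V12; apply: rep_conj => //; apply: rd.
  by rewrite P0E P0E' addrC subrK.
- move=> p pP gp; have [_ pt uX] := goodP p (conj pP gp).
  have uu := polar_unitary uX.
  have E1 : u p *m P0 *m ctr (u p) = P p by rewrite -uP// -mulmxA unitary_C// mulmx1.
  have E2 : u p *m (1%:M - P0) *m ctr (u p) = 1%:M - P p.
    by rewrite (conj1B P0 uu); congr (_ - _).
  apply/funext => a; rewrite /rr /ii /=.
  have part r' (V : 'M[C]_(r', m)) Q Q' : ctr V *m V = Q -> u p *m Q *m ctr (u p) = Q' ->
    u p *m (ctr V *m (V *m ctr (u p) *m p a *m ctr (V *m ctr (u p))) *m V) *m ctr (u p) = Q' *m p a *m Q'.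
    by move=> VQ <-; rewrite -VQ ctrM ctrK !mulmxA.
  rewrite mulmxDr mulmxDl (part _ _ _ _ P0E E1) (part _ _ _ _ P0E' E2).
  by apply: pinch; [exact: PP|exact: Pcomm].
Qed.

End Splitting.
End Representations.

(** * Finite dimensional algebras *)

Section TraceNilpotent.
Context {F : fieldType}.
Hypothesis charF : forall n, (n.+1%:R : F) != 0.

(** A full-rank factorization e = c r of an idempotent satisfies r c = 1. *)
Lemma idempotent_trace n (e : 'M[F]_n) : e *m e = e -> \tr e = (\rank e)%:R.
Proof.
move=> ee; move: (row_base_free e) (col_base_full e) (mulmx_base e).
move: (row_base e) (col_base e) => r c r_free c_full cr.
rewrite -[in LHS]cr mxtrace_mulC -[RHS]mxtrace1; congr (\tr _).
apply: (row_free_inj r_free); apply: (row_full_inj c_full) => /=.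
by rewrite mul1mx -mulmxA cr mulmxA cr ee.
Qed.

(** Fitting's decomposition: the projection onto the part where [M] is invertible is a polynomial in
    [M] without constant term. Its trace is therefore 0, and so is its rank. *)
Lemma trace_nilpotent n (M : 'M[F]_n.+1) :
  (forall i, \tr (M ^+ i.+1) = 0) -> exists N, M ^+ N = 0.
Proof.
move=> trM; have trH r k : \tr (horner_mx M r * M ^+ k.+1) = 0.
  elim/poly_ind: r k => [|r c IH] k; first by rewrite rmorph0 mul0r mxtrace0.
  rewrite rmorphD rmorphM/= horner_mx_X horner_mx_C mulrDl -mulrA -exprS.
  by rewrite mxtraceD IH add0r -mulmxE mul_scalar_mx mxtraceZ trM mulr0.
have [s [q qX pE]] := multiplicity_XsubC (mxminpoly M) 0.
have p0 := monic_neq0 (mxminpoly_monic M); rewrite p0 /= subr0 in qX pE.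
(* The exponent s + 1 makes [e] a multiple of [M] even when s = 0. *)
have : coprimep ('X^(s.+1)) q.
  by apply: coprimep_expl; rewrite coprimep_sym coprimepX.
move=> /Bezout_eq1_coprimepP[[u v] /= uv].
have pM : horner_mx M (q * 'X^s) = 0 by rewrite -pE mx_root_minpoly.
pose e := horner_mx M (u * 'X^(s.+1)).
have e1 : 1 - e = horner_mx M (v * q).
  by rewrite /e -(rmorph1 (horner_mx M)) -rmorphB -uv addrC addKr.
have ee : e *m e = e.
  apply/eqP; rewrite mulmxE -subr_eq0 -{3}[e]mulr1 -mulrBr -opprB mulrN e1 /e -rmorphM.
  have -> : u * 'X^(s.+1) * (v * q) = u * v * 'X * (q * 'X^s) by rewrite exprS; ring.
  by rewrite rmorphM/= pM mulr0 oppr0.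
have : \tr e = 0.
  by rewrite /e rmorphM rmorphXn/= horner_mx_X trH.
rewrite (idempotent_trace ee); case rk : (\rank e) => [|k] => [_|/eqP]; last first.
  by rewrite (negbTE (charF k)).
have e0 : e = 0 by apply/eqP; rewrite -mxrank_eq0 rk.
exists s; rewrite -[LHS]mulr1 -(subr0 1) -e0 e1.
have -> : M ^+ s = horner_mx M 'X^s by rewrite rmorphXn/= horner_mx_X.
rewrite -rmorphM (_ : 'X^s * (v * q) = v * (q * 'X^s)); last by ring.
by rewrite rmorphM/= pM mulr0.
Qed.

End TraceNilpotent.

(** * The trace form and the Casimir element *)

Section FiniteDimensional.
Context {R : realType}.
Local Notation C := (Cplx R).

Section Amul.
Context {A : starAlgType R}.
Implicit Types x y : A.

Lemma amulr0 x : amul x 0 = 0.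
Proof. by apply: (addrI (amul x 0)); rewrite -amulDr !addr0. Qed.
Lemma amul0r x : amul 0 x = 0.
Proof. by apply: (addrI (amul 0 x)); rewrite -amulDl !addr0. Qed.
Lemma amulBl x y z : amul (x - y) z = amul x z - amul y z.
Proof. by rewrite amulDl -scaleN1r amulZl scaleN1r. Qed.
Lemma amul_suml I (s : seq I) (f : I -> A) y :
  amul (\sum_(i <- s) f i) y = \sum_(i <- s) amul (f i) y.
Proof.
elim: s => [|i s IH]; first by rewrite !big_nil amul0r.
by rewrite !big_cons amulDl IH.
Qed.
Lemma amul_sumr I (s : seq I) (f : I -> A) y :
  amul y (\sum_(i <- s) f i) = \sum_(i <- s) amul y (f i).
Proof.
elim: s => [|i s IH]; first by rewrite !big_nil amulr0.
by rewrite !big_cons amulDr IH.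
Qed.
Lemma star0 : star (0 : A) = 0.
Proof. by apply: (addrI (star 0)); rewrite -starD !addr0. Qed.
Lemma star1 : star (aone : A) = aone.
Proof. by rewrite -[LHS]amul1l -{1}(starK aone) -starM amul1l starK. Qed.

Definition apow x n : A := iter n (amul x) aone.
Lemma apowD x i j : amul (apow x i) (apow x j) = apow x (i + j).
Proof. by elim: i => [|i IH]; rewrite ?amul1l// /apow/= -amulA; congr amul; exact: IH. Qed.
Lemma star_apow x n : star x = x -> star (apow x n) = apow x n.
Proof.
move=> sx; elim: n => [|n IH]; first by rewrite star1.
rewrite {1}/apow/= -/(apow x n) starM IH sx -[X in amul _ X](amul1r x).
by rewrite -[amul x aone]/(apow x 1) apowD addn1.
Qed.
End Amul.

(** A spanning family of least length is a basis. *)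
Lemma finite_dimensional_basis (A : starAlgType R) : finite_dimensional A ->
  exists (n : nat) (e : 'I_n -> A),
    (forall a, exists c : 'rV[C]_n, a = \sum_i c 0 i *: e i) /\
    (forall c : 'rV[C]_n, \sum_i c 0 i *: e i = 0 -> c = 0).
Proof.
move=> [n0 [e0 sp0]].
pose P n := `[< exists e : 'I_n -> A, forall a, exists c : 'rV[C]_n, a = \sum_i c 0 i *: e i >].
have : exists n, P n.
  exists n0; apply/asboolP; exists e0 => a; have [c ->] := sp0 a.
  by exists (\row_i c i); apply: eq_bigr => i _; rewrite mxE.
move=> exP; case: (ex_minnP exP) => n /asboolP[e sp] minn.
exists n, e; split => // c c0; apply/eqP; apply: contraT => cn0.
have [j cj] : exists j, c 0 j != 0.
  apply/existsP; apply: contraNT cn0; rewrite negb_exists => /forallP H.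
  by apply/eqP/rowP => j; rewrite mxE; apply/eqP; have := H j; rewrite negbK.
case: n e sp minn c c0 cn0 j cj => [|n] e sp minn c c0 cn0 j cj; first by case: j cj.
suff : P n by move=> /minn; rewrite ltnn.
apply/asboolP; exists (fun i => e (lift j i)) => a; have [d ->] := sp a.
exists (\row_i (d 0 (lift j i) - d 0 j / c 0 j * c 0 (lift j i))).
have ej : e j = - \sum_(i < n) (c 0 (lift j i) / c 0 j) *: e (lift j i).
  move: c0; rewrite (bigD1_ord j)//= => /eqP; rewrite addr_eq0 => /eqP h.
  rewrite -[LHS]scale1r -(mulVf cj) -scalerA h scalerN scaler_sumr; congr (- _).
  by apply: eq_bigr => i _; rewrite scalerA mulrC.
rewrite (bigD1_ord j)//= ej scalerN scaler_sumr addrC -sumrB.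
by apply: eq_bigr => i _; rewrite mxE scalerBl scalerA; congr (_ - _ *: _); rewrite mulrA mulrAC.
Qed.

(** The exponent is first raised to a power of two. The C*-identity, applied to a self-adjoint power
    of [x], then halves it step by step. *)
Lemma selfadjoint_nilpotent (A : cstarType R) (x : A) n :
  star x = x -> apow x n = 0 -> x = 0.
Proof.
move=> sx xn; have {xn} : apow x (2 ^ n)%N = 0.
  have nn : (n <= 2 ^ n)%N by exact/ltnW/ltn_expl.
  by rewrite -(subnK nn) -apowD xn amulr0.
elim: n => [|n IH]; first by rewrite expn0 /apow/= amul1r.
rewrite expnS mul2n -addnn -apowD => H; apply: IH.
have := cstar_identity (apow x (2 ^ n)%N); rewrite star_apow// H normr0.
by move=> /esym/eqP; rewrite expf_eq0/= normr_eq0 => /eqP.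
Qed.

Lemma cstar_mul_star_eq0 (A : cstarType R) (x : A) : amul x (star x) = 0 -> x = 0.
Proof.
move=> H; have := cstar_identity (star x); rewrite starK H normr0.
move=> /esym/eqP; rewrite expf_eq0/= normr_eq0 => /eqP sx.
by rewrite -(starK x) sx star0.
Qed.

(** The trace form of the regular representation is nondegenerate, so the basis has a dual basis,
    and the two give the Casimir element; cyclicity of the trace moves [x] across it. *)
Lemma ane_finite_dimensional (A : cstarType R) m :
  finite_dimensional A -> ane R (@reps R A m).
Proof.
(* The zero algebra has an empty basis and is treated apart; otherwise the size [n.+1] makes the
   square matrices a ring. *)
move=> /finite_dimensional_basis[[|n] [e [sp ind]]].
  apply: (@ane_casimir _ _ 0 (fun=> 0) (fun=> 0)) => [|m' p p0 _ _ x].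
    by have [c ->] := sp (aone : A); rewrite !big_ord0.
  by rewrite !big_ord0.
have /choice[co coE] : forall a, exists c : 'rV[C]_n.+1, a = \sum_i c 0 i *: e i by exact: sp.
have coU (c : 'rV[C]_n.+1) (a : A) : \sum_i c 0 i *: e i = a -> co a = c.
  move=> ca; apply/eqP; rewrite -subr_eq0; apply/eqP/ind.
  under eq_bigr do rewrite !mxE scalerBl.
  by rewrite sumrB ca -coE subrr.
have coD x y : co (x + y) = co x + co y.
  by apply: coU; under eq_bigr do rewrite mxE scalerDl; rewrite big_split/= -!coE.
have coZ c x : co (c *: x) = c *: co x.
  apply: coU; under eq_bigr do rewrite mxE -scalerA.
  by rewrite -scaler_sumr -coE.
have co0 : co 0 = 0 by rewrite -(scale0r 0) coZ scale0r.
have co_sum I (s : seq I) (f : I -> A) : co (\sum_(i <- s) f i) = \sum_(i <- s) co (f i).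
  by elim: s => [|i s IH]; rewrite ?big_nil// !big_cons coD IH.
have coe i : co (e i) = delta_mx 0 i.
  apply: coU; rewrite (bigD1 i)//= mxE !eqxx scale1r big1 ?addr0// => j ji.
  by rewrite mxE eqxx (negbTE ji) scale0r.
(* Right multiplication by [a] on coordinate rows; acting on rows from the right, it is
   multiplicative without reversal. *)
pose Mr a : 'M[C]_n.+1 := \matrix_(i, j) co (amul (e i) a) 0 j.
have coM x b : co (amul x b) = co x *m Mr b.
  rewrite {1}[x]coE amul_suml co_sum; apply/rowP => j; rewrite summxE mxE.
  by apply: eq_bigr => i _; rewrite amulZl coZ !mxE.
have MrM a b : Mr (amul a b) = Mr a *m Mr b.
  apply/matrixP => i j; rewrite mxE amulA coM !mxE.
  by apply: eq_bigr => k _; rewrite !mxE.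
have Mr1 : Mr aone = 1.
  by apply/matrixP => i j; rewrite mxE amul1r coe !mxE eqxx eq_sym.
have MrD a b : Mr (a + b) = Mr a + Mr b.
  by apply/matrixP => i j; rewrite !mxE amulDr coD mxE.
have MrZ c a : Mr (c *: a) = c *: Mr a.
  by apply/matrixP => i j; rewrite !mxE amulZr coZ mxE.
pose tau a := \tr (Mr a).
have tauD a b : tau (a + b) = tau a + tau b by rewrite /tau MrD mxtraceD.
have tauZ c a : tau (c *: a) = c * tau a by rewrite /tau MrZ mxtraceZ.
have tau0 : tau 0 = 0 by rewrite -(scale0r 0) tauZ mul0r.
have tau_sum I (s : seq I) (f : I -> A) : tau (\sum_(i <- s) f i) = \sum_(i <- s) tau (f i).
  by elim: s => [|i s IH]; rewrite ?big_nil// !big_cons tauD IH.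
have tauC a b : tau (amul a b) = tau (amul b a) by rewrite /tau !MrM mxtrace_mulC.
have Mrpow x k : Mr (apow x k) = Mr x ^+ k.
  by elim: k => [|k IH]; rewrite ?Mr1// exprS -IH -mulmxE -MrM.
(* If [a] is orthogonal to everything, all powers of right multiplication by [amul a (star a)] have
   trace 0. So this self-adjoint element is nilpotent, hence 0, and [a] is 0 by the C*-identity. *)
have nondeg a : (forall b, tau (amul a b) = 0) -> a = 0.
  move=> a0; pose x := amul a (star a).
  have [N xN] : exists N, Mr x ^+ N = 0.
    apply: trace_nilpotent => [k|k]; first by rewrite pnatr_eq0.
    by rewrite -Mrpow /apow/= -/(tau _) -amulA a0.
  apply: cstar_mul_star_eq0; apply: (@selfadjoint_nilpotent _ _ N).
    by rewrite starM starK.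
  by rewrite -[apow _ _]amul1l [LHS]coE coM Mrpow xN mulmx0 big1// => i _; rewrite mxE scale0r.
have nondeg_e a : (forall i, tau (amul a (e i)) = 0) -> a = 0.
  move=> a0; apply: nondeg => b; rewrite [b]coE amul_sumr tau_sum big1// => i _.
  by rewrite amulZr tauZ a0 mulr0.
pose G : 'M[C]_n.+1 := \matrix_(i, j) tau (amul (e i) (e j)).
have Gu : G \in unitmx.
  rewrite -row_free_unit -kermx_eq0; apply/rowV0P => v /sub_kermxP vG.
  apply: ind; apply: nondeg_e => j; rewrite amul_suml tau_sum.
  have /rowP/(_ j) := vG; rewrite !mxE => vj; rewrite -[RHS]vj.
  by apply: eq_bigr => i _; rewrite amulZl tauZ mxE.
pose f i := \sum_j invmx G i j *: e j.
have tfe i l : tau (amul (f i) (e l)) = (i == l)%:R.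
  have /matrixP/(_ i l) := mulVmx Gu; rewrite !mxE => <-.
  rewrite /f amul_suml tau_sum; apply: eq_bigr => j _.
  by rewrite amulZl tauZ mxE.
have co_tau x i : co x 0 i = tau (amul (f i) x).
  rewrite [x in RHS]coE amul_sumr tau_sum (bigD1 i)//= big1 => [|j ji].
    by rewrite amulZr tauZ tfe eqxx mulr1 addr0.
  by rewrite amulZr tauZ tfe eq_sym (negbTE ji) mulr0.
have dual y : y = \sum_i tau (amul y (e i)) *: f i.
  apply/eqP; rewrite -subr_eq0; apply/eqP/nondeg_e => l.
  rewrite amulBl tauD -scaleN1r tauZ mulN1r amul_suml tau_sum (bigD1 l)//= big1 => [|j jl].
    by rewrite amulZl tauZ tfe eqxx mulr1 addr0 subrr.
  by rewrite amulZl tauZ tfe (negbTE jl) mulr0.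
(* Pairing the sum of the [f i] times [e i] with [a] gives the trace of right multiplication by [a],
   that is [tau a]; hence the sum is the unit. *)
apply: (@ane_casimir _ _ _ f e) => [|m' p p0 pP p0P x].
  apply/eqP; rewrite -subr_eq0; apply/eqP/nondeg => a.
  rewrite amulBl amul1l tauD -scaleN1r tauZ mulN1r amul_suml tau_sum.
  apply/eqP; rewrite subr_eq0; apply/eqP; rewrite [RHS]/tau /mxtrace.
  by apply: eq_bigr => i _; rewrite mxE co_tau amulA.
transitivity (\sum_i \sum_l tau (amul (amul x (f i)) (e l)) *: (p (f l) *m p0 (e i))).
  apply: eq_bigr => i _; rewrite {1}[amul x (f i)]dual (rep_sum pP) mulmx_suml.
  by apply: eq_bigr => l _; rewrite (repZ pP) scalemxAl.
rewrite exchange_big/=; apply: eq_bigr => l _.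
rewrite [amul (e l) x]coE (rep_sum p0P) mulmx_sumr; apply: eq_bigr => i _.
by rewrite (repZ p0P) scalemxAr co_tau -amulA tauC -amulA.
Qed.

End FiniteDimensional.

(** * Countable coordinates on representation spaces *)

Section Spanning.
Context {R : realType}.
Local Notation C := (Cplx R).

(* A uniform form of separability, which makes the pointwise topology on
   representations metrizable. *)
Definition spanning (A : starAlgType R) :=
  exists a : nat -> A, forall x (e : R) M, 0 < e ->
    exists n (c : 'I_n -> C), forall m (p : A -> 'M[C]_m), (m <= M)%N -> rep p ->
      mxn (p (x - \sum_i c i *: a i)) < e.

(** The coordinates are real and imaginary parts of the matrix entries at the spanning elements. As
    the approximation is uniform over representations, finitely many coordinates control [p x] for
    any [x]. *)
Lemma spanning_cgen (A : starAlgType R) m : spanning A ->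
  exists E : nat -> {ptws A -> 'M[C]_m} -> R, cgen (@reps R A m) E.
Proof.
move=> [a aP].
pose E j (p : {ptws A -> 'M[C]_m}) : R :=
  if unpickle j is Some (i, r, s, b) then
    (if (b : bool) then cRe (p (a i) (r : 'I_m) (s : 'I_m)) else cIm (p (a i) r s)) else 0.
have Etrue i r s p : E (pickle (i, r, s, true)) p = cRe (p (a i) r s).
  by rewrite /E pickleK.
have Efalse i r s p : E (pickle (i, r, s, false)) p = cIm (p (a i) r s).
  by rewrite /E pickleK.
have approx x (e : R) : 0 < e -> exists n (c : 'I_n -> C), forall s t : A -> 'M[C]_m,
    rep s -> rep t -> mxn (s x - t x) <= e + \sum_i cnorm (c i) * mxn (s (a i) - t (a i)).
  move=> e0; have [n [c cP]] := aP x (e / 2) m (divr_gt0 e0 (ltr0n R 2)).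
  exists n, c => s t rs rt.
  have -> : s x - t x = s (x - \sum_i c i *: a i) - t (x - \sum_i c i *: a i) +
      \sum_i c i *: (s (a i) - t (a i)).
    rewrite (repB rs) (repB rt) (rep_sum rs) (rep_sum rt).
    under [X in _ = _ + X]eq_bigr do rewrite scalerBr -(repZ rs) -(repZ rt).
    rewrite sumrB opprB addrACA [X in _ = X + _]addrC; apply/eqP; rewrite -subr_eq0.
    by apply/eqP/matrixP => i j; rewrite !mxE; ring.
  apply: le_trans (mxnD _ _) _; apply: lerD.
    rewrite [leRHS]splitr; apply: le_trans (mxnD _ _) _; rewrite mxnN; apply: lerD.
      exact/ltW/(cP m).
    exact/ltW/(cP m).
  apply: le_trans (mxn_sum _ _ _) _; apply: ler_sum => i _; by rewrite mxnZ.
exists E; split.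
- move=> j; rewrite /E; case: (unpickle j) => [[[[i r] s] b]|]; last exact: cts_on_cst.
  have cc : cts_on (@reps R A m) (fun p : {ptws A -> 'M[C]_m} => p (a i) r s).
    exact: (cts_on_mx_coord (cts_on_eval (a := a i))).
  by case: b; [exact: cts_on_cRe cc|exact: cts_on_cIm cc].
- move=> s rs V sV.
  pose F : set_system {ptws A -> 'M[C]_m} := [set B | exists n e, 0 < e /\ forall t, rep t ->
        (forall j, (j < n)%N -> `|E j t - E j s| < e) -> B t].
  suff : F V by [].
  have FF : Filter F.
    split; first by exists 0%N, 1.
      move=> P Q [n [e [e0 eP]]] [n' [e' [e'0 e'Q]]].
      exists (maxn n n'), (Num.min e e'); split; first by rewrite lt_min e0.
      move=> t rt H; split.
        apply: eP => // j jn; have := H j; rewrite leq_max jn => /(_ isT).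
        by rewrite lt_min => /andP[].
      apply: e'Q => // j jn; have := H j; rewrite leq_max jn orbT => /(_ isT).
      by rewrite lt_min => /andP[].
    by move=> P Q PQ [n [e [e0 eP]]]; exists n, e; split => // t rt H; apply/PQ/eP.
  apply: (ptws_cvg FF _ sV) => x W /nbhs_mxnP[e e0 eW].
  have [n [c cP]] := approx x (e / 2) (divr_gt0 e0 (ltr0n R 2)).
  (* [K] accounts for the real coordinates of one matrix and [L] for the coefficients; the added 1
     keeps both positive, and for [K] it makes the last inequality strict. *)
  pose K : R := (m * m)%:R * 2 + 1; pose L : R := \sum_i cnorm (c i) + 1.
  have K0 : 0 < K by rewrite ltr_wpDl// mulr_ge0.
  have L0 : 0 < L by rewrite ltr_wpDl// sumr_ge0// => i _; exact: cnorm_ge0.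
  pose de := e / 2 / (K * L).
  have de0 : 0 < de by rewrite !divr_gt0// mulr_gt0.
  (* Beyond the code of every entry of the first [n] spanning elements. *)
  exists (\max_(z : ('I_n * 'I_m * 'I_m * bool)%type) (pickle (z.1.1.1 : nat, z.1.1.2, z.1.2, z.2)).+1)%N, de.
  split => // t rt H; apply: eW.
  have Hz (i : 'I_n) (r q : 'I_m) (b : bool) : `|E (pickle (i : nat, r, q, b)) t - E (pickle (i : nat, r, q, b)) s| < de.
    apply: H; pose z : ('I_n * 'I_m * 'I_m * bool)%type := (i, r, q, b).
    exact: (@leq_bigmax _ (fun z : ('I_n * 'I_m * 'I_m * bool)%type => (pickle (z.1.1.1 : nat, z.1.1.2, z.1.2, z.2)).+1) z).
  have clo (i : 'I_n) : mxn (t (a i) - s (a i)) <= (m * m)%:R * 2 * de.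
    rewrite -mulrA; apply: mxn_le => r q; apply: le_trans (cnorm_le_ReIm _) _.
    rewrite !mxE cRe_is_additive cIm_is_additive mulrDl mul1r.
    apply: lerD; first by have /ltW := Hz i r q true; rewrite !Etrue.
    by have /ltW := Hz i r q false; rewrite !Efalse.
  apply: (le_lt_trans (cP t s rt rs)); rewrite [ltRHS]splitr ltrD2l.
  apply: (@le_lt_trans _ _ (L * ((m * m)%:R * 2 * de))).
    rewrite /L mulrDl mulr_suml -[leLHS]addr0; apply: lerD; last first.
      by rewrite mul1r; apply: mulr_ge0; [exact: mulr_ge0|exact: ltW].
    by apply: ler_sum => i _; apply: ler_wpM2l; [exact: cnorm_ge0|exact: clo].
  have -> : e / 2 = L * (K * de) by rewrite /de; field; rewrite !gt_eqF.
  by rewrite ltr_pM2l// ltr_pM2r// /K ltrDl.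
- move=> s t rs rt H; apply/funext => x; apply/eqP; rewrite -subr_eq0; apply/eqP/mxn_eq0.
  apply/ler_addgt0Pr => e e0; rewrite add0r.
  have [n [c cP]] := approx x e e0; apply: le_trans (cP s t rs rt) _.
  rewrite big1 ?addr0// => i _.
  have -> : s (a i) = t (a i).
    apply/matrixP => r q; apply: complex_ext.
      by have := H (pickle (i : nat, r, q, true)); rewrite !Etrue.
    by have := H (pickle (i : nat, r, q, false)); rewrite !Efalse.
  by rewrite subrr mxn0 mulr0.
Qed.

Lemma spanning_finite_dimensional (A : starAlgType R) :
  finite_dimensional A -> spanning A.
Proof.
move=> [n [e sp]].
exists (fun i => if insub i is Some j then e j else 0) => x eps M e0.
have [c ->] := sp x; exists n, c => m p _ rp.
rewrite [X in p X](_ : _ = 0) ?(rep0 rp) ?mxn0//.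
by rewrite -sumrB big1// => i _; rewrite valK subrr.
Qed.

Section Isomorphism.
Context {A B : starAlgType R} {f : A -> B} {g : B -> A}.
Hypotheses (fP : star_hom f) (fK : cancel f g) (gK : cancel g f).

Let gP : star_hom g.
Proof.
have [lf mf sf] := fP; split.
- by move=> c x y; rewrite -{1}(gK x) -{1}(gK y) -lf fK.
- by move=> x y; rewrite -{1}(gK x) -{1}(gK y) -mf fK.
- by move=> x; rewrite -{1}(gK x) -sf fK.
Qed.

Let f1 : f aone = aone.
Proof.
have [_ mf _] := fP.
by rewrite -[LHS]amul1r -[X in amul _ X](gK aone) -mf amul1l gK.
Qed.

Let g1 : g aone = aone. Proof. by rewrite -f1 fK. Qed.

Lemma rep_comp (A' B' : starAlgType R) (h : A' -> B') m (p : B' -> 'M[C]_m) :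
  star_hom h -> h aone = aone -> rep p -> rep (p \o h).
Proof.
move=> [lh mh sh] h1 rp; split.
- by move=> c x y /=; rewrite lh (repD rp) (repZ rp).
- by move=> x y /=; rewrite mh (repM rp).
- by move=> x /=; rewrite sh (repS rp).
- by rewrite /= h1 (rep1 rp).
Qed.

Lemma ane_isomorphic m : ane R (@reps R A m) -> ane R (@reps R B m).
Proof.
move=> aA; apply: (@ane_retractT _ _ _ _ _
  (fun p : {ptws B -> 'M[C]_m} => (p \o f : {ptws A -> 'M[C]_m}))
  (fun p : {ptws A -> 'M[C]_m} => (p \o g : {ptws B -> 'M[C]_m})) aA).
- apply/cts_on_ptws => a; exact: (cts_on_eval (a := f a)).
- by move=> p; exact: rep_comp fP f1.
- apply/cts_on_ptws => a; exact: (cts_on_eval (a := g a)).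
- by move=> p; exact: rep_comp gP g1.
- by move=> p _; apply/funext => x /=; rewrite gK.
Qed.

Lemma spanning_isomorphic : spanning A -> spanning B.
Proof.
move=> [a aP]; exists (f \o a) => x e M e0.
have [n [c cP]] := aP (g x) e M e0; exists n, c => m p mM rp.
have [lf _ _] := fP.
have := cP m (p \o f) mM (rep_comp fP f1 rp).
have rpf := rep_comp fP f1 rp.
rewrite (repB rpf) (rep_sum rpf) (repB rp) (rep_sum rp) /= gK.
by under eq_bigr do rewrite -/((p \o f) _) (repZ rpf) -(repZ rp).
Qed.

End Isomorphism.
End Spanning.

(** * Pull-backs *)

Section Ball.
Context {R : realType} {n : nat}.

Definition vrad (x : 'rV[R]_n) : R := Num.sqrt (\sum_i x 0 i ^+ 2).
Definition ball1 : set 'rV[R]_n := [set x | vrad x <= 1].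
Definition sphere1 : set 'rV[R]_n := [set x | vrad x = 1].

Lemma vrad_ge0 x : 0 <= vrad x. Proof. exact: sqrtr_ge0. Qed.

Lemma sumsq_ge0 (x : 'rV[R]_n) : 0 <= \sum_i x 0 i ^+ 2.
Proof. by apply: sumr_ge0 => i _; exact: sqr_ge0. Qed.

Lemma vrad_sqr (x : 'rV[R]_n) : vrad x ^+ 2 = \sum_i x 0 i ^+ 2.
Proof. by rewrite sqr_sqrtr// sumsq_ge0. Qed.

Lemma sphere_ball x : sphere1 x -> ball1 x.
Proof. by rewrite /sphere1 /ball1 /= => ->. Qed.

Lemma vradZ c (x : 'rV[R]_n) : vrad (c *: x) = `|c| * vrad x.
Proof.
rewrite /vrad; under eq_bigr do rewrite mxE exprMn.
by rewrite -mulr_sumr sqrtrM ?sqr_ge0// sqrtr_sqr.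
Qed.

Lemma vrad_coord (x : 'rV[R]_n) i : `|x 0 i| <= vrad x.
Proof.
rewrite -(ler_pXn2r (isT : (0 < 2)%N)) ?nnegrE ?vrad_ge0// vrad_sqr.
rewrite real_normK ?num_real// (bigD1 i)//= lerDl.
by apply: sumr_ge0 => j _; exact: sqr_ge0.
Qed.

Lemma vrad_cts : continuous vrad.
Proof.
move=> x; apply: (@continuous_comp _ _ _ (fun x : 'rV[R]_n => \sum_i x 0 i ^+ 2) Num.sqrt).
  pose S s (x : 'rV[R]_n) : R := \sum_(i <- s) x 0 i ^+ 2.
  suff : continuous (S (index_enum 'I_n)) by apply.
  elim: (index_enum _) => [|i s IH] {}x.
    rewrite (_ : S _ = fun=> 0); first exact: cst_continuous.
    by apply/funext => y; rewrite /S big_nil.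
  rewrite (_ : S _ = fun y => y 0 i * y 0 i + S s y); last first.
    by apply/funext => y; rewrite /S big_cons.
  have ci : (fun y : 'rV[R]_n => y 0 i) @ x --> x 0 i by exact: coord_continuous.
  exact: (cvgD (cvgM ci ci) (IH x)).
exact: sqrt_continuous.
Qed.

Lemma ball1_compact : compact ball1.
Proof.
apply: bounded_closed_compact.
  exists 1; split => // M M1 x /= x1; rewrite /= [leLHS](_ : _ = mx_norm x)// mx_normrE; apply: bigmax_le => [|[i j] _ /=].
    exact: le_trans ler01 (ltW M1).
  by rewrite ord1; apply: le_trans (vrad_coord x j) _; apply: le_trans x1 (ltW M1).
apply: (@closed_comp _ _ vrad [set r | r <= 1]); last exact: closed_le.
by move=> x _; exact: vrad_cts.
Qed.

Lemma vrad_convex (x y : 'rV[R]_n) c : 0 <= c <= 1 -> vrad x <= 1 -> vrad y <= 1 ->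
  vrad (x + c *: (y - x)) <= 1.
Proof.
move=> /andP[c0 c1] x1 y1.
have sq z : vrad z <= 1 -> \sum_i z 0 i ^+ 2 <= 1.
  by move=> z1; rewrite -vrad_sqr expr_le1// vrad_ge0.
rewrite -(ler_pXn2r (isT : (0 < 2)%N)) ?nnegrE ?vrad_ge0// vrad_sqr expr1n.
apply: (@le_trans _ _ ((1 - c) * (\sum_i x 0 i ^+ 2) + c * \sum_i y 0 i ^+ 2)).
  rewrite !mulr_sumr -big_split/=; apply: ler_sum => i _; rewrite !mxE.
  (* Convexity of the square: the two sides differ by c (1 - c) times the square of the
     difference. *)
  have := mulr_ge0 (mulr_ge0 c0 (_ : 0 <= 1 - c)) (sqr_ge0 (y 0 i - x 0 i)).
  by rewrite subr_ge0 => /(_ c1); nra.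
have := ler_wpM2l c0 (sq _ y1).
have := ler_wpM2l (_ : 0 <= 1 - c) (sq _ x1); rewrite subr_ge0 => /(_ c1).
lra.
Qed.

End Ball.

(** * Uniformity over the closed ball *)

Section Uniform.
Context {R : realType} {n : nat}.
Local Notation C := (Cplx R).

(** The tube lemma for the compact ball. *)
Lemma near_ball1 (Z : topologicalType) (K : set Z) (P : Z -> 'rV[R]_n -> Prop) (z0 : Z) :
  (forall x, ball1 x -> \forall z \near (z0, x), K z.1 -> ball1 z.2 -> P z.1 z.2) ->
  \forall z \near z0, K z -> forall x, ball1 x -> P z x.
Proof.
move=> H; have /compact_near_coveringP/near_covering_withinP := @ball1_compact R n.
move=> /(_ Z (nbhs z0) (fun z x => K z -> P z x) _).
have H' : forall x, ball1 x -> \forall x' \near x & i \near nbhs z0, ball1 x' -> K i -> P i x'.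
  move=> x /H [[U V] [/= Uz Vx] UV]; exists (V, U) => // -[x' z] [/= Vx' Uz'] bx' Kz.
  exact: (UV (z, x')).
by move=> /(_ H'); apply: filterS => z Hz Kz x bx; exact: (Hz x bx Kz).
Qed.

Lemma uniform_ball1 (Z : topologicalType) (K : set Z) k
    (G : Z * 'rV[R]_n -> 'M[C]_k) (z0 : Z) e :
  cts_on [set z | K z.1 /\ ball1 z.2] G -> K z0 -> 0 < e ->
  \forall z \near z0, K z -> forall x, ball1 x -> mxn (G (z, x) - G (z0, x)) < e.
Proof.
move=> /cts_on_mxnP cG Kz0 e0; apply: near_ball1 => x bx.
have e20 : 0 < e / 2 by rewrite divr_gt0.
have H1 := cG (z0, x) (conj Kz0 bx) _ e20.
have H2 : \forall z \near (z0, x), ball1 z.2 -> mxn (G (z0, z.2) - G (z0, x)) < e / 2.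
  have [[U V] [/= Uz Vx] UV] := H1.
  exists (setT, V); first by split => //; exact: filterT.
  move=> [z x'] [/= _ Vx'] bx'; apply: (UV (z0, x')); last by split.
  by split => //=; exact: nbhs_singleton.
apply: filterS2 H1 H2 => -[z x'] /= H1 H2 Kz bx'.
rewrite -[X in mxn X](subrKA (G (z0, x))) [ltRHS]splitr.
apply: le_lt_trans (mxnD _ _) _; apply: ltrD; first exact: H1.
by rewrite mxnB; exact: H2.
Qed.

End Uniform.

Section RealContinuity.
Context {R : realType} {X : topologicalType} {K : set X}.
Local Notation C := (Cplx R).
Implicit Types f g : X -> R.

Lemma cts_on_near f x : cts_on K f -> K x -> f @ within K (nbhs x) --> f x.
Proof. by move=> cf Kx V /(cf x Kx). Qed.

Lemma cts_on_of_near f :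
  (forall x, K x -> f @ within K (nbhs x) --> f x) -> cts_on K f.
Proof. by move=> H x Kx V fV; exact: H. Qed.

Lemma cts_on_rD f g : cts_on K f -> cts_on K g -> cts_on K (fun x => f x + g x).
Proof.
move=> cf cg; apply: cts_on_of_near => x Kx.
exact: (cvgD (cts_on_near cf Kx) (cts_on_near cg Kx)).
Qed.

Lemma cts_on_rN f : cts_on K f -> cts_on K (fun x => - f x).
Proof.
move=> cf; apply: cts_on_of_near => x Kx.
exact: (cvgN (cts_on_near cf Kx)).
Qed.

Lemma cts_on_rB f g : cts_on K f -> cts_on K g -> cts_on K (fun x => f x - g x).
Proof. by move=> cf cg; exact: (cts_on_rD cf (cts_on_rN cg)). Qed.

Lemma cts_on_rM f g : cts_on K f -> cts_on K g -> cts_on K (fun x => f x * g x).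
Proof.
move=> cf cg; apply: cts_on_of_near => x Kx.
exact: (cvgM (cts_on_near cf Kx) (cts_on_near cg Kx)).
Qed.

Lemma cts_on_rinv f : (forall x, K x -> f x != 0) -> cts_on K f ->
  cts_on K (fun x => (f x)^-1).
Proof.
move=> f0 cf; apply: cts_on_of_near => x Kx.
exact: (cvgV (f0 x Kx) (cts_on_near cf Kx)).
Qed.

Lemma cts_on_rmax f g : cts_on K f -> cts_on K g -> cts_on K (fun x => Num.max (f x) (g x)).
Proof.
move=> /cts_on_realP cf /cts_on_realP cg; apply/cts_on_realP => x Kx e e0.
apply: filterS2 (cf x Kx e e0) (cg x Kx e e0) => y Hf Hg Ky.
move: (Hf Ky) (Hg Ky); rewrite !ltr_norml.
by case: (leP (f x) (g x)) => ?; case: (leP (f y) (g y)) => ?; lra.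
Qed.

Lemma cts_on_rmin f g : cts_on K f -> cts_on K g -> cts_on K (fun x => Num.min (f x) (g x)).
Proof.
move=> /cts_on_realP cf /cts_on_realP cg; apply/cts_on_realP => x Kx e e0.
apply: filterS2 (cf x Kx e e0) (cg x Kx e e0) => y Hf Hg Ky.
move: (Hf Ky) (Hg Ky); rewrite !ltr_norml.
by case: (leP (f x) (g x)) => ?; case: (leP (f y) (g y)) => ?; lra.
Qed.

Lemma cts_on_toC f : cts_on K f -> cts_on K (fun x => toC (f x)).
Proof.
move=> /cts_on_realP cf; apply/cts_on_complexP => x Kx e e0.
by have := cf x Kx e e0; apply: filterS => y H Ky; rewrite -rmorphB cnorm_toC; exact: H.
Qed.

Lemma cts_on_rsum (I : Type) (s : seq I) (f : I -> X -> R) :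
  (forall i, cts_on K (f i)) -> cts_on K (fun x => \sum_(i <- s) f i x).
Proof.
move=> cf; elim: s => [|i s IH].
  have : cts_on K (fun _ : X => 0 : R) by exact: cts_on_cst.
  by apply: cts_on_ext => x _; rewrite big_nil.
by have := cts_on_rD (cf i) IH; apply: cts_on_ext => x _; rewrite big_cons.
Qed.

Lemma cts_on_cnorm (f : X -> C) : cts_on K f -> cts_on K (fun x => cnorm (f x)).
Proof.
move=> /cts_on_complexP cf; apply/cts_on_realP => x Kx e e0.
have := cf x Kx e e0; apply: filterS => y H Ky; apply: le_lt_trans (H Ky).
have h1 := cnormD (f y - f x) (f x); rewrite subrK in h1.
have h2 := cnormD (f x - f y) (f y); rewrite subrK cnormB in h2.
by rewrite ler_norml; lra.
Qed.

Lemma cts_on_scalar_mx m (f : X -> C) : cts_on K f -> cts_on K (fun x => (f x)%:M : 'M[C]_m).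
Proof.
move=> cf; have := cts_on_scalemx cf (@cts_on_cst _ _ _ (1%:M : 'M[C]_m)).
by apply: cts_on_ext => x _; rewrite scalemx1.
Qed.

End RealContinuity.

(** * Elements and representations of a pull-back *)

Section Attach.
Context {R : realType}.
Local Notation C := (Cplx R).

(* The pull-back of B and C(D^n, M_k) along Phi, seen from outside: an element
   a has a component p a in B and a matrix Q a x at every point x of the ball;
   values of Q and Phi elsewhere are irrelevant. *)
Record attached (A B : starAlgType R) (k n : nat) (p : A -> B)
    (Q : A -> 'rV[R]_n -> 'M[C]_k) (Phi : B -> 'rV[R]_n -> 'M[C]_k) : Prop :=
  Attached {
    att_p : star_hom p;
    att_p1 : p aone = aone;
    att_Q : forall x, ball1 x -> rep (fun a => Q a x);
    att_Qc : forall a, cts_on ball1 (Q a);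
    att_Phi : forall x, sphere1 x -> rep (fun b => Phi b x);
    att_QPhi : forall a x, sphere1 x -> Q a x = Phi (p a) x;
    att_inj : forall a a', p a = p a' ->
      (forall x, ball1 x -> Q a x = Q a' x) -> a = a';
    att_surj : forall (b : B) (F : 'rV[R]_n -> 'M[C]_k), cts_on ball1 F ->
      (forall x, sphere1 x -> F x = Phi b x) ->
      exists a, p a = b /\ forall x, ball1 x -> Q a x = F x;
    att_ext : forall b : B,
      cts_on ball1
        (fun x : 'rV[R]_n => toC (vrad x) *: Phi b ((vrad x)^-1 *: x) : 'M[C]_k) }.

Section Interface.
Context {A B : starAlgType R} {k n : nat} {p : A -> B}
  {Q : A -> 'rV[R]_n -> 'M[C]_k} {Phi : B -> 'rV[R]_n -> 'M[C]_k}.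
Hypothesis att : attached p Q Phi.
Local Notation D := (@ball1 R n).
Local Notation Sph := (@sphere1 R n).

Lemma att_pM x y : p (amul x y) = amul (p x) (p y). Proof. by case: (att_p att). Qed.
Lemma att_pS x : p (star x) = star (p x). Proof. by case: (att_p att). Qed.
Lemma att_pone : p aone = aone. Proof. exact: att_p1 att. Qed.
Lemma att_pD x y : p (x + y) = p x + p y.
Proof. by have [lp _ _] := att_p att; rewrite -[x]scale1r lp !scale1r. Qed.
Lemma att_pzero : p 0 = 0.
Proof. by apply: (addrI (p 0)); rewrite -att_pD !addr0. Qed.
Lemma att_pZ c x : p (c *: x) = c *: p x.
Proof. by have [lp _ _] := att_p att; rewrite -[c *: x]addr0 lp att_pzero addr0. Qed.
Lemma att_pB x y : p (x - y) = p x - p y.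
Proof. by rewrite att_pD -scaleN1r att_pZ scaleN1r. Qed.

Lemma att_QM x a b : D x -> Q (amul a b) x = Q a x *m Q b x.
Proof. by move=> /(att_Q att)/repM. Qed.
Lemma att_QS x a : D x -> Q (star a) x = ctr (Q a x).
Proof. by move=> /(att_Q att)/repS. Qed.
Lemma att_Qone x : D x -> Q aone x = 1%:M.
Proof. by move=> /(att_Q att)/rep1. Qed.
Lemma att_QD x a b : D x -> Q (a + b) x = Q a x + Q b x.
Proof. by move=> /(att_Q att)/repD. Qed.
Lemma att_QB x a b : D x -> Q (a - b) x = Q a x - Q b x.
Proof. by move=> /(att_Q att)/repB. Qed.
Lemma att_QZ x c a : D x -> Q (c *: a) x = c *: Q a x.
Proof. by move=> /(att_Q att)/repZ. Qed.

Definition mk (b : B) (F : 'rV[R]_n -> 'M[C]_k) : A :=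
  xget 0 [set a | p a = b /\ forall x, D x -> Q a x = F x].

Lemma mkP b F : cts_on D F -> (forall x, Sph x -> F x = Phi b x) ->
  p (mk b F) = b /\ forall x, D x -> Q (mk b F) x = F x.
Proof.
move=> cF FPhi; rewrite /mk; have [a aP] := att_surj att cF FPhi.
by case: xgetP => [a' _ //|/(_ a)].
Qed.

(** The central element that is the scalar [be] in B and the scalar function [w] on the ball; the
    two components match when [w] equals [be] on the sphere. *)
Definition smk (w : 'rV[R]_n -> R) (be : R) : A :=
  mk (toC be *: aone) (fun x => (toC (w x))%:M).

Lemma smkP w be : cts_on D w -> (forall x, Sph x -> w x = be) ->
  p (smk w be) = toC be *: aone /\ forall x, D x -> Q (smk w be) x = (toC (w x))%:M.
Proof.
move=> cw wS; apply: mkP; first exact: (cts_on_scalar_mx (cts_on_toC cw)).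
move=> x Sx; have rP := att_Phi att Sx.
by rewrite (repZ rP) (rep1 rP) scalemx1 wS.
Qed.

Definition scalarfun (w : 'rV[R]_n -> R) (be : R) :=
  cts_on D w /\ forall x, Sph x -> w x = be.

Lemma smk_mul w be a : scalarfun w be ->
  p (amul (smk w be) a) = toC be *: p a /\
  forall x, D x -> Q (amul (smk w be) a) x = toC (w x) *: Q a x.
Proof.
move=> [cw wS]; have [pw Qw] := smkP cw wS; split.
  by rewrite att_pM pw amulZl amul1l.
by move=> x Dx; rewrite att_QM// Qw// mul_scalar_mx.
Qed.

Lemma smk_central w be a : scalarfun w be -> amul (smk w be) a = amul a (smk w be).
Proof.
move=> [cw wS]; have [pw Qw] := smkP cw wS; apply: (att_inj att).
  by rewrite !att_pM pw amulZl amulZr amul1l amul1r.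
by move=> x Dx; rewrite !att_QM// Qw// mul_scalar_mx mul_mx_scalar.
Qed.

Lemma smk_star w be : scalarfun w be -> star (smk w be) = smk w be.
Proof.
move=> [cw wS]; have [pw Qw] := smkP cw wS; apply: (att_inj att).
  by rewrite att_pS pw starZ star1 toC_conj.
by move=> x Dx; rewrite att_QS// Qw// ctr_scalar toC_conj.
Qed.

Lemma scalarfun_vrad : scalarfun (@vrad R n) 1.
Proof. by split => //; apply: cts_on_cts; exact: vrad_cts. Qed.

Lemma scalarfun_cst c : scalarfun (fun=> c) c.
Proof. by split => //; exact: cts_on_cst. Qed.

Lemma scalarfunB w be w' be' : scalarfun w be -> scalarfun w' be' ->
  scalarfun (fun x => w x - w' x) (be - be').
Proof.
move=> [cw wS] [cw' wS']; split; first exact: cts_on_rB.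
by move=> x Sx; rewrite wS// wS'.
Qed.

Lemma smkB w be w' be' : scalarfun w be -> scalarfun w' be' ->
  smk (fun x => w x - w' x) (be - be') = smk w be - smk w' be'.
Proof.
move=> sw sw'; have sB := scalarfunB sw sw'.
have [pw Qw] := smkP sw.1 sw.2; have [pw' Qw'] := smkP sw'.1 sw'.2.
have [att_pB' att_QB'] := smkP sB.1 sB.2; apply: (att_inj att).
  by rewrite att_pB' att_pB pw pw' rmorphB scalerBl.
by move=> x Dx; rewrite att_QB'// att_QB// Qw// Qw'// rmorphB raddfB.
Qed.

Lemma smk_cst c : smk (fun=> c) c = toC c *: aone.
Proof.
have sc := scalarfun_cst c; have [pw Qw] := smkP sc.1 sc.2; apply: (att_inj att).
  by rewrite pw att_pZ att_pone.
by move=> x Dx; rewrite Qw// att_QZ// att_Qone// scalemx1.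
Qed.

Definition hgt : A := smk (@vrad R n) 1.

Section Killing.
Context {m : nat} {rho : A -> 'M[C]_m}.
Hypothesis rhoP : rep rho.

(** The pair [u], [ga] inverts [w], [be] wherever [a] is nonzero, on the ball and in B, so [a] is a
    multiple of the element that [v] annihilates. *)
Lemma rep_kill (v : 'rV[C]_m) w be u ga a : scalarfun w be -> scalarfun u ga ->
  v *m rho (smk w be) = 0 -> (be * ga = 1 \/ p a = 0) ->
  (forall x, D x -> w x * u x = 1 \/ Q a x = 0) -> v *m rho a = 0.
Proof.
move=> sw su vw bg wu.
have -> : a = amul (smk w be) (amul (smk u ga) a).
  have [p2 Q2] := smk_mul a su; have [p3 Q3] := smk_mul (amul (smk u ga) a) sw.
  apply: (att_inj att).
    rewrite p3 p2 scalerA -rmorphM; case: bg => ->; first by rewrite rmorph1 scale1r.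
    by rewrite scaler0.
  move=> x Dx; rewrite Q3// Q2// scalerA -rmorphM; case: (wu x Dx) => ->.
    by rewrite rmorph1 scale1r.
  by rewrite scaler0.
by rewrite (repM rhoP) mulmxA vw mul0mx.
Qed.

Let eig_smk (v : 'rV[C]_m) eta : v *m rho hgt = toC eta *: v ->
  v *m rho (smk (fun x => vrad x - eta) (1 - eta)) = 0.
Proof.
move=> vh; rewrite (smkB scalarfun_vrad (scalarfun_cst eta)) (repB rhoP) mulmxBr vh.
by rewrite smk_cst (repZ rhoP) (rep1 rhoP) scalemx1 mul_mx_scalar subrr.
Qed.

(** For [eta] outside [0, 1] the function [vrad - eta] is invertible, and the eigenvector would be
    annihilated by the unit. *)
Lemma rep_hgt_range (v : 'rV[C]_m) eta : v *m rho hgt = toC eta *: v -> v != 0 ->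
  0 <= eta <= 1.
Proof.
move=> vh v0; apply: contraNT v0 => eta01.
have ne x : D x -> vrad x - eta != 0.
  move=> Dx; apply: contraNneq eta01 => /eqP; rewrite subr_eq0 => /eqP <-.
  by rewrite vrad_ge0.
have s1 : scalarfun (fun x => vrad x - eta) (1 - eta).
  exact: (scalarfunB scalarfun_vrad (scalarfun_cst eta)).
have s2 : scalarfun (fun x => (vrad x - eta)^-1) (1 - eta)^-1.
  split; last by move=> x; rewrite /sphere1/= => ->.
  by apply: cts_on_rinv => //; case: s1.
have e1 : 1 - eta != 0.
  apply: contraNneq eta01 => /eqP; rewrite subr_eq0 => /eqP <-.
  by rewrite lexx ler01.
apply/eqP; rewrite -[v]mulmx1 -(rep1 rhoP).
apply: (rep_kill s1 s2 (eig_smk vh)); first by left; rewrite mulfV.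
by move=> x Dx; left; rewrite mulfV// ne.
Qed.

(** Such an eigenvector sees only the radius [eta]. Replacing [vrad] by its maximum with [t] makes
    [vrad - eta] invertible everywhere and changes nothing where [a] may be nonzero. *)
Lemma rep_kill_ge (v : 'rV[C]_m) eta t a : v *m rho hgt = toC eta *: v ->
  eta < t -> t <= 1 -> (forall x, D x -> vrad x <= t -> Q a x = 0) -> v *m rho a = 0.
Proof.
move=> vh et t1 Qa.
have s1 := scalarfunB scalarfun_vrad (scalarfun_cst eta).
have s2 : scalarfun (fun x => (Num.max (vrad x) t - eta)^-1) (1 - eta)^-1.
  split; last by move=> x; rewrite /sphere1/= => ->; rewrite max_l.
  apply: cts_on_rinv => [x Dx|].
    by rewrite gt_eqF// subr_gt0 lt_max et orbT.
  apply: cts_on_rB; last exact: cts_on_cst.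
  by apply: cts_on_rmax; [case: scalarfun_vrad|exact: cts_on_cst].
apply: (rep_kill s1 s2 (eig_smk vh)).
  by left; rewrite mulfV// gt_eqF// subr_gt0; lra.
move=> x Dx; have [xt|tx] := leP (vrad x) t; first by right; exact: Qa.
by left; rewrite mulfV// gt_eqF// subr_gt0; lra.
Qed.

(** Now [vrad] is replaced by its minimum with [t]. This may alter the value 1 on the sphere, and
    [p a = 0] takes care of the component in B. *)
Lemma rep_kill_le (v : 'rV[C]_m) eta t a : v *m rho hgt = toC eta *: v ->
  t < eta -> p a = 0 -> (forall x, D x -> t <= vrad x -> Q a x = 0) -> v *m rho a = 0.
Proof.
move=> vh et pa Qa.
have s1 := scalarfunB scalarfun_vrad (scalarfun_cst eta).
have s2 : scalarfun (fun x => (Num.min (vrad x) t - eta)^-1) (Num.min 1 t - eta)^-1.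
  split; last by move=> x; rewrite /sphere1/= => ->.
  apply: cts_on_rinv => [x Dx|].
    by rewrite lt_eqF// subr_lt0 gt_min et orbT.
  apply: cts_on_rB; last exact: cts_on_cst.
  by apply: cts_on_rmin; [case: scalarfun_vrad|exact: cts_on_cst].
apply: (rep_kill s1 s2 (eig_smk vh)); first by right.
move=> x Dx; have [tx|xt] := leP t (vrad x); first by right; exact: Qa.
by left; rewrite mulfV// lt_eqF// subr_lt0; lra.
Qed.

End Killing.

(** One factor counts the k * k matrix units, one the m * m entries; the last majorizes the square
    root of [fcalc_bound m]. *)
Definition jbound m : R := (k * k)%:R * ((m * m)%:R * (@fcalc_bound R m + 1)).

Lemma fcalc_bound_ge0 m : 0 <= @fcalc_bound R m.
Proof. by rewrite /fcalc_bound !mulr_ge0. Qed.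

Lemma jbound_ge0 m : 0 <= jbound m.
Proof. by rewrite /jbound !mulr_ge0// addr_ge0// fcalc_bound_ge0. Qed.

(* An eigenvalue of [rho (star j j)] above the supremum of [Q (star j j)] would
   make its eigenvector vanish under an invertible scalar function; the matrix
   units reduce to this scalar case. *)
Lemma rep_ideal_bound m (rho : A -> 'M[C]_m) j e : rep rho -> p j = 0 -> 0 <= e ->
  (forall x, D x -> forall s t, cnorm (Q j x s t) <= e) -> mxn (rho j) <= jbound m * e.
Proof.
move=> rhoP pj e0 je.
have jS x : Sph x -> Q j x = 0.
  by move=> Sx; rewrite (att_QPhi att)// pj (rep0 (att_Phi att Sx)).
(* The components of [j] along matrix units; they belong to A because [j] vanishes on the sphere. *)
pose jst s t := mk 0 (fun x => Q j x s t *: delta_mx s t).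
have jstP s t : p (jst s t) = 0 /\ forall x, D x -> Q (jst s t) x = Q j x s t *: delta_mx s t.
  apply: mkP.
    apply: cts_on_scalemx; last exact: cts_on_cst.
    exact: (cts_on_mx_coord (i := s) (j := t) (att_Qc att (a := j))).
  by move=> x Sx; rewrite jS// mxE scale0r (rep0 (att_Phi att Sx)).
have jsum : j = \sum_s \sum_t jst s t.
  apply: (att_inj att).
    have ps (I : Type) (r : seq I) (F : I -> A) : (forall i, p (F i) = 0) -> p (\sum_(i <- r) F i) = 0.
      move=> F0; elim: r => [|i r IH]; first by rewrite big_nil att_pzero.
      by rewrite big_cons att_pD F0 IH addr0.
    by rewrite pj ps// => s; rewrite ps// => t; case: (jstP s t).
  move=> x Dx; rewrite (rep_sum (att_Q att Dx)) [LHS]matrix_sum_delta.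
  apply: eq_bigr => s _; rewrite (rep_sum (att_Q att Dx)).
  by apply: eq_bigr => t _; have [_ ->] := jstP s t.
have jst_le s t : mxn (rho (jst s t)) <= (m * m)%:R * ((fcalc_bound m + 1) * e).
  have [pst Qst] := jstP s t.
  pose y := amul (star (jst s t)) (jst s t).
  pose f2 x := cnorm (Q j x s t) ^+ 2.
  have sf2 : scalarfun f2 0.
    split; last by move=> x Sx; rewrite /f2 jS// mxE cnorm0 expr0n.
    have c1 := cts_on_cnorm (cts_on_mx_coord (i := s) (j := t) (att_Qc att (a := j))).
    exact: (cts_on_rM c1 c1).
  have yE : rho y = ctr (rho (jst s t)) *m rho (jst s t) by rewrite (repM rhoP) (repS rhoP).
  (* On the ball, [y] is the scalar function [f2] times a projection. So an eigenvector of [rho y]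
     for an eigenvalue [d > 0] is also one of the image of [f2], for the same [d]. *)
  have yy : amul y y = amul y (smk f2 0).
    rewrite -(smk_central y sf2); have [pfy Qfy] := smk_mul y sf2.
    apply: (att_inj att); first by rewrite pfy !att_pM pst !amulr0 scaler0.
    move=> x Dx; rewrite Qfy// !att_QM// att_QS// Qst//.
    set z := Q j x s t; set E := delta_mx s t.
    have E1 : E *m ctr E *m E = E.
      rewrite /ctr map_delta_mx trmx_delta mul_delta_mx_cond eqxx mulr1n.
      by rewrite mul_delta_mx_cond eqxx mulr1n.
    have gen (X Y : 'M[C]_k) : X *m Y *m X = X -> Y *m X *m (Y *m X) = Y *m X.
      by move=> XYX; rewrite -mulmxA (mulmxA X) XYX.
    have -> : ctr (z *: E) *m (z *: E) = toC (f2 x) *: (ctr E *m E).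
      by rewrite ctrZ -scalemxAl -scalemxAr scalerA cnorm_conjM.
    by rewrite -scalemxAl -scalemxAr (gen _ _ E1).
  have eig i : eigval (rho y) i <= e ^+ 2.
    rewrite leNgt; apply/negP => de.
    set d := eigval (rho y) i in de.
    have yh : ctr (rho y) = rho y by rewrite yE ctr_gram.
    set v := row i (eigbasis (rho y)).
    have vy : v *m rho y = toC d *: v by exact: row_eigbasis.
    have d0 : 0 < d by apply: le_lt_trans de; exact: sqr_ge0.
    have vs : v *m rho (smk f2 0) = toC d *: v.
      have dd : toC d != 0 by rewrite -(rmorph0 toC) (inj_eq toC_inj) gt_eqF.
      apply: (scalerI dd); rewrite scalemxAl -vy -mulmxA -(repM rhoP) -yy (repM rhoP) mulmxA.
      by rewrite vy -scalemxAl vy.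
    have s1 := scalarfunB sf2 (scalarfun_cst d).
    have f2d x : D x -> f2 x - d < 0.
      move=> Dx; rewrite subr_lt0; apply: le_lt_trans de.
      by rewrite /f2 ler_pXn2r ?nnegrE ?cnorm_ge0// je.
    have s2 : scalarfun (fun x => (f2 x - d)^-1) (0 - d)^-1.
      split; last by move=> x Sx; have [_ ->] := sf2.
      by apply: cts_on_rinv; [move=> x Dx; rewrite lt_eqF// f2d|case: s1].
    have v0 : v *m rho (smk (fun x => f2 x - d) (0 - d)) = 0.
      rewrite (smkB sf2 (scalarfun_cst d)) (repB rhoP) mulmxBr vs.
      by rewrite smk_cst (repZ rhoP) (rep1 rhoP) scalemx1 mul_mx_scalar subrr.
    have : v *m rho aone = 0.
      apply: (rep_kill rhoP s1 s2 v0); first by left; rewrite mulfV// sub0r oppr_eq0 gt_eqF.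
      by move=> x Dx; left; rewrite mulfV// lt_eqF// f2d.
    by rewrite (rep1 rhoP) mulmx1; apply/eqP; exact: row_eigbasis_neq0.
  have yle : mxn (rho y) <= fcalc_bound m * e ^+ 2.
    have yh : ctr (rho y) = rho y by rewrite yE ctr_gram.
    rewrite -(fcalc_id yh); apply: fcalc_le; first exact: sqr_ge0.
    by move=> i; rewrite ger0_norm ?eig// yE; exact: eigval_gram_ge0.
  have B0 := fcalc_bound_ge0 m.
  apply: mxn_le => a b; set z := rho (jst s t) a b.
  have Be : 0 <= (fcalc_bound m + 1) * e by rewrite mulr_ge0// addr_ge0.
  rewrite -(ler_pXn2r (isT : (0 < 2)%N)) ?nnegrE ?cnorm_ge0//.
  apply: (@le_trans _ _ (fcalc_bound m * e ^+ 2)); last first.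
    by rewrite exprMn ler_wpM2r ?sqr_ge0//; nra.
  apply: le_trans yle; apply: le_trans (mxn_coord _ b b).
  rewrite yE -{2}(ctrK (rho (jst s t))) ctr_mul_diag cnorm_toC ger0_norm; last first.
    by apply: sumr_ge0 => *; exact: sqr_ge0.
  rewrite (bigD1 a)//= !mxE cnorm_conj lerDl.
  by apply: sumr_ge0 => *; exact: sqr_ge0.
rewrite jsum (rep_sum rhoP) /jbound -mulrA; apply: le_trans (mxn_sum _ _ _) _.
apply: (@le_trans _ _ (\sum_(s < k) \sum_(t < k) ((m * m)%:R * ((fcalc_bound m + 1) * e)))).
  apply: ler_sum => s _; rewrite (rep_sum rhoP); apply: le_trans (mxn_sum _ _ _) _.
  exact: ler_sum.
by rewrite !sumr_const !card_ord -mulrnA -[leLHS]mulr_natl !mulrA lexx.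
Qed.

End Interface.
End Attach.

(** * Scalar and non-scalar Hermitian matrices *)

Section Scalar.
Context {R : realType}.
Local Notation C := (Cplx R).

Lemma trace_eigval m (H : 'M[C]_m) : ctr H = H -> \tr H = toC (\sum_i eigval H i).
Proof.
move=> hH; rewrite -{1}(fcalc_id hH) fcalcE mxtrace_mulC mulmxA.
have [-> _] := eigbasis_unitary H.
by rewrite mul1mx mxtrace_diag rmorph_sum; apply: eq_bigr => i _; rewrite mxE.
Qed.

(** The normalized trace recovers the value of a scalar matrix and is continuous on all matrices. *)
Definition mean m (M : 'M[C]_m) : R := cRe (\tr M) / m%:R.

Lemma mean_scalar m c : (0 < m)%N -> mean ((toC c)%:M : 'M[C]_m) = c.
Proof.
move=> m0; rewrite /mean mxtrace_scalar -(rmorphMn toC) toCK -mulr_natr mulfK//.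
by rewrite pnatr_eq0 -lt0n.
Qed.

Lemma eigval_scalar m c i : eigval ((toC c)%:M : 'M[C]_m) i = c.
Proof.
set H := (toC c)%:M; have hH : ctr H = H by rewrite ctr_scalar toC_conj.
have := row_eigbasis i hH; rewrite mul_mx_scalar => /eqP.
rewrite -subr_eq0 -scalerBl scaler_eq0 (negbTE (row_eigbasis_neq0 H i)) orbF.
by rewrite subr_eq0 => /eqP/toC_inj.
Qed.

Lemma scalar_of_eigval m (H : 'M[C]_m) c : ctr H = H ->
  (forall i, eigval H i = c) -> H = (toC c)%:M.
Proof. by move=> hH Hc; rewrite -{1}(fcalc_id hH) (fcalc_ext (g := fun=> c))// fcalc_cst. Qed.

Lemma scalar_or_split m (H : 'M[C]_m) : (0 < m)%N -> ctr H = H ->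
  H = (toC (mean H))%:M \/ exists i j, eigval H i < eigval H j.
Proof.
move=> m0 hH; pose i0 := Ordinal m0.
case: (pselect (exists i, eigval H i != eigval H i0)) => [ [i ne] | no].
  by move: ne; rewrite neq_lt => /orP[] lt; right; [exists i, i0|exists i0, i].
left; have E : H = (toC (eigval H i0))%:M.
  by apply: scalar_of_eigval => // i; apply: contrapT => /eqP ne; apply: no; exists i.
by rewrite {2}E mean_scalar.
Qed.

Lemma mean_lt m (H : 'M[C]_m) t : (0 < m)%N -> ctr H = H ->
  (forall i, eigval H i < t) -> mean H < t.
Proof.
move=> m0 hH Ht; rewrite /mean (trace_eigval hH) toCK ltr_pdivrMr ?ltr0n//.
rewrite mulr_natr -[in ltRHS](card_ord m) -sumr_const (bigD1 (Ordinal m0))//=.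
rewrite [ltRHS](bigD1 (Ordinal m0))//=; apply: ltr_leD => //.
by apply: ler_sum => i _; exact: ltW.
Qed.

Lemma cts_on_mean (X : topologicalType) (K : set X) m (f : X -> 'M[C]_m) :
  cts_on K f -> cts_on K (fun x => mean (f x)).
Proof.
move=> cf; apply: cts_on_rM; last exact: cts_on_cst.
by apply: cts_on_cRe; apply: cts_on_csum => i; exact: cts_on_mx_coord.
Qed.

Lemma cts_on_mxn (X : topologicalType) (K : set X) m n (f : X -> 'M[C]_(m, n)) :
  cts_on K f -> cts_on K (fun x => mxn (f x)).
Proof.
move=> cf; apply: cts_on_rsum => i; apply: cts_on_rsum => j.
exact: (cts_on_cnorm (cts_on_mx_coord (i := i) (j := j) cf)).
Qed.

(** This turns openness relative to [S] into an ambient open set, the form in which the extension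
    lemmas take it. *)
Lemma relatively_open (T : topologicalType) (S P : set T) :
  (forall s, S s -> P s -> \forall t \near s, S t -> P t) ->
  exists U, open U /\ S `&` U = S `&` P.
Proof.
move=> H; exists (interior [set t | S t -> P t]); split; first exact: open_interior.
apply/seteqP; split => s [Ss].
  by move=> /interior_subset/(_ Ss).
by move=> Ps; split => //; exact: H.
Qed.

Lemma reps_eigval_near (A : starAlgType R) m (p : {ptws A -> 'M[C]_m}) h (O : set R) :
  rep p -> star h = h -> (forall i, nbhs (eigval (p h) i) O) ->
  \forall q \near p, reps q -> forall i, O (eigval ((q : A -> 'M[C]_m) h) i).
Proof.
move=> rp hh no; have hp (q : A -> 'M[C]_m) : rep q -> ctr (q h) = q h.
  by move=> rq; rewrite -(repS rq) hh.
have := eigval_near (hp p rp) no.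
move=> /(@cts_on_eval R A m setT h p I); apply: filterS => q H rq i.
by apply: H => //; exact: hp.
Qed.

Lemma reps_empty_dim (A : starAlgType R) : ane R (@reps R A 0).
Proof.
have E (M N : 'M[C]_0) : M = N by rewrite (flatmx0 M) (flatmx0 N).
move=> X d dX K f cK cf fS; exists setT, (fun _ _ => 0); split => //.
- exact: openT.
- exact: cts_on_cst.
- by move=> x _; apply/funext => a; exact: E.
- by move=> x _; split=> [c y z|y z|y|]; exact: E.
Qed.

End Scalar.

(** * Representations of a matrix algebra *)

Section MatrixAlgebra.
Context {R : realType}.
Local Notation C := (Cplx R).

Definition mxalg k : Type := 'M[C]_k.

HB.instance Definition _ k := GRing.Lmodule.copy (mxalg k) 'M[C]_k.
HB.instance Definition _ k := isStarAlgebra.Build R (mxalg k)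
  (@mulmxA C k k k k) (@mul1mx C k k) (@mulmx1 C k k) (@mulmxDl C k k k)
  (@mulmxDr C k k k) (fun c x y => esym (@scalemxAl C k k k c x y))
  (fun c x y => esym (@scalemxAr C k k k c x y))
  (@ctrD R k k) (@ctrZ R k k) (@ctrM R k k k) (@ctrK R k k).

(** The Casimir element is the sum over [i] of [delta_mx i o] tensor [delta_mx o i], for a fixed
    index [o]. *)
Lemma ane_mxalg k m : (0 < k)%N -> ane R (@reps R (mxalg k) m).
Proof.
move=> k0; pose o := Ordinal k0.
apply: (@ane_casimir R (mxalg k) k (fun i => delta_mx i o : mxalg k) (fun i => delta_mx o i : mxalg k)).
  apply: etrans (_ : \sum_i delta_mx i i = 1%:M :> 'M[C]_k).
    by apply: eq_bigr => i _; exact: mul_delta_mx.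
  apply/matrixP => i j; rewrite summxE !mxE (bigD1 i)//= !mxE eqxx/= big1 ?addr0 1?eq_sym// => l li.
  by rewrite !mxE eq_sym (negbTE li).
move=> {}m p q rp rq x.
have L i : amul (x : mxalg k) (delta_mx i o : mxalg k) = \sum_j (x : 'M[C]_k) j i *: (delta_mx j o : mxalg k).
  apply/matrixP => a b; rewrite [LHS]mxE summxE (bigD1 i)//= big1 ?addr0; last first.
    by move=> l li; rewrite mxE (negbTE li) mulr0.
  rewrite (bigD1 a)//= big1 ?addr0; first by rewrite !mxE !eqxx.
  by move=> l la; rewrite !mxE eq_sym (negbTE la) mulr0.
have L' i : amul (delta_mx o i : mxalg k) (x : mxalg k) = \sum_j (x : 'M[C]_k) i j *: (delta_mx o j : mxalg k).
  apply/matrixP => a b; rewrite [LHS]mxE summxE (bigD1 i)//= big1 ?addr0; last first.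
    by move=> l li; rewrite mxE (negbTE li) andbF mul0r.
  rewrite (bigD1 b)//= big1 ?addr0; first by rewrite !mxE !eqxx !andbT mulrC.
  by move=> l la; rewrite !mxE [b == l]eq_sym (negbTE la) andbF mulr0.
under eq_bigr do rewrite L (rep_sum rp) mulmx_suml.
under [RHS]eq_bigr do rewrite L' (rep_sum rq) mulmx_sumr.
rewrite exchange_big/=; apply: eq_bigr => i _; apply: eq_bigr => j _.
by rewrite (repZ rp) (repZ rq) -scalemxAl -scalemxAr.
Qed.

End MatrixAlgebra.

(** * Deforming representations by maps of the ball *)

Section Deformation.
Context {R : realType}.
Local Notation C := (Cplx R).
Context {A B : starAlgType R} {k n : nat} {p : A -> B}
  {Q : A -> 'rV[R]_n -> 'M[C]_k} {Phi : B -> 'rV[R]_n -> 'M[C]_k}.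
Hypothesis att : attached p Q Phi.
Local Notation D := (@ball1 R n).
Local Notation Sph := (@sphere1 R n).
Local Notation mk := (@mk R A B k n p Q).
Local Notation smk := (@smk R A B k n p Q).
Local Notation jbound := (@jbound R k).

Lemma cts_on_prod2 (Z U T : topologicalType) (K : set U) (f : U -> T) :
  cts_on K f -> cts_on [set z : Z * U | K z.2] (fun z => f z.2).
Proof.
move=> cf; apply: (@cts_on_comp _ _ _ _ K snd f) => //.
by apply: (cts_on_snd (f := id)) => z _ V; apply: filterS.
Qed.

Lemma cts_on_prod1 (Z U T : topologicalType) (K : set Z) (f : Z -> T) :
  cts_on K f -> cts_on [set z : Z * U | K z.1] (fun z => f z.1).
Proof.
move=> cf; apply: (@cts_on_comp _ _ _ _ K fst f) => //.
by apply: (cts_on_fst (f := id)) => z _ V; apply: filterS.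
Qed.

(* [j] is cut by [w^2 / (w^2 + d)], which [rho] kills, leaving a remainder that
   is uniformly small by compactness of the ball. *)
Lemma rep_kill_zero m (rho : A -> 'M[C]_m) w be j : rep rho -> scalarfun w be ->
  rho (smk w be) = 0 -> p j = 0 -> (forall x, D x -> w x = 0 -> Q j x = 0) ->
  rho j = 0.
Proof.
move=> rr sw w0 pj Qj; have [cw wS] := sw.
have dn d (r : R) : 0 < d -> 0 < r ^+ 2 + d by move=> d0; rewrite ltr_wpDl// sqr_ge0.
have key e : 0 < e -> exists2 d : R, 0 < d &
    forall x, D x -> mxn (toC (d / (w x ^+ 2 + d)) *: Q j x) < e.
  move=> e0.
  have : \forall d \near (0 : R), [set d | 0 < d] d -> forall x, D x ->
      mxn (toC (d / (w x ^+ 2 + d)) *: Q j x) < e.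
    apply: near_ball1 => x Dx; have [wx|wx] := eqVneq (w x) 0.
      have := cts_on_prod2 (Z := R) (att_Qc att (a := j)).
      move=> /cts_on_mxnP/(_ (0, x) Dx e e0); apply: filterS => -[d y] /= H d0 Dy.
      rewrite mxnZ cnorm_toC; apply: le_lt_trans (H Dy); rewrite (Qj x Dx wx) subr0.
      rewrite -[leRHS]mul1r ler_wpM2r ?mxn_ge0// ger0_norm; last first.
        by rewrite divr_ge0// ltW// dn.
      by rewrite ler_pdivrMr ?dn// mul1r lerDr sqr_ge0.
    pose K := [set z : R * 'rV[R]_n | 0 <= z.1 /\ D z.2 /\ w z.2 != 0].
    have KD : K `<=` [set z | D z.2] by move=> z [_ []].
    have cwz : cts_on K (fun z => w z.2) := cts_on_sub KD (cts_on_prod2 cw).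
    have cz : cts_on K (fun z => z.1).
      by apply: (cts_on_fst (f := id)) => z _ V; apply: filterS.
    have w2 z : K z -> w z.2 * w z.2 + z.1 != 0.
      move=> [z0 [_ wz]]; rewrite gt_eqF// ltr_pwDl// -expr2 lt_def sqr_ge0 andbT.
      by rewrite expf_eq0.
    have cQ := cts_on_sub KD (cts_on_prod2 (Z := R) (att_Qc att (a := j))).
    have cG := cts_on_scalemx (cts_on_toC
      (cts_on_rM cz (cts_on_rinv w2 (cts_on_rD (cts_on_rM cwz cwz) cz)))) cQ.
    move: cG => /cts_on_mxnP/(_ (0, x) (conj (lexx 0) (conj Dx wx)) e e0).
    apply: filterS => -[d y] /= H d0 Dy; have [wy|wy] := eqVneq (w y) 0.
      by rewrite (Qj y Dy wy) scaler0 mxn0.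
    by have := H (conj (ltW d0) (conj Dy wy)); rewrite mul0r rmorph0 scale0r subr0 -expr2.
  move=> /nbhs_ballP[r /= r0 /(_ (r / 2))] H; exists (r / 2); first exact: divr_gt0.
  apply: H => /=; last exact: divr_gt0.
  rewrite /ball/= sub0r normrN ger0_norm; last by rewrite divr_ge0// ltW.
  by rewrite ltr_pdivrMr// mulr_natr mulr2n ltrDl.
apply: mxn_eq0; apply/ler_addgt0Pr => e e0; rewrite add0r.
have J0 := @jbound_ge0 R k m.
have [d d0 Hd] := key (e / (jbound m + 1)) (divr_gt0 e0 (ltr_wpDl J0 ltr01)).
(* A regularized inverse of [w]: multiplying by [w * u] leaves the remainder d / (w^2 + d). *)
pose u x := w x / (w x ^+ 2 + d); pose ga := be / (be ^+ 2 + d).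
have su : scalarfun u ga.
  split; last by move=> x Sx; rewrite /u wS.
  apply: cts_on_rM => //; apply: cts_on_rinv; first by move=> x _; rewrite gt_eqF// dn.
  by apply: cts_on_rD; [exact: (cts_on_rM cw cw)|exact: cts_on_cst].
pose j1 := amul (smk w be) (amul (smk u ga) j).
have [p2 Q2] := smk_mul att j su; have [p3 Q3] := smk_mul att (amul (smk u ga) j) sw.
have -> : rho j = rho (j - j1).
  by rewrite (repB rr) /j1 (repM rr) w0 mul0mx subr0.
apply: (@le_trans _ _ (jbound m * (e / (jbound m + 1)))).
  apply: (rep_ideal_bound att rr); first by rewrite (att_pB att) p3 p2 pj !scaler0 subr0.
    by rewrite divr_ge0// ?ltW// ltr_wpDl.
  move=> x Dx s t; apply: le_trans (mxn_coord _ s t) _; apply: le_trans (ltW (Hd x Dx)).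
  rewrite (att_QB att)// Q3// Q2// scalerA -rmorphM -[X in X - _]scale1r -(rmorph1 toC) -scalerBl -rmorphB.
  rewrite le_eqVlt; apply/orP; left; apply/eqP; congr (mxn (toC _ *: _)).
  by rewrite /u; field; rewrite gt_eqF// dn.
rewrite mulrA ler_pdivrMr ?ltr_wpDl// mulrC ler_wpM2l//; first exact: ltW.
by rewrite lerDl.
Qed.

(** Fixing the sphere keeps [x |-> Q a (g x)] compatible with [p a], so that composition with [g] is
    an endomorphism of A. *)
Definition ballmap (g : 'rV[R]_n -> 'rV[R]_n) :=
  [/\ cts_on D g, forall x, D x -> D (g x) & forall x, Sph x -> g x = x].

Definition pull (g : 'rV[R]_n -> 'rV[R]_n) (a : A) : A := mk (p a) (fun x => Q a (g x)).

Lemma pullP g a : ballmap g -> p (pull g a) = p a /\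
  forall x, D x -> Q (pull g a) x = Q a (g x).
Proof.
move=> [cg gD gS]; apply: (mkP att).
  exact: (cts_on_comp gD cg (att_Qc att (a := a))).
by move=> x Sx; rewrite gS// (att_QPhi att).
Qed.

Lemma pull_star_hom g : ballmap g -> star_hom (pull g).
Proof.
move=> gP; have [_ gD _] := gP; split.
- move=> c a a'; have [p1 Q1] := pullP a gP; have [p2 Q2] := pullP a' gP.
  have [p3 Q3] := pullP (c *: a + a') gP; apply: (att_inj att).
    by rewrite p3 !(att_pD att) !(att_pZ att) p1 p2.
  move=> x Dx; have Dg := gD x Dx.
  by rewrite Q3// !(att_QD att)// !(att_QZ att)// Q1// Q2.
- move=> a a'; have [p1 Q1] := pullP a gP; have [p2 Q2] := pullP a' gP.
  have [p3 Q3] := pullP (amul a a') gP; apply: (att_inj att).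
    by rewrite p3 !(att_pM att) p1 p2.
  by move=> x Dx; have Dg := gD x Dx; rewrite Q3// !(att_QM att)// Q1// Q2.
- move=> a; have [p1 Q1] := pullP a gP; have [p3 Q3] := pullP (star a) gP.
  apply: (att_inj att); first by rewrite p3 !(att_pS att) p1.
  by move=> x Dx; have Dg := gD x Dx; rewrite Q3// !(att_QS att)// Q1.
Qed.

Lemma pull1 g : ballmap g -> pull g aone = aone.
Proof.
move=> gP; have [_ gD _] := gP; have [p1 Q1] := pullP aone gP.
apply: (att_inj att) => // x Dx.
by rewrite Q1// !(att_Qone att)//; exact: gD.
Qed.

Lemma rep_pull m (rho : A -> 'M[C]_m) g : rep rho -> ballmap g -> rep (fun a => rho (pull g a)).
Proof. by move=> rr gP; exact: rep_comp (pull_star_hom gP) (pull1 gP) rr. Qed.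

(** Moving from [z0] to [z] changes the pulled-back element by one with zero component in B and
    uniformly small values on the ball; [rep_ideal_bound] makes its image small under all [rho z] at
    once. *)
Lemma cts_on_pull (Z : topologicalType) (K : set Z) m (th : Z * 'rV[R]_n -> 'rV[R]_n)
    (rho : Z -> {ptws A -> 'M[C]_m}) :
  cts_on [set z | K z.1 /\ D z.2] th ->
  (forall z, K z -> ballmap (fun x => th (z, x))) ->
  cts_on K rho -> (forall z, K z -> rep (rho z)) ->
  cts_on K (fun z => (fun a => rho z (pull (fun x => th (z, x)) a)) : {ptws A -> 'M[C]_m}).
Proof.
move=> cth thP crho rr; apply/cts_on_ptws => a; apply/cts_on_mxnP => z0 Kz0 e e0.
have J0 := @jbound_ge0 R k m.
have e1 : 0 < e / 2 / (jbound m + 1) by rewrite !divr_gt0// ltr_wpDl.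
have cQ : cts_on [set z | K z.1 /\ D z.2] (fun z => Q a (th z)).
  apply: (@cts_on_comp _ _ _ _ D th (Q a)) => //; last exact: (att_Qc att (a := a)).
  by move=> [z x] /= [Kz Dx]; have [_ + _] := thP z Kz; apply.
have H1 := uniform_ball1 cQ Kz0 e1.
have [/(_ crho) ce _] := cts_on_ptws K (rho : Z -> {ptws A -> 'M[C]_m}).
have := ce (pull (fun x => th (z0, x)) a) => /cts_on_mxnP/(_ z0 Kz0 (e / 2) (divr_gt0 e0 (ltr0n R 2))).
move=> H2; apply: filterS2 H1 H2 => z H1 H2 Kz.
have {}H1 := H1 Kz; have {}H2 := H2 Kz; have rz := rr z Kz.
set a0 := pull (fun x => th (z0, x)) a in H2 *; set a1 := pull _ a.
have [p1 Q1] := pullP a (thP z Kz); have [p2 Q2] := pullP a (thP z0 Kz0).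
rewrite -[rho z a1](subrK (rho z a0)) -(repB rz) -addrA [ltRHS]splitr.
apply: le_lt_trans (mxnD _ _) _; apply: ler_ltD => //.
apply: (@le_trans _ _ (jbound m * (e / 2 / (jbound m + 1)))).
  apply: (rep_ideal_bound att rz); first by rewrite (att_pB att) p1 p2 subrr.
    exact: ltW.
  move=> x Dx s t; apply: le_trans (mxn_coord _ s t) _; apply: le_trans (ltW (H1 x Dx)).
  by rewrite (att_QB att)// Q1// Q2.
rewrite mulrA ler_pdivrMr ?ltr_wpDl// mulrC ler_wpM2l//; first by rewrite divr_ge0// ltW.
by rewrite lerDl.
Qed.

End Deformation.

(** * Scalar functions annihilated by a representation *)

Section ScalarIdeal.
Context {R : realType}.
Local Notation C := (Cplx R).
Context {A B : starAlgType R} {k n : nat} {p : A -> B}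
  {Q : A -> 'rV[R]_n -> 'M[C]_k} {Phi : B -> 'rV[R]_n -> 'M[C]_k}.
Hypothesis att : attached p Q Phi.
Local Notation D := (@ball1 R n).
Local Notation smk := (@smk R A B k n p Q).
Local Notation hgt := (@hgt R A B k n p Q).
Context {m : nat} {rho : {ptws A -> 'M[C]_m}}.
Hypothesis rr : rep rho.

Lemma hgt_star : star hgt = hgt.
Proof. exact (smk_star att (@scalarfun_vrad R n)). Qed.

Lemma rep_hgt_herm : ctr (rho hgt) = rho hgt.
Proof. by rewrite -(repS rr) hgt_star. Qed.

Lemma rep_eq_inner t a b : t <= 1 -> (forall i, eigval (rho hgt) i < t) ->
  (forall x, D x -> vrad x <= t -> Q a x = Q b x) -> rho a = rho b.
Proof.
move=> t1 Ht Qab; apply/eqP; rewrite -subr_eq0 -(repB rr); apply/eqP.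
apply: (eigbasis_eq0 (H := rho hgt)) => i.
apply: (rep_kill_ge att rr (row_eigbasis i rep_hgt_herm) (Ht i) t1) => x Dx xt.
by rewrite (att_QB att)// Qab// subrr.
Qed.

Lemma rep_eq_outer t a b : (forall i, t < eigval (rho hgt) i) -> p a = p b ->
  (forall x, D x -> t <= vrad x -> Q a x = Q b x) -> rho a = rho b.
Proof.
move=> Ht pab Qab; apply/eqP; rewrite -subr_eq0 -(repB rr); apply/eqP.
apply: (eigbasis_eq0 (H := rho hgt)) => i.
apply: (rep_kill_le att rr (row_eigbasis i rep_hgt_herm) (Ht i)).
  by rewrite (att_pB att) pab subrr.
by move=> x Dx xt; rewrite (att_QB att)// Qab// subrr.
Qed.

(** Such functions are closed under sums and squares; a sum of squares has the common zeros as its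
    zero set, the form that [rep_kill_zero] takes. *)
Definition kills w be := scalarfun w be /\ rho (smk w be) = 0.

Lemma kills_add w be w' be' : kills w be -> kills w' be' ->
  kills (fun x => w x + w' x) (be + be').
Proof.
move=> [sw rw] [sw' rw']; have [cw wS] := sw; have [cw' wS'] := sw'.
have s2 : scalarfun (fun x => w x + w' x) (be + be').
  by split; [exact: cts_on_rD|move=> x Sx; rewrite wS// wS'].
split => //; have -> : smk (fun x => w x + w' x) (be + be') = smk w be + smk w' be'.
  have [p1 Q1] := smkP att cw wS; have [p2 Q2] := smkP att cw' wS'.
  have [p3 Q3] := smkP att s2.1 s2.2; apply: (att_inj att).
    by rewrite p3 (att_pD att) p1 p2 rmorphD scalerDl.
  by move=> x Dx; rewrite Q3// (att_QD att)// Q1// Q2// rmorphD raddfD.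
by rewrite (repD rr) rw rw' addr0.
Qed.

Lemma kills_sqr w be : kills w be -> kills (fun x => w x ^+ 2) (be ^+ 2).
Proof.
move=> [sw rw]; have [cw wS] := sw.
have s2 : scalarfun (fun x => w x ^+ 2) (be ^+ 2).
  by split; [exact: (cts_on_rM cw cw)|move=> x Sx; rewrite wS].
split => //; have -> : smk (fun x => w x ^+ 2) (be ^+ 2) = amul (smk w be) (smk w be).
  have [p1 Q1] := smkP att cw wS; have [p3 Q3] := smkP att s2.1 s2.2.
  apply: (att_inj att).
    by rewrite p3 (att_pM att) p1 amulZl amul1l scalerA -rmorphM.
  by move=> x Dx; rewrite Q3// (att_QM att)// Q1// -scalar_mxM -rmorphM.
by rewrite (repM rr) rw mul0mx.
Qed.

Lemma kills_sum (I : Type) (s : seq I) (w : I -> 'rV[R]_n -> R) (be : I -> R) :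
  (forall i, kills (w i) (be i)) ->
  kills (fun x => \sum_(i <- s) w i x) (\sum_(i <- s) be i).
Proof.
move=> H; elim: s => [|i s IH].
  rewrite (_ : (fun x => _) = fun=> 0); last by apply/funext => x; rewrite big_nil.
  rewrite big_nil; split; first exact: scalarfun_cst.
  by rewrite (smk_cst att) rmorph0 scale0r (rep0 rr).
rewrite (_ : (fun x => _) = fun x => w i x + \sum_(i <- s) w i x); last first.
  by apply/funext => x; rewrite big_cons.
by rewrite big_cons; exact: kills_add.
Qed.

Lemma kills_eq w be c : scalarfun w be -> rho (smk w be) = (toC c)%:M ->
  kills (fun x => w x - c) (be - c).
Proof.
move=> sw rw; split; first exact: scalarfunB sw (@scalarfun_cst R n c).
rewrite (smkB att sw (@scalarfun_cst R n c)) (repB rr) rw (smk_cst att).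
by rewrite (repZ rr) (rep1 rr) scalemx1 subrr.
Qed.

End ScalarIdeal.

(** * Representations with radius below 1 *)

Section Inner.
Context {R : realType}.
Local Notation C := (Cplx R).
Context {A B : starAlgType R} {k n : nat} {p : A -> B}
  {Q : A -> 'rV[R]_n -> 'M[C]_k} {Phi : B -> 'rV[R]_n -> 'M[C]_k}.
Hypothesis att : attached p Q Phi.
Local Notation D := (@ball1 R n).
Local Notation Sph := (@sphere1 R n).
Local Notation mk := (@mk R A B k n p Q).
Local Notation smk := (@smk R A B k n p Q).
Local Notation hgt := (@hgt R A B k n p Q).
Local Notation pull := (@pull R A B k n p Q).
Hypothesis k0 : (0 < k)%N.
Context {m : nat}.
Hypothesis m0 : (0 < m)%N.
Hypothesis IH : forall r, (r < m)%N -> ane R (@reps R A r).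
Context {E : nat -> {ptws A -> 'M[C]_m} -> R}.
Hypothesis Egen : cgen (@reps R A m) E.
Context {t : R}.
Hypotheses (t0 : 0 < t) (t1 : t < 1).
Local Notation T := {ptws A -> 'M[C]_m}.

(** A cut-off: 1 on the ball of radius [t], where the representations of this section are supported,
    and 0 on the sphere, so that functions multiplied by it come from elements with zero component
    in B. *)
Definition chi (x : 'rV[R]_n) : R := Num.min 1 ((1 - vrad x) / (1 - t)).

Lemma chi_cts : cts_on D chi.
Proof.
have cr : cts_on D (@vrad R n) by apply: cts_on_cts; exact: vrad_cts.
have c1 := cts_on_rM (cts_on_rB (@cts_on_cst _ _ _ (1 : R)) cr) (@cts_on_cst _ _ D (1 - t)^-1).
exact: (cts_on_rmin (@cts_on_cst _ _ _ (1 : R)) c1).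
Qed.

Lemma chi_range x : D x -> 0 <= chi x <= 1.
Proof.
move=> Dx; rewrite /chi ge_min lexx andbT le_min ler01/=.
by rewrite divr_ge0// subr_ge0// ltW.
Qed.

Lemma chi1 x : vrad x <= t -> chi x = 1.
Proof.
by move=> xt; apply/min_idPl; rewrite ler_pdivlMr ?subr_gt0// mul1r lerD2l lerN2.
Qed.

Lemma chi_sphere x : Sph x -> chi x = 0.
Proof. by rewrite /sphere1/= /chi => ->; rewrite subrr mul0r min_r. Qed.

Lemma scalarfun_chi : scalarfun chi 0.
Proof. by split; [exact: chi_cts|exact: chi_sphere]. Qed.

Lemma coord_cts j : cts_on D (fun x : 'rV[R]_n => x 0 j).
Proof. by apply: cts_on_cts; exact: coord_continuous. Qed.

Lemma scalarfun_coord j : scalarfun (fun x : 'rV[R]_n => chi x * x 0 j) 0.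
Proof.
split; first exact: (cts_on_rM chi_cts (coord_cts (j := j))).
by move=> x Sx; rewrite chi_sphere// mul0r.
Qed.

Definition xi j : A := smk (fun x => chi x * x 0 j) 0.
Definition lam (rho : T) : 'rV[R]_n := \row_j mean (rho (xi j)).
Definition mu (rho : T) : R := mean (rho hgt).
Definition clam (rho : T) : 'rV[R]_n :=
  (t / Num.max t (vrad (lam rho) + (t - mu rho))) *: lam rho.
(* [clam] brings [lam] into the open ball of radius t, and does not move it when
   [vrad lam = mu], as is the case when all coordinate functions and the radius
   are scalar. *)
Definition squeeze c (rho : T) (x : 'rV[R]_n) : 'rV[R]_n :=
  x + ((1 - c) * chi x) *: (clam rho - x).
Definition inner : set T := [set rho | forall i, eigval (rho hgt) i < t].
Definition defect (rho : T) (a : A) : R := mxn (rho a - (toC (mean (rho a)))%:M).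
(** Stated as a bound on one continuous function, which makes closedness immediate. *)
Definition scalarset : set T :=
  [set rho | defect rho hgt + \sum_j defect rho (xi j) <= 0].

Lemma scalarsetP rho : scalarset rho <->
  rho hgt = (toC (mu rho))%:M /\ forall j, rho (xi j) = (toC (lam rho 0 j))%:M.
Proof.
split => [|[Hh Hx]]; last first.
  rewrite /scalarset/= /defect -/(mu rho) -Hh subrr mxn0 add0r big1// => j _.
  by have := Hx j; rewrite mxE => {1}->; rewrite subrr mxn0.
rewrite /scalarset/= => H.
have ge0 a : 0 <= defect rho a by exact: mxn_ge0.
have s0 : 0 <= \sum_j defect rho (xi j) by apply: sumr_ge0.
have zero a : defect rho a <= 0 -> rho a = (toC (mean (rho a)))%:M.
  by move=> /mxn_eq0/eqP; rewrite subr_eq0 => /eqP.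
split; first by apply: zero; apply: le_trans H; rewrite lerDl.
move=> j; rewrite mxE; apply: zero.
have : defect rho (xi j) <= \sum_j defect rho (xi j).
  by rewrite (bigD1 j)//= lerDl sumr_ge0.
by move=> /le_trans; apply; apply: le_trans H; rewrite lerDr.
Qed.

Lemma mu_lt rho : rep rho -> inner rho -> mu rho < t.
Proof. by move=> rr /(mean_lt m0 (rep_hgt_herm att rr)). Qed.

Lemma clam_lt rho : rep rho -> inner rho -> vrad (clam rho) < t.
Proof.
move=> rr ir; have mt := mu_lt rr ir; have l0 := vrad_ge0 (lam rho).
pose M := Num.max t (vrad (lam rho) + (t - mu rho)).
have M0 : 0 < M by rewrite lt_max t0.
rewrite /clam -/M vradZ ger0_norm ?divr_ge0 ?ltW// mulrAC ltr_pdivrMr// ltr_pM2l//.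
by rewrite /M lt_max; apply/orP; right; lra.
Qed.

Lemma squeeze_ballmap c rho : 0 <= c <= 1 -> rep rho -> inner rho ->
  ballmap (squeeze c rho).
Proof.
move=> /andP[c0 c1] rr ir; split.
- apply: cts_on_rV => j.
  have c2 := cts_on_rM (@cts_on_cst _ _ D (1 - c)) chi_cts.
  have c3 := cts_on_rB (@cts_on_cst _ _ D (clam rho 0 j)) (coord_cts (j := j)).
  have := cts_on_rD (coord_cts (j := j)) (cts_on_rM c2 c3).
  by apply: cts_on_ext => x _; rewrite !mxE.
- move=> x Dx; have /andP[h0 h1] := chi_range Dx; apply: vrad_convex => //.
    by rewrite mulr_ge0 ?subr_ge0//= -[leRHS]mulr1 ler_pM// ?subr_ge0// lerBlDr lerDl.
  by apply: ltW; apply: lt_trans t1; exact: clam_lt.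
- by move=> x Sx; rewrite /squeeze chi_sphere// mulr0 scale0r addr0.
Qed.

Lemma cts_on_lam (K : set T) j : cts_on K (fun rho => lam rho 0 j).
Proof.
have := cts_on_mean (@cts_on_eval R A m K (xi j)).
by apply: cts_on_ext => rho _; rewrite mxE.
Qed.

Lemma cts_on_clam (K : set T) j : cts_on K (fun rho => clam rho 0 j).
Proof.
have cl : cts_on K lam by apply: cts_on_rV => i; exact: cts_on_lam.
have cr : cts_on K (fun rho => vrad (lam rho)) := cts_on_compT cl (@vrad_cts R n).
have cm : cts_on K mu := cts_on_mean (@cts_on_eval R A m K hgt).
have ct := @cts_on_cst _ _ K t.
have cM := cts_on_rmax ct (cts_on_rD cr (cts_on_rB ct cm)).
have cV : cts_on K (fun rho => (Num.max t (vrad (lam rho) + (t - mu rho)))^-1).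
  by apply: cts_on_rinv cM => rho _; rewrite gt_eqF// lt_max t0.
have := cts_on_rM (cts_on_rM ct cV) (@cts_on_lam K j).
by apply: cts_on_ext => rho _; rewrite !mxE.
Qed.

Section Point.
Context {rho : T}.
Hypotheses (rr : rep rho) (ir : inner rho).

Lemma inner_eq a b : (forall x, D x -> vrad x <= t -> Q a x = Q b x) -> rho a = rho b.
Proof. exact (rep_eq_inner att rr (ltW t1) ir). Qed.

Lemma inner_scalar a c : (forall x, D x -> vrad x <= t -> Q a x = (toC c)%:M) ->
  rho a = (toC c)%:M.
Proof.
move=> H; have -> : rho a = rho (toC c *: aone).
  by apply: inner_eq => x Dx xt; rewrite H// (att_QZ att)// (att_Qone att)// scalemx1.
by rewrite (repZ rr) (rep1 rr) scalemx1.
Qed.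

Section ScalarPoint.
Hypothesis sr : scalarset rho.

(** The functions [vrad - mu], [chi * x_j - lam_j] and [max(vrad, t) - t] are annihilated, and [lam]
    is their only possible common zero: the last forces [vrad <= t], where [chi] is 1 and the second
    family reads [x = lam]. *)
Lemma scalar_kill j : p j = 0 ->
  (forall x, D x -> vrad x <= t -> vrad x = mu rho -> x = lam rho -> Q j x = 0) ->
  rho j = 0.
Proof.
move=> pj Qj; have [Hh Hx] := (scalarsetP rho).1 sr.
have k1 := kills_eq att rr (@scalarfun_vrad R n) Hh.
have k2 := kills_sum att rr (index_enum _)
  (fun i => kills_sqr att rr (kills_eq att rr (scalarfun_coord i) (Hx i))).
have s3 : scalarfun (fun x : 'rV[R]_n => Num.max (vrad x) t) 1.
  split; last by move=> x; rewrite /sphere1/= => ->; rewrite max_l// ltW.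
  by apply: cts_on_rmax; [case: (@scalarfun_vrad R n)|exact: cts_on_cst].
have k3 : @kills R A B k n p Q m rho (fun x : 'rV[R]_n => Num.max (vrad x) t - t) (1 - t).
  apply: (kills_eq att rr s3); apply: inner_scalar => x Dx xt.
  by have [_ ->] := smkP att s3.1 s3.2; rewrite // max_r.
have := kills_add att rr (kills_add att rr k2 (kills_sqr att rr k1)) (kills_sqr att rr k3).
move=> [sw rw]; apply: (rep_kill_zero att rr sw rw pj) => x Dx /= w0.
have g2 : 0 <= (vrad x - mu rho) ^+ 2 by exact: sqr_ge0.
have g3 : 0 <= (Num.max (vrad x) t - t) ^+ 2 by exact: sqr_ge0.
have g1 : 0 <= \sum_i (chi x * x 0 i - lam rho 0 i) ^+ 2.
  by apply: sumr_ge0 => i _; exact: sqr_ge0.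
have e3 : (Num.max (vrad x) t - t) ^+ 2 = 0 by lra.
have e2 : (vrad x - mu rho) ^+ 2 = 0 by lra.
have e1 : \sum_i (chi x * x 0 i - lam rho 0 i) ^+ 2 = 0 by lra.
have xt : vrad x <= t.
  by move/eqP: e3; rewrite expf_eq0/= subr_eq0 => /eqP <-; rewrite le_max lexx.
apply: Qj => //; first by move/eqP: e2; rewrite expf_eq0/= subr_eq0 => /eqP.
apply/rowP => i; apply/eqP; rewrite -subr_eq0.
have := chi1 xt => ch; move/eqP: e1; rewrite psumr_eq0 => [|l _]; last exact: sqr_ge0.
by move=> /allP/(_ i (mem_index_enum i))/=; rewrite expf_eq0/= ch mul1r.
Qed.

(** Otherwise no point meets the two conditions of [scalar_kill], and [rho] would annihilate the
    element given by [chi], which it sends to 1. *)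
Lemma scalar_lam : vrad (lam rho) = mu rho.
Proof.
apply: contrapT => ne.
have [pc Qc] := smkP att scalarfun_chi.1 scalarfun_chi.2.
have r0 : rho (smk chi 0) = 0.
  by apply: scalar_kill => [|x _ _ xm xl]; [rewrite pc rmorph0 scale0r|rewrite -xl in ne].
have : rho (smk chi 0) = (toC 1)%:M.
  by apply: inner_scalar => x Dx xt; rewrite Qc// chi1.
rewrite r0 => /matrixP/(_ (Ordinal m0) (Ordinal m0)); rewrite !mxE eqxx mulr1n rmorph1.
by move/eqP; rewrite eq_sym oner_eq0.
Qed.

Lemma scalar_lam_lt : vrad (lam rho) < t.
Proof. by rewrite scalar_lam; exact: mu_lt. Qed.

Lemma scalar_clam : clam rho = lam rho.
Proof.
by rewrite /clam scalar_lam addrC subrK max_l// divff ?scale1r// gt_eqF.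
Qed.

Lemma scalar_eq a b : p a = p b -> Q a (lam rho) = Q b (lam rho) -> rho a = rho b.
Proof.
move=> pab Qab; apply/eqP; rewrite -subr_eq0 -(repB rr); apply/eqP.
apply: scalar_kill; first by rewrite (att_pB att) pab subrr.
by move=> x Dx _ _ xl; rewrite (att_QB att)// xl Qab subrr.
Qed.

End ScalarPoint.
End Point.


Local Notation Mk := (@mxalg R k).

(** Constant matrices, cut off so as to lie in A. For [rho] in [inner] the cut-off is invisible, and
    [M |-> rho (bump M)] respects products and adjoints. *)
Definition bump (M : 'M[C]_k) : A := mk 0 (fun x => toC (chi x) *: M).

Lemma bumpP M : p (bump M) = 0 /\ forall x, D x -> Q (bump M) x = toC (chi x) *: M.
Proof.
apply: (mkP att); first exact: (cts_on_scalemx (cts_on_toC chi_cts) (@cts_on_cst _ _ _ M)).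
by move=> x Sx; rewrite chi_sphere// rmorph0 scale0r (rep0 (att_Phi att Sx)).
Qed.

Lemma rep_scalar (A' : starAlgType R) (s : A' -> 'M[C]_m) c :
  rep s -> s (toC c *: aone) = (toC c)%:M.
Proof. by move=> rs; rewrite (repZ rs) (rep1 rs) scalemx1. Qed.

(** Such a [rho] is evaluation at [lam rho] followed by the representation [rho \o bump] of the
    matrix algebra, so it amounts to a point of the open ball of radius [t] and a representation of
    [Mk]. *)
Lemma ane_inner_scalar : ane R ((@reps R A m `&` inner) `&` scalarset).
Proof.
pose W := {ptws Mk -> 'M[C]_m}.
have aS' : ane R ([set l : 'rV[R]_n | vrad l < t] `*` @reps R Mk m).
  apply: ane_setX; last exact: ane_mxalg.
  rewrite -[X in ane R X]setTI; apply: ane_open; first exact: ane_rV.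
  apply: (@open_comp _ _ (@vrad R n) [set r | r < t]); last exact: open_lt.
  by move=> x _; exact: vrad_cts.
have lD (l : 'rV[R]_n) : vrad l < t -> D l by move=> lt; apply: ltW; apply: lt_trans t1.
have sigc (z : 'rV[R]_n * W) a c : rep z.2 -> Q a z.1 = (toC c)%:M ->
    z.2 (Q a z.1) = (toC c)%:M.
  move=> rz ->; rewrite -(rep_scalar c rz); congr (z.2 _).
  exact: esym (scalemx1 _ _).
apply: (@ane_retractT _ _ _ _ _
  (fun rho : T => (lam rho, (fun M => rho (bump M)) : W))
  (fun z : 'rV[R]_n * W => (fun a => z.2 (Q a z.1)) : T) aS').
- apply: cts_on_pair; first by apply: cts_on_rV => j; exact: cts_on_lam.
  by apply/cts_on_ptws => M; exact: cts_on_eval.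
- move=> rho [[rr ir] sr]; split; first exact: scalar_lam_lt.
  have ie := @inner_eq rho rr ir; split => /=.
  + move=> c M N; rewrite -(repZ rr) -(repD rr); apply: ie => x Dx xt.
    have [_ Q1] := bumpP M; have [_ Q2] := bumpP N; have [_ Q3] := bumpP (c *: M + N).
    rewrite Q3// (att_QD att)// (att_QZ att)// Q1// Q2// chi1// rmorph1 !scale1r.
    by [].
  + move=> M N; rewrite -(repM rr); apply: ie => x Dx xt.
    have [_ Q1] := bumpP M; have [_ Q2] := bumpP N; have [_ Q3] := bumpP (M *m N).
    rewrite Q3// (att_QM att)// Q1// Q2// chi1// rmorph1 !scale1r.
    by [].
  + move=> M; rewrite -(repS rr); apply: ie => x Dx xt.
    have [_ Q1] := bumpP M; have [_ Q3] := bumpP (ctr M).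
    rewrite Q3// (att_QS att)// Q1// chi1// rmorph1 !scale1r.
    by [].
  + rewrite -(rep1 rr); apply: ie => x Dx xt.
    have [_ Q1] := bumpP 1%:M.
    by rewrite Q1// (att_Qone att)// chi1// rmorph1 scale1r.
- apply/cts_on_ptws => a; set S' := _ `*` _.
  have cid : cts_on S' (@id ('rV[R]_n * W)) by move=> z _ V; apply: filterS.
  have cQ : cts_on S' (fun z : 'rV[R]_n * W => Q a z.1).
    apply: (@cts_on_comp _ _ _ _ D fst (Q a)); last exact: (att_Qc att (a := a)).
      by move=> z [/lD].
    exact: (cts_on_fst cid).
  have cs s u : cts_on S' (fun z : 'rV[R]_n * W => z.2 (delta_mx s u : Mk)).
    exact: (cts_on_compT (cts_on_snd cid) (@ptws_eval Mk _ (delta_mx s u))).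
  (* The argument of [z.2] varies with [z] as well; expanding it in matrix units separates the two
     dependences. *)
  have := cts_on_summx (s := index_enum 'I_k) (fun s => cts_on_summx (s := index_enum 'I_k)
    (fun u => cts_on_scalemx (cts_on_mx_coord (i := s) (j := u) cQ) (cs s u))).
  apply: cts_on_ext => z [_ rz].
  have E1 : Q a z.1 = \sum_s \sum_u Q a z.1 s u *: (delta_mx s u : Mk) :> Mk.
    exact: matrix_sum_delta.
  rewrite [in RHS]E1 (rep_sum rz); apply: eq_bigr => s _.
  by rewrite (rep_sum rz); apply: eq_bigr => u _; rewrite (repZ rz).
- move=> z [zt rz]; have Dz := lD _ zt; have rQ := att_Q att Dz.
  have rr : rep (fun a => z.2 (Q a z.1)).
    split => [c a b|a b|a|].
    + by rewrite (repD rQ) (repZ rQ); have [lz _ _ _] := rz; exact: lz.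
    + by rewrite (repM rQ); exact: (repM rz).
    + by rewrite (repS rQ); exact: (repS rz).
    + by rewrite (rep1 rQ); exact: (rep1 rz).
  have h1 : z.2 (Q hgt z.1) = (toC (vrad z.1))%:M.
    apply: sigc => //; have [ch hS] := @scalarfun_vrad R n.
    by have [_ ->] := smkP att ch hS.
  have h2 j : z.2 (Q (xi j) z.1) = (toC (z.1 0 j))%:M.
    apply: sigc => //; have [ch hS] := scalarfun_coord j.
    by have [_ ->] := smkP att ch hS; rewrite // chi1 ?mul1r// ltW.
  split; first by split => // i; rewrite h1 eigval_scalar.
  apply/scalarsetP; split; first by rewrite /mu h1 mean_scalar.
  by move=> j; rewrite mxE h2 mean_scalar.
- move=> rho [[rr ir] sr]; apply/funext => a /=.
  have [pc Qc] := smk_mul att a scalarfun_chi.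
  have -> : rho a = rho (amul (smk chi 0) a).
    by apply: (inner_eq rr ir) => x Dx xt; rewrite Qc// chi1// rmorph1 scale1r.
  have [pb Qb] := bumpP (Q a (lam rho)).
  have Dl := lD _ (scalar_lam_lt rr ir sr).
  by apply: (scalar_eq rr ir sr); [rewrite pb pc rmorph0 scale0r|rewrite Qb// Qc].
Qed.

Lemma closed_scalarset : closed scalarset.
Proof.
have cd a : cts_on setT (fun rho : T => defect rho a).
  have ce := @cts_on_eval R A m setT a.
  have c1 := cts_on_scalar_mx (m := m) (cts_on_toC (cts_on_mean ce)).
  have c2 := cts_on_scalemx (@cts_on_cst _ _ setT (-1 : C)) c1.
  have := cts_on_mxn (cts_on_addmx ce c2).
  by apply: cts_on_ext => rho _; rewrite scaleN1r.
have cf := cts_on_rD (cd hgt) (cts_on_rsum (s := index_enum 'I_n) (fun j => cd (xi j))).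
have cl : closed [set r : R | r <= 0] by exact: closed_le.
by have := cts_on_closed closedT cf cl; rewrite setTI.
Qed.

Lemma smk_split (rho : T) w be : rep rho -> scalarfun w be ->
  (exists i j, eigval (rho (smk w be)) i < eigval (rho (smk w be)) j) ->
  exists V : set T, [/\ open V, V rho & ane R (@reps R A m `&` V)].
Proof.
move=> rr sw [i [j ij]]; apply: (rep_split_ane IH rr _ _ ij).
  by move=> a; exact: (smk_central att a sw).
exact: (smk_star att sw).
Qed.

Lemma ane_inner : exists U : set T,
  [/\ open U, @reps R A m `&` U = @reps R A m `&` inner & ane R (@reps R A m `&` U)].
Proof.
have [U [oU SU]] : exists U, open U /\ @reps R A m `&` U = @reps R A m `&` inner.
  apply: relatively_open => rho rr ir.
  apply: (reps_eigval_near (O := [set x | x < t]) rr (hgt_star att)) => i.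
  by apply: open_nbhs_nbhs; split; [exact: open_lt|exact: ir].
exists U; split => //.
have NP rho : (@reps R A m `&` U) rho -> rep rho /\ inner rho by rewrite SU.
have [E1 E2 E3] := Egen.
apply: (@ane_cone R T (@reps R A m) U scalarset
  (fun c rho => (fun a => rho (pull (squeeze c rho) a)) : T) E) => //.
- exact: closed_scalarset.
- by rewrite SU; exact: ane_inner_scalar.
- move=> rho [rN nsr]; have [rr ir] := NP _ rN.
  suff [V [oV Vr aV]] : exists V : set T, [/\ open V, V rho & ane R (@reps R A m `&` V)].
    exists V; split => //.
    have -> : @reps R A m `&` U `&` ~` scalarset `&` V =
        @reps R A m `&` V `&` (U `&` ~` scalarset).
      by rewrite -!setIA; congr (_ `&` _); rewrite [RHS]setIC -setIA.
    apply: ane_open => //; apply: openI => //; rewrite openC; exact: closed_scalarset.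
  apply: contrapT => nV; apply: nsr; apply/scalarsetP.
  have sc w be : scalarfun w be -> rho (smk w be) = (toC (mean (rho (smk w be))))%:M.
    move=> sw; have hh : ctr (rho (smk w be)) = rho (smk w be).
      by rewrite -(repS rr) (smk_star att sw).
    by case: (scalar_or_split m0 hh) => // /(smk_split rr sw).
  split; first exact: (sc _ _ (@scalarfun_vrad R n)).
  by move=> j; rewrite mxE; apply: sc; exact: scalarfun_coord.
- by move=> j; apply: cts_on_sub (E1 j) => rho [].
- move=> rho [rr _] V /(E2 rho rr)[N [e [e0 H]]]; exists N, e; split => // s [rs _].
  exact: H.
- pose K := [set z : R * T | 0 <= z.1 <= 1 /\ (@reps R A m `&` U) z.2].
  have cid : cts_on K (@id (R * T)) by move=> z _ V; apply: filterS.
  have c1 : cts_on K (fun z => z.1) := cts_on_fst cid.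
  have c2 : cts_on K (fun z => z.2) := cts_on_snd cid.
  apply: (cts_on_pull att (th := fun zx => squeeze zx.1.1 zx.1.2 zx.2) _ _ c2).
  + set K' := [set z | _]; apply: cts_on_rV => j.
    have K1 : K' `<=` [set z : (R * T) * 'rV[R]_n | K z.1] by move=> z [].
    have K2 : K' `<=` [set z : (R * T) * 'rV[R]_n | D z.2] by move=> z [].
    have d1 := cts_on_sub K1 (cts_on_prod1 c1).
    have d2 := cts_on_sub K2 (cts_on_prod2 (Z := (R * T)%type) chi_cts).
    have d3 := cts_on_sub K2 (cts_on_prod2 (Z := (R * T)%type) (coord_cts (j := j))).
    have d4 := cts_on_sub K1 (cts_on_prod1 (cts_on_comp (fun z _ => I) c2 (@cts_on_clam setT j))).
    have := cts_on_rD d3 (cts_on_rM (cts_on_rM (cts_on_rB (@cts_on_cst _ _ _ (1 : R)) d1) d2) (cts_on_rB d4 d3)).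
    by apply: cts_on_ext => z _; rewrite /= !mxE.
  + by move=> [c rho] [/= c01 /NP[rr ir]]; exact: squeeze_ballmap.
  + by move=> z [_ []].
- move=> c rho c01 /NP[rr ir]; apply: (rep_pull att rr); exact: squeeze_ballmap.
- move=> rho /NP[rr ir]; apply/funext => a.
  have b1 : ballmap (squeeze 1 rho) by apply: squeeze_ballmap => //; rewrite ler01 lexx.
  have [pa Qa] := pullP att a b1; congr (rho _); apply: (att_inj att) => // x Dx.
  by rewrite Qa// /squeeze subrr mul0r scale0r addr0.
(* At parameter 0 every point with [vrad x <= t] goes to [clam rho], so scalar functions become
   their values there. *)
- move=> rho rN; have [rr ir] := NP _ rN.
  have b1 : ballmap (squeeze 0 rho) by apply: squeeze_ballmap => //; rewrite ler01 lexx.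
  have Dl : D (clam rho) by apply: ltW; apply: lt_trans t1; exact: clam_lt.
  have E0 a c : Q a (clam rho) = (toC c)%:M -> rho (pull (squeeze 0 rho) a) = (toC c)%:M.
    move=> Qa; apply: (inner_scalar rr ir) => x Dx xt; have [_ ->] := pullP att a b1; rewrite //.
    by rewrite /squeeze subr0 mul1r chi1// scale1r addrC subrK.
  set rho' := (fun a : A => _ : 'M[C]_m).
  have rr' : rep rho' by exact: (rep_pull att rr b1).
  have h1 : rho' hgt = (toC (vrad (clam rho)))%:M.
    by apply: E0; have [ch hS] := @scalarfun_vrad R n; have [_ ->] := smkP att ch hS.
  have h2 j : rho' (xi j) = (toC (clam rho 0 j))%:M.
    apply: E0; have [ch hS] := scalarfun_coord j; have [_ ->] := smkP att ch hS; rewrite //.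
    by rewrite chi1 ?mul1r// ltW// clam_lt.
  split.
    by rewrite SU; split => // i; rewrite h1 eigval_scalar; exact: clam_lt.
  apply/scalarsetP; split; first by rewrite /mu h1 mean_scalar.
  by move=> j; rewrite mxE h2 mean_scalar.
- move=> c rho c01 [/NP[rr ir] sr]; apply/funext => a.
  have b1 := squeeze_ballmap c01 rr ir; have [pa Qa] := pullP att a b1.
  have Dl : D (lam rho) by apply: ltW; apply: lt_trans t1; exact: scalar_lam_lt.
  apply: (scalar_eq rr ir sr) => //.
  by rewrite Qa// /squeeze scalar_clam// subrr scaler0 addr0.
Qed.

End Inner.

(** * Representations near the sphere *)

Section Outer.
Context {R : realType}.
Local Notation C := (Cplx R).
Context {A B : starAlgType R} {k n : nat} {p : A -> B}
  {Q : A -> 'rV[R]_n -> 'M[C]_k} {Phi : B -> 'rV[R]_n -> 'M[C]_k}.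
Hypothesis att : attached p Q Phi.
Local Notation D := (@ball1 R n).
Local Notation mk := (@mk R A B k n p Q).
Local Notation hgt := (@hgt R A B k n p Q).
Local Notation pull := (@pull R A B k n p Q).
Hypothesis k0 : (0 < k)%N.
Context {m : nat}.
Hypothesis m0 : (0 < m)%N.
Hypothesis IH : forall r, (r < m)%N -> ane R (@reps R A r).
Context {E : nat -> {ptws A -> 'M[C]_m} -> R}.
Hypothesis Egen : cgen (@reps R A m) E.
Hypothesis aB : ane R (@reps R B m).
Local Notation T := {ptws A -> 'M[C]_m}.

(** For [c = 0] the shell of radii at least 1/2 goes radially to the sphere and the rest of the ball
    is dilated by 2; for [c = 1] this is the identity. The maximum avoids the singularity at the
    centre. *)
Definition blow c (x : 'rV[R]_n) : 'rV[R]_n :=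
  ((1 - c) / Num.max (vrad x) 2^-1 + c) *: x.
Definition outer : set T := [set rho | forall i, 2^-1 < eigval (rho hgt) i].
Definition flat : set T := [set rho | rho hgt = (toC 1)%:M].
(** Radial extension of [b] to the ball. It need not be multiplicative, but the defect has zero
    component in B, and representations in [flat] do not see it. *)
Definition rlift (b : B) : A := mk b (fun x => toC (vrad x) *: Phi b ((vrad x)^-1 *: x)).

Lemma rliftP b : p (rlift b) = b /\
  forall x, D x -> Q (rlift b) x = toC (vrad x) *: Phi b ((vrad x)^-1 *: x).
Proof.
apply: (mkP att); first exact: (att_ext att (b := b)).
by move=> x; rewrite /sphere1/= => ->; rewrite rmorph1 invr1 !scale1r.
Qed.

(** [rho] annihilates [vrad - 1], whose zero set is the sphere, where [Q a] is determined by
    [p a]. *)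
Lemma flat_eq r (rho : A -> 'M[C]_r) a b : rep rho -> rho hgt = (toC 1)%:M ->
  p a = p b -> rho a = rho b.
Proof.
move=> rr Hh pab; apply/eqP; rewrite -subr_eq0 -(repB rr); apply/eqP.
have [sw rw] := kills_eq att rr (@scalarfun_vrad R n) Hh.
apply: (rep_kill_zero att rr sw rw); first by rewrite (att_pB att) pab subrr.
move=> x Dx /= /eqP; rewrite subr_eq0 => /eqP Sx.
by rewrite (att_QB att)// !(att_QPhi att)// pab subrr.
Qed.

Lemma rep_lift r (rho : A -> 'M[C]_r) : rep rho -> rho hgt = (toC 1)%:M ->
  rep (fun b => rho (rlift b)).
Proof.
move=> rr Hh; have pl b : p (rlift b) = b by have [] := rliftP b.
split => [c b b'|b b'|b|].
- by rewrite -(repZ rr) -(repD rr); apply: (flat_eq rr Hh); rewrite pl (att_pD att) (att_pZ att) !pl.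
- by rewrite -(repM rr); apply: (flat_eq rr Hh); rewrite pl (att_pM att) !pl.
- by rewrite -(repS rr); apply: (flat_eq rr Hh); rewrite pl (att_pS att) !pl.
- by rewrite -(rep1 rr); apply: (flat_eq rr Hh); rewrite pl (att_pone att).
Qed.

Lemma p_hgt : p hgt = aone.
Proof.
have [c1 s1] := @scalarfun_vrad R n; have [-> _] := smkP att c1 s1.
by rewrite rmorph1 scale1r.
Qed.

Lemma ane_outer_flat : ane R ((@reps R A m `&` outer) `&` flat).
Proof.
apply: (@ane_retractT _ _ _ _ _
  (fun rho : T => (fun b => rho (rlift b)) : {ptws B -> 'M[C]_m})
  (fun s : {ptws B -> 'M[C]_m} => (s \o p : T)) aB).
- by apply/cts_on_ptws => b; exact: cts_on_eval.
- by move=> rho [[rr _] fr]; exact: rep_lift.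
- by apply/cts_on_ptws => a; exact: (cts_on_eval (a := p a)).
- move=> s rs; have r2 := rep_comp (att_p att) (att_p1 att) rs.
  have h : s (p hgt) = (toC 1)%:M by rewrite p_hgt (rep1 rs) rmorph1.
  split; last exact: h.
  split => // i; rewrite /= h eigval_scalar.
  by rewrite invf_lt1// ltr1n.
- move=> rho [[rr _] fr]; apply/funext => a /=; apply: flat_eq => //.
  by have [] := rliftP (p a).
Qed.

Lemma closed_flat : closed flat.
Proof.
have -> : flat = [set rho : T | mxn (rho hgt + (-1 : C) *: (toC 1)%:M) <= 0].
  apply/seteqP; split => rho /=; rewrite /flat/= scaleN1r.
    by move=> ->; rewrite subrr mxn0.
  by move=> /mxn_eq0/eqP; rewrite subr_eq0 => /eqP.
have ce := @cts_on_eval R A m setT hgt.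
have cf := cts_on_mxn (cts_on_addmx ce (@cts_on_cst _ _ setT ((-1 : C) *: (toC 1)%:M))).
have cl : closed [set r : R | r <= 0] by exact: closed_le.
by have := cts_on_closed closedT cf cl; rewrite setTI.
Qed.

Lemma half_gt0 : 0 < 2^-1 :> R. Proof. by rewrite invr_gt0. Qed.

Lemma blow_max (x : 'rV[R]_n) : 0 < Num.max (vrad x) 2^-1.
Proof. by rewrite lt_max half_gt0 orbT. Qed.

Lemma cts_on_max : cts_on D (fun x : 'rV[R]_n => (Num.max (vrad x) 2^-1)^-1).
Proof.
apply: cts_on_rinv => [x _|]; first by rewrite gt_eqF// blow_max.
apply: cts_on_rmax; last exact: cts_on_cst.
by apply: cts_on_cts; exact: vrad_cts.
Qed.

Lemma blow_ballmap c : 0 <= c <= 1 -> ballmap (@blow c).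
Proof.
move=> /andP[c0 c1]; split.
- apply: cts_on_rV => j.
  have d1 := cts_on_rM (@cts_on_cst _ _ D (1 - c)) cts_on_max.
  have := cts_on_rM (cts_on_rD d1 (@cts_on_cst _ _ D c)) (coord_cts (j := j)).
  by apply: cts_on_ext => x _; rewrite !mxE.
- move=> x Dx; have M0 := blow_max x; rewrite /ball1/= vradZ.
  have h0 : 0 <= (1 - c) / Num.max (vrad x) 2^-1 by rewrite divr_ge0 ?subr_ge0// ltW.
  rewrite ger0_norm ?addr_ge0// mulrDl -[leRHS](subrK c); apply: lerD.
    rewrite mulrAC ler_pdivrMr// ler_wpM2l ?subr_ge0//.
    by rewrite le_max lexx.
  by rewrite -[leRHS]mulr1 ler_wpM2l.
- move=> x; rewrite /sphere1/= => Sx; rewrite /blow Sx max_l; last first.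
    by rewrite invf_le1// ler1n.
  by rewrite divr1 subrK scale1r.
Qed.

Lemma ane_outer : exists U : set T,
  [/\ open U, @reps R A m `&` U = @reps R A m `&` outer & ane R (@reps R A m `&` U)].
Proof.
have [U [oU SU]] : exists U, open U /\ @reps R A m `&` U = @reps R A m `&` outer.
  apply: relatively_open => rho rr ir.
  apply: (reps_eigval_near (O := [set x | 2^-1 < x]) rr (hgt_star att)) => i.
  by apply: open_nbhs_nbhs; split; [exact: open_gt|exact: ir].
exists U; split => //.
have NP rho : (@reps R A m `&` U) rho -> rep rho /\ outer rho by rewrite SU.
have [E1 E2 E3] := Egen.
have flat_fix c rho a : 0 <= c <= 1 -> rep rho -> flat rho -> rho (pull (blow c) a) = rho a.
  move=> c01 rr fr; apply: flat_eq => //.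
  by have [] := pullP att a (blow_ballmap c01).
apply: (@ane_cone R T (@reps R A m) U flat
  (fun c rho => (fun a => rho (pull (blow c) a)) : T) E) => //.
- exact: closed_flat.
- by rewrite SU; exact: ane_outer_flat.
- move=> rho [rN nfr]; have [rr ir] := NP _ rN.
  suff [V [oV Vr aV]] : exists V : set T, [/\ open V, V rho & ane R (@reps R A m `&` V)].
    exists V; split => //.
    have -> : @reps R A m `&` U `&` ~` flat `&` V =
        @reps R A m `&` V `&` (U `&` ~` flat).
      by rewrite -!setIA; congr (_ `&` _); rewrite [RHS]setIC -setIA.
    apply: ane_open => //; apply: openI => //; rewrite openC; exact: closed_flat.
  case: (scalar_or_split m0 (rep_hgt_herm att rr)) => [Hh|ij]; last first.
    exact: (smk_split att IH rr (@scalarfun_vrad R n) ij).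
  set c := mean _ in Hh.
  have vh := row_eigbasis (Ordinal m0) (rep_hgt_herm att rr).
  have := rep_hgt_range att rr vh (row_eigbasis_neq0 _ _).
  rewrite [X in eigval X]Hh eigval_scalar => /andP[c0 c1].
  have {}c1 : c < 1.
    rewrite lt_def c1 andbT; apply/eqP => ce; apply: nfr.
    by rewrite /flat/= Hh ce.
  (* The scalar [c] lies below 1, and the radius bound is taken halfway between them. *)
  have [V [oV SV aV]] := @ane_inner _ _ _ _ _ _ _ _ att k0 m m0 IH E Egen ((1 + c) / 2)
    ltac:(lra) ltac:(lra).
  exists V; split => //.
  suff : (@reps R A m `&` V) rho by case.
  by rewrite SV; split => // i; rewrite Hh eigval_scalar; lra.
- by move=> j; apply: cts_on_sub (E1 j) => rho [].
- move=> rho [rr _] V /(E2 rho rr)[N [e [e0 H]]]; exists N, e; split => // s [rs _].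
  exact: H.
- pose K := [set z : R * T | 0 <= z.1 <= 1 /\ (@reps R A m `&` U) z.2].
  have cid : cts_on K (@id (R * T)) by move=> z _ V; apply: filterS.
  have c1 : cts_on K (fun z => z.1) := cts_on_fst cid.
  have c2 : cts_on K (fun z => z.2) := cts_on_snd cid.
  apply: (cts_on_pull att (th := fun zx => blow zx.1.1 zx.2) _ _ c2).
  + set K' := [set z | _]; apply: cts_on_rV => j.
    have K1 : K' `<=` [set z : (R * T) * 'rV[R]_n | K z.1] by move=> z [].
    have K2 : K' `<=` [set z : (R * T) * 'rV[R]_n | D z.2] by move=> z [].
    have d1 := cts_on_sub K1 (cts_on_prod1 c1).
    have d2 := cts_on_sub K2 (cts_on_prod2 (Z := (R * T)%type) cts_on_max).
    have d3 := cts_on_sub K2 (cts_on_prod2 (Z := (R * T)%type) (coord_cts (j := j))).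
    have := cts_on_rM (cts_on_rD (cts_on_rM (cts_on_rB (@cts_on_cst _ _ _ (1 : R)) d1) d2) d1) d3.
    by apply: cts_on_ext => z _; rewrite /= !mxE.
  + by move=> [c rho] [/= c01 _]; exact: blow_ballmap.
  + by move=> z [_ []].
- move=> c rho c01 /NP[rr ir]; apply: (rep_pull att rr); exact: blow_ballmap.
- move=> rho /NP[rr ir]; apply/funext => a.
  have b1 : ballmap (@blow 1) by apply: blow_ballmap => //; rewrite ler01 lexx.
  have [pa Qa] := pullP att a b1; congr (rho _); apply: (att_inj att) => // x Dx.
  by rewrite Qa// /blow subrr mul0r add0r scale1r.
- move=> rho rN; have [rr ir] := NP _ rN.
  have b1 : ballmap (@blow 0) by apply: blow_ballmap => //; rewrite ler01 lexx.
  have h1 : rho (pull (blow 0) hgt) = (toC 1)%:M.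
    rewrite -[RHS](rep1 rr).
    have [ph Qh] := pullP att hgt b1; have [_ bD _] := b1.
    apply: (rep_eq_outer att rr ir); first by rewrite ph p_hgt (att_pone att).
    move=> x Dx xt; rewrite Qh//; have [c1 s1] := @scalarfun_vrad R n.
    have [_ ->] := smkP att c1 s1; last exact: bD.
    rewrite (att_Qone att)// vradZ subr0 addr0 mul1r max_l//.
    have x0 : 0 < vrad x by apply: lt_le_trans xt; exact: half_gt0.
    by rewrite ger0_norm ?invr_ge0 ?vrad_ge0// mulVf ?rmorph1// gt_eqF.
  split; last exact: h1.
  rewrite SU; split; first exact: (rep_pull att rr b1).
  by move=> i; rewrite h1 eigval_scalar invf_lt1// ltr1n.
- by move=> c rho c01 [/NP[rr ir] fr]; apply/funext => a; exact: flat_fix.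
Qed.

(** [rho hgt] is non-scalar, a scalar below 1, or 1; splitting, the inner contraction and the outer
    contraction cover these cases. *)
Lemma reps_local (rho : T) : rep rho ->
  exists V : set T, [/\ open V, V rho & ane R (@reps R A m `&` V)].
Proof.
move=> rr; case: (scalar_or_split m0 (rep_hgt_herm att rr)) => [Hh|ij]; last first.
  exact: (smk_split att IH rr (@scalarfun_vrad R n) ij).
set c := mean _ in Hh.
have vh := row_eigbasis (Ordinal m0) (rep_hgt_herm att rr).
have := rep_hgt_range att rr vh (row_eigbasis_neq0 _ _).
rewrite [X in eigval X]Hh eigval_scalar => /andP[c0 c1].
have [lt|ge] := ltP c 1.
  have [V [oV SV aV]] := @ane_inner _ _ _ _ _ _ _ _ att k0 m m0 IH E Egen ((1 + c) / 2)
    ltac:(lra) ltac:(lra).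
  exists V; split => //.
  suff : (@reps R A m `&` V) rho by case.
  by rewrite SV; split => // i; rewrite Hh eigval_scalar; lra.
have [V [oV SV aV]] := ane_outer.
exists V; split => //.
suff : (@reps R A m `&` V) rho by case.
by rewrite SV; split => // i; rewrite Hh eigval_scalar; have := half_gt0; lra.
Qed.

End Outer.

Section Pullback.
Context {R : realType}.
Local Notation C := (Cplx R).
Context {A B : starAlgType R} {k n : nat} {p : A -> B}
  {Q : A -> 'rV[R]_n -> 'M[C]_k} {Phi : B -> 'rV[R]_n -> 'M[C]_k}.
Hypothesis att : attached p Q Phi.

(** Strong induction on [m], since splitting uses all smaller sizes for the same algebra; in size 0
    there is a single representation. *)
Theorem ane_attached m : (0 < k)%N -> spanning A -> (forall r, ane R (@reps R B r)) ->
  ane R (@reps R A m).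
Proof.
move=> k0 sA aB; elim/ltn_ind: m => m IH.
have [m0|m0] := posnP m; first by rewrite m0; exact: reps_empty_dim.
have [E Egen] := spanning_cgen m sA.
apply: ane_of_local => rho rr; exact: (reps_local att k0 m0 IH Egen (aB m) rr).
Qed.

End Pullback.

(** * Nets and partitions of unity on the ball *)

Section Net.
Context {R : realType} {n : nat}.
Local Notation C := (Cplx R).
Local Notation D := (@ball1 R n).

Lemma norm_le_vrad (x : 'rV[R]_n) : `|x| <= vrad x.
Proof.
rewrite [leLHS](_ : _ = mx_norm x)// mx_normrE; apply: bigmax_le => [|[i j] _ /=].
  exact: vrad_ge0.
by rewrite ord1; exact: vrad_coord.
Qed.

Lemma ball1_net (r : R) : 0 < r -> exists s : seq 'rV[R]_n,
  (forall y, y \in s -> D y) /\ forall x, D x -> exists2 y, y \in s & `|x - y| < r.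
Proof.
move=> r0; have := @ball1_compact R n; rewrite compact_cover.
move=> /(_ _ D (fun y => ball y r)) [].
- by move=> y _; exact: ball_open.
- by move=> x Dx; exists x => //; exact: ballxx.
move=> s sD cov; exists (finmap.enum_fset s); split.
  by move=> y ys; have := sD y ys; rewrite inE.
move=> x /cov[y /= ys]; rewrite -ball_normE/= distrC => xy.
by exists y.
Qed.

Lemma uniform_on_ball1 k (F : 'rV[R]_n -> 'M[C]_k) e : cts_on D F -> 0 < e ->
  exists2 r, 0 < r & forall x y, D x -> D y -> `|x - y| < r -> mxn (F x - F y) < e.
Proof.
move=> /cts_on_mxnP cF e0.
have : \forall d \near (0 : R), [set d | 0 < d] d -> forall x, D x ->
    forall y, D y -> `|x - y| < d -> mxn (F x - F y) < e.
  apply: near_ball1 => x Dx; have e2 : 0 < e / 2 by rewrite divr_gt0.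
  have := cF x Dx _ e2 => /nbhs_ballP[r /= r0 Hr].
  have r2 : 0 < r / 2 by rewrite divr_gt0.
  exists ([set d | d < r / 2], ball x (r / 2)).
    split => /=; last exact: nbhsx_ballx.
    by apply: open_nbhs_nbhs; split => //; exact: open_lt.
  move=> [d z] /= [dr xz] d0 Dz y Dy zy.
  have xz' : `|x - z| < r / 2 by move: xz; rewrite -ball_normE.
  have Fz : mxn (F z - F x) < e / 2.
    apply: Hr => //; rewrite -ball_normE/=; apply: lt_trans xz' _.
    by rewrite ltr_pdivrMr// mulr_natr mulr2n ltrDl.
  have Fy : mxn (F y - F x) < e / 2.
    apply: Hr => //; rewrite -ball_normE/= -(subrKA z) [ltRHS]splitr.
    apply: le_lt_trans (ler_normD _ _) _; apply: ltrD => //.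
    exact: lt_trans zy dr.
  rewrite -(subrKA (F x)) [ltRHS]splitr; apply: le_lt_trans (mxnD _ _) _.
  by apply: ltrD => //; rewrite mxnB.
move=> /nbhs_ballP[r /= r0 /(_ (r / 2))] H; have r2 : 0 < r / 2 by rewrite divr_gt0.
exists (r / 2) => // x y Dx Dy; apply: H => //=.
rewrite -ball_normE/= sub0r normrN ger0_norm ?ltW//.
by rewrite ltr_pdivrMr// mulr_natr mulr2n ltrDl.
Qed.

(** The bound on [r] keeps [x] off the centre; the distance from [x] to its radial projection is at
    most [1 - vrad x]. *)
Lemma radial_close (x : 'rV[R]_n) r : 1 - r < vrad x -> r <= 2^-1 -> D x ->
  sphere1 ((vrad x)^-1 *: x) /\ `|x - (vrad x)^-1 *: x| < r.
Proof.
move=> xr r2 Dx; have x0 : 0 < vrad x.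
  apply: le_lt_trans xr; rewrite subr_ge0; apply: le_trans r2 _.
  by rewrite invf_le1// ler1n.
split; first by rewrite /sphere1/= vradZ ger0_norm ?invr_ge0 ?ltW// mulVf// gt_eqF.
have -> : x - (vrad x)^-1 *: x = (1 - (vrad x)^-1) *: x by rewrite scalerBl scale1r.
rewrite normrZ distrC ger0_norm; last by rewrite subr_ge0 invf_ge1.
apply: (@le_lt_trans _ _ (((vrad x)^-1 - 1) * vrad x)).
  by rewrite ler_wpM2l ?norm_le_vrad// subr_ge0 invf_ge1.
by rewrite mulrBl mulVf ?gt_eqF// mul1r ltrBlDr addrC -ltrBlDr.
Qed.

Definition tent (r : R) (y x : 'rV[R]_n) : R := Num.max 0 (r - `|x - y|).

Lemma tent_ge0 r y x : 0 <= tent r y x. Proof. by rewrite le_max lexx. Qed.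

Lemma tent_gt0 r y x : (0 < tent r y x) = (`|x - y| < r).
Proof. by rewrite lt_max ltxx subr_gt0. Qed.

Lemma tent_cts r y : cts_on D (tent r y).
Proof.
apply: cts_on_rmax; first exact: cts_on_cst.
apply: cts_on_rB; first exact: cts_on_cst.
apply/cts_on_realP => x Dx e e0.
have := nbhsx_ballx x e e0; apply: filterS => z; rewrite -ball_normE/= => xz _.
apply: le_lt_trans xz; rewrite distrC; apply: le_trans (ler_dist_dist _ _) _.
by rewrite opprB addrA subrK.
Qed.

Context {r : R} {s : seq 'rV[R]_n}.
Hypothesis net : forall x, D x -> exists2 y, y \in s & `|x - y| < r.

(** Normalized tents at the net points: a partition of unity on the ball. *)
Definition pou (i : nat) (x : 'rV[R]_n) : R :=
  tent r (nth 0 s i) x / \sum_(j < size s) tent r (nth 0 s j) x.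

Lemma pou_sum_gt0 x : D x -> 0 < \sum_(j < size s) tent r (nth 0 s j) x.
Proof.
move=> /net[y ys xy].
have js : (index y s < size s)%N by rewrite index_mem.
rewrite (bigD1 (Ordinal js))//=; apply: ltr_wpDr; first by apply: sumr_ge0 => *; exact: tent_ge0.
by rewrite nth_index// tent_gt0.
Qed.

Lemma pou_ge0 i x : D x -> 0 <= pou i x.
Proof. by move=> Dx; rewrite divr_ge0 ?tent_ge0// ltW// pou_sum_gt0. Qed.

Lemma pou_sum x : D x -> \sum_(i < size s) pou i x = 1.
Proof. by move=> Dx; rewrite -mulr_suml mulfV// gt_eqF// pou_sum_gt0. Qed.

Lemma pou_far i x : r <= `|x - nth 0 s i| -> pou i x = 0.
Proof.
move=> far; rewrite /pou (_ : tent _ _ _ = 0) ?mul0r//.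
by apply/eqP; rewrite eq_le tent_ge0 andbT leNgt tent_gt0 -leNgt.
Qed.

Lemma pou_cts i : cts_on D (pou i).
Proof.
apply: cts_on_rM; first exact: tent_cts.
apply: cts_on_rinv => [x Dx|]; first by rewrite gt_eqF// pou_sum_gt0.
by apply: cts_on_rsum => j; exact: tent_cts.
Qed.

End Net.

Section SpanningCriterion.
Context {R : realType}.
Local Notation C := (Cplx R).

Lemma spanning_of_countable (A : starAlgType R) (I : countType) (a : I -> A) :
  (forall x (e : R) M, 0 < e -> exists s : seq (C * I),
    forall m (p : A -> 'M[C]_m), (m <= M)%N -> rep p ->
      mxn (p (x - \sum_(z <- s) z.1 *: a z.2)) < e) ->
  spanning A.
Proof.
move=> H; pose a' i := if unpickle i is Some j then a j else 0.
exists a' => x e M e0; have [s sP] := H x e M e0.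
suff [n [c nc]] : exists n (c : nat -> C), forall N, (n <= N)%N ->
    \sum_(i < N) c i *: a' i = \sum_(z <- s) z.1 *: a z.2.
  by exists n, (fun i => c i) => m p mM rp; rewrite nc//; exact: sP.
elim: s {sP} => [|z s [n [c nc]]].
  by exists 0%N, (fun=> 0) => N _; rewrite big_nil big1// => i _; rewrite scale0r.
exists (maxn n (pickle z.2).+1), (fun i => c i + (if i == pickle z.2 then z.1 else 0)).
move=> N; rewrite geq_max => /andP[nN zN].
under eq_bigr do rewrite scalerDl.
rewrite big_split/= nc// big_cons addrC; congr (_ + _).
rewrite (bigD1 (Ordinal zN))//= eqxx /a' pickleK big1 ?addr0// => i ne.
have -> : (nat_of_ord i == pickle z.2) = false.
  by apply: contra_neqF ne => /eqP iz; apply: val_inj.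
by rewrite scale0r.
Qed.

End SpanningCriterion.

(** * Spanning families in pull-backs *)

Section SpanningAttached.
Context {R : realType}.
Local Notation C := (Cplx R).
Context {A B : starAlgType R} {k n : nat} {p : A -> B}
  {Q : A -> 'rV[R]_n -> 'M[C]_k} {Phi : B -> 'rV[R]_n -> 'M[C]_k}.
Hypothesis att : attached p Q Phi.
Local Notation D := (@ball1 R n).
Local Notation Sph := (@sphere1 R n).
Local Notation mk := (@mk R A B k n p Q).
Local Notation smk := (@smk R A B k n p Q).
Local Notation hgt := (@hgt R A B k n p Q).
Local Notation jbound := (@jbound R k).
Local Notation rlift := (@rlift R A B k n p Q Phi).

Lemma att_psum (I : Type) (s : seq I) (F : I -> A) :
  p (\sum_(i <- s) F i) = \sum_(i <- s) p (F i).
Proof.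
elim: s => [|i s IH]; first by rewrite !big_nil (att_pzero att).
by rewrite !big_cons (att_pD att) IH.
Qed.

Definition rep_const m : R :=
  (m * m)%:R * ((m * m)%:R * ((m * m)%:R * ((m * m)%:R + jbound m))).

Lemma rep_const_ge0 m : 0 <= rep_const m.
Proof. by rewrite /rep_const !mulr_ge0// addr_ge0// jbound_ge0. Qed.

Lemma mxn_row r m (M : 'M[C]_(r, m)) i : mxn (row i M) <= mxn M.
Proof.
rewrite /mxn big_ord1 [leRHS](bigD1 i)//=; under eq_bigr do rewrite mxE.
by rewrite lerDl; apply: sumr_ge0 => *; apply: sumr_ge0 => *; exact: cnorm_ge0.
Qed.

(** With eigenvalue below 1 the eigenvector does not see a neighbourhood of the sphere, so [a] may
    be cut off by [chi], and [rep_ideal_bound] applies. *)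
Lemma rep_row_lt1 m (rho : A -> 'M[C]_m) a e i : rep rho -> 0 <= e ->
  (forall x, D x -> mxn (Q a x) <= e) -> eigval (rho hgt) i < 1 ->
  mxn (row i (eigbasis (rho hgt)) *m rho a) <= (m * m)%:R * (jbound m * e).
Proof.
move=> rr e0 Qe l1; set v := row i _; set l := eigval _ _ in l1.
have vh : v *m rho hgt = toC l *: v := row_eigbasis i (rep_hgt_herm att rr).
pose t := (1 + l) / 2; have lt : l < t by rewrite /t; lra.
have t1 : t < 1 by rewrite /t; lra.
have sc : scalarfun (@chi R n t) 0 by exact: scalarfun_chi.
have [pc Qc] := smk_mul att a sc.
have -> : v *m rho a = v *m rho (amul (smk (@chi R n t) 0) a).
  apply/eqP; rewrite -subr_eq0 -mulmxBr -(repB rr); apply/eqP.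
  apply: (rep_kill_ge att rr vh lt (ltW t1)) => x Dx xt.
  by rewrite (att_QB att)// Qc// chi1// rmorph1 scale1r subrr.
apply: le_trans (mxnM _ _) _; apply: ler_pM; rewrite ?mxn_ge0//.
  exact: le_trans (mxn_row _ _) (mxn_eigbasis _).
apply: (rep_ideal_bound att rr) => //; first by rewrite pc rmorph0 scale0r.
move=> x Dx s u; apply: le_trans (mxn_coord _ s u) _.
have /andP[h0 h1] := chi_range t1 Dx.
rewrite Qc// mxnZ cnorm_toC ger0_norm//; apply: le_trans (Qe x Dx).
by rewrite -[leRHS]mul1r ler_wpM2r ?mxn_ge0.
Qed.

(* The eigenspace of [rho hgt] for the eigenvalue 1 carries a representation of
   A that factors through B. *)
Lemma rep_row_eq1 m (rho : A -> 'M[C]_m) a e i : rep rho -> 0 <= e ->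
  (forall r (s : B -> 'M[C]_r), (r <= m)%N -> rep s -> mxn (s (p a)) <= e) ->
  eigval (rho hgt) i = 1 ->
  mxn (row i (eigbasis (rho hgt)) *m rho a) <= (m * m)%:R * ((m * m)%:R * e).
Proof.
move=> rr e0 Be l1; set H := rho hgt in l1 *; have hH : ctr H = H := rep_hgt_herm att rr.
pose J := [set j | eigval H j == 1]%SET; pose V := eigrows H J.
have VV : V *m ctr V = 1%:M := eigrows_unit H J.
pose f (x : R) : R := (x == 1)%:R.
have VP : ctr V *m V = fcalc f H by apply: eigrows_proj => j; rewrite inE.
have comm b : rho b *m H = H *m rho b.
  by rewrite -!(repM rr) (smk_central att b (@scalarfun_vrad R n)).
have Vr b : V *m rho b *m ctr V *m V = V *m rho b.
  rewrite -!mulmxA VP (fcalc_comm f hH hH (comm b)) -VP !mulmxA VV.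
  by rewrite mul1mx.
have rs := rep_compress rr VV Vr; set sig := fun a : A => _ in rs.
have VH : V *m H = V.
  apply/row_matrixP => j; rewrite row_mul.
  have -> : row j V = row (enum_val j) (eigbasis H) by apply/rowP => c; rewrite !mxE.
  rewrite row_eigbasis//; have := enum_valP j; rewrite inE => /eqP ->.
  by rewrite rmorph1 scale1r.
have sh : sig hgt = (toC 1)%:M by rewrite /sig VH VV rmorph1.
have sa : sig a = sig (rlift (p a)).
  by apply: (flat_eq att rs sh); have [] := rliftP att (p a).
have rJ : (#|J| <= m)%N by rewrite -[X in (_ <= X)%N]card_ord max_card.
have iJ : i \in J by rewrite inE l1 eqxx.
have -> : row i (eigbasis H) *m rho a = row (enum_rank_in iJ i) (sig a *m V).
  rewrite /sig Vr row_mul; congr (_ *m _).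
  by apply/rowP => c; rewrite !mxE enum_rankK_in.
apply: le_trans (mxn_row _ _) _; apply: le_trans (mxnM _ _) _.
rewrite mulrA [leRHS]mulrC; apply: ler_pM; rewrite ?mxn_ge0//.
  by rewrite sa; apply: (Be _ _ rJ (rep_lift att rs sh)).
apply: (@le_trans _ _ ((#|J| * m)%:R * (m * m)%:R)).
  apply: mxn_le => b c; rewrite mxE; apply: le_trans (mxn_coord _ _ _) _.
  exact: mxn_eigbasis.
by rewrite ler_wpM2r// ler_nat leq_mul2r rJ orbT.
Qed.

(** Each row of [eigbasis] is an eigenvector of [rho hgt]. Where its eigenvalue is below 1 the
    values on the ball control it, and where it is 1 the component in B does. *)
Lemma rep_bound m (rho : A -> 'M[C]_m) a e : rep rho -> 0 <= e ->
  (forall r (s : B -> 'M[C]_r), (r <= m)%N -> rep s -> mxn (s (p a)) <= e) ->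
  (forall x, D x -> mxn (Q a x) <= e) -> mxn (rho a) <= rep_const m * e.
Proof.
move=> rr e0 Be Qe; set H := rho hgt; have hH : ctr H = H := rep_hgt_herm att rr.
have J0 := @jbound_ge0 R k m; set c : R := (m * m)%:R; have c0 : 0 <= c by [].
have rows i : mxn (row i (eigbasis H) *m rho a) <= c * ((c + jbound m) * e).
  have := rep_hgt_range att rr (row_eigbasis i hH) (row_eigbasis_neq0 _ _).
  move=> /andP[_]; rewrite le_eqVlt => /orP[/eqP l1|l1].
    apply: le_trans (rep_row_eq1 rr e0 Be l1) _.
    by rewrite ler_wpM2l// ler_wpM2r// lerDl.
  apply: le_trans (rep_row_lt1 rr e0 Qe l1) _.
  by rewrite ler_wpM2l// ler_wpM2r// lerDr.
have [_ UU] := eigbasis_unitary H.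
have -> : rho a = ctr (eigbasis H) *m (eigbasis H *m rho a).
  by rewrite mulmxA UU mul1mx.
apply: le_trans (mxnM _ _) _; rewrite /rep_const -/c -!mulrA.
apply: ler_pM; rewrite ?mxn_ge0//; first by rewrite mxn_ctr mxn_eigbasis.
apply: mxn_le => i j; apply: le_trans (rows i).
have -> : (eigbasis H *m rho a) i j = (row i (eigbasis H) *m rho a) 0 j.
  by rewrite -row_mul [RHS]mxE.
exact: mxn_coord.
Qed.

(** At most 1/2, as [radial_close] requires. *)
Definition mesh (N : nat) : R := (N.+2)%:R^-1.

Lemma mesh_gt0 N : 0 < mesh N. Proof. by rewrite invr_gt0. Qed.

Lemma mesh_le N : mesh N <= 2^-1.
Proof. by rewrite lef_pV2 ?posrE ?ltr0n// ler_nat. Qed.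

Lemma mesh_small d : 0 < d -> exists N, mesh N < d.
Proof.
move=> d0; exists (Num.bound d^-1); rewrite /mesh invf_plt ?posrE//.
have := archi_boundP (ltW (_ : 0 < d^-1)); rewrite invr_gt0 => /(_ d0).
by move=> /lt_trans; apply; rewrite ltr_nat leqW.
Qed.

(** Lifts of the family of B reduce [a] to an element that is small on the sphere. This one is
    approximated by its values at the points of a net, weighted by a partition of unity that is cut
    off near the sphere; countably many nets and the matrix units give the other half of the
    family. *)
Theorem spanning_attached : spanning B -> spanning A.
Proof.
move=> [b bP].
have [net netP] := choice (fun N => @ball1_net R n _ (mesh_gt0 N)).
pose w N i x := @chi R n (1 - mesh N) x * @pou R n (mesh N) (net N) i x.
pose hat N i u v := mk 0 (fun x => toC (w N i x) *: (delta_mx u v : 'M[C]_k)).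
have hatP N i u v : p (hat N i u v) = 0 /\
    forall x, D x -> Q (hat N i u v) x = toC (w N i x) *: delta_mx u v.
  apply: (mkP att).
    have cw := cts_on_rM (@chi_cts R n (1 - mesh N)) (pou_cts (netP N).2 (i := i)).
    exact: (cts_on_scalemx (cts_on_toC cw) (@cts_on_cst _ _ _ (delta_mx u v : 'M[C]_k))).
  move=> x Sx; rewrite /w chi_sphere// mul0r rmorph0 scale0r.
  by rewrite (rep0 (att_Phi att Sx)).
pose g (z : nat + (nat * nat * 'I_k * 'I_k)) : A :=
  match z with
  | inl j => rlift (b j)
  | inr q => hat q.1.1.1 q.1.1.2 q.1.2 q.2
  end.
apply: (spanning_of_countable (a := g)) => a e M e0.
pose K : R := \sum_(m < M.+1) rep_const m + 1.
have Km m : (m <= M)%N -> rep_const m < K.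
  move=> mM; have mM' : (m < M.+1)%N by [].
  rewrite /K (bigD1 (Ordinal mM'))//= -addrA ltrDl ltr_wpDl// sumr_ge0// => *.
  exact: rep_const_ge0.
have K0 : 0 < K by apply: le_lt_trans (Km 0%N isT); exact: rep_const_ge0.
(* [K] exceeds every [rep_const m] with [m <= M]. One half is spent on the size on the sphere, the
   other on the oscillation over the mesh. *)
pose e1 := e / K / 2; have e10 : 0 < e1 by rewrite !divr_gt0.
(* The size [k] is included because evaluation at a point of the sphere is a representation of B of
   that size. *)
have [nB [c Hc]] := bP (p a) e1 (maxn M k) e10.
pose S1 := \sum_(i < nB) c i *: rlift (b i); pose a1 := a - S1.
have pa1 : p a1 = p a - \sum_i c i *: b i.
  rewrite /a1 (att_pB att) att_psum; congr (_ - _); apply: eq_bigr => i _.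
  by rewrite (att_pZ att); have [-> _] := rliftP att (b i).
have [d d0 Hd] := uniform_on_ball1 (att_Qc att (a := a1)) e10.
have [N Nd] := mesh_small d0; have [nD nP] := netP N.
pose y i := nth 0 (net N) i.
have yD (i : 'I_(size (net N))) : D (y i) by apply/nD/mem_nth.
pose S2 := \sum_(z : 'I_(size (net N)) * 'I_k * 'I_k)
  Q a1 (y z.1.1) z.1.2 z.2 *: hat N z.1.1 z.1.2 z.2.
exists ([seq (c i, inl (nat_of_ord i)) | i : 'I_nB] ++
  [seq (Q a1 (y z.1.1) z.1.2 z.2, inr (N, nat_of_ord z.1.1, z.1.2, z.2))
    | z : 'I_(size (net N)) * 'I_k * 'I_k]) => m rho mM rr.
rewrite big_cat/= !big_image/= -/S1 -/S2 opprD addrA -/a1.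
have pS2 : p S2 = 0.
  rewrite /S2 att_psum big1// => z _; rewrite (att_pZ att).
  by have [-> _] := hatP N z.1.1 z.1.2 z.2; rewrite scaler0.
have QS2 x : D x -> Q S2 x = \sum_(i < size (net N)) toC (w N i x) *: Q a1 (y i).
  move=> Dx; rewrite /S2 (rep_sum (att_Q att Dx)).
  have E i : toC (w N i x) *: Q a1 (y i) = \sum_u \sum_v
      toC (w N i x) *: (Q a1 (y i) u v *: delta_mx u v).
    rewrite {1}[Q a1 (y i)]matrix_sum_delta scaler_sumr.
    by apply: eq_bigr => u _; rewrite scaler_sumr.
  under [RHS]eq_bigr do rewrite E.
  rewrite pair_bigA pair_bigA/=; apply: eq_bigr => z _.
  rewrite (att_QZ att)//; have [_ ->] := hatP N z.1.1 z.1.2 z.2; last by [].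
  by rewrite !scalerA mulrC.
have sphere_small x : Sph x -> mxn (Q a1 x) < e1.
  move=> Sx; rewrite (att_QPhi att)// pa1.
  exact: (Hc k (fun b' => Phi b' x) (leq_maxr M k) (att_Phi att Sx)).
have Qsmall x : D x -> mxn (Q (a1 - S2) x) <= e / K.
  move=> Dx; have t1 : 1 - mesh N < 1 by rewrite ltrBlDr ltrDl mesh_gt0.
  have /andP[h0 h1] := chi_range t1 Dx; set h := @chi R n (1 - mesh N) x in h0 h1.
  have -> : Q (a1 - S2) x = toC (1 - h) *: Q a1 x +
      \sum_(i < size (net N)) toC (w N i x) *: (Q a1 x - Q a1 (y i)).
    rewrite (att_QB att)// QS2//; under [X in _ = _ + X]eq_bigr do rewrite scalerBr.
    rewrite sumrB -scaler_suml -rmorph_sum -mulr_sumr (pou_sum nP Dx) mulr1 addrA -/h.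
    by rewrite -scalerDl -rmorphD subrK rmorph1 scale1r.
  have -> : e / K = e1 + e1 by rewrite /e1 -splitr.
  apply: le_trans (mxnD _ _) _; rewrite mxnZ cnorm_toC ger0_norm ?subr_ge0//.
  apply: (@le_trans _ _ ((1 - h) * (e1 + e1) + h * e1)); last by nra.
  apply: lerD.
    (* In the collar, where [chi] drops, [x] is compared with its radial projection to the sphere,
       where [a1] is already small. *)
    have [xt|tx] := leP (vrad x) (1 - mesh N).
      by rewrite /h chi1// subrr !mul0r.
    rewrite ler_wpM2l ?subr_ge0//; have [Sx close] := radial_close tx (mesh_le N) Dx.
    rewrite -[Q a1 x](subrK (Q a1 ((vrad x)^-1 *: x))).
    apply: le_trans (mxnD _ _) _; apply: lerD; last exact/ltW/sphere_small.
    by apply/ltW/Hd => //; [exact: sphere_ball|exact: lt_trans Nd].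
  apply: le_trans (mxn_sum _ _ _) _.
  rewrite -[h]mulr1 -(pou_sum nP Dx) mulr_sumr mulr_suml; apply: ler_sum => i _.
  have w0 : 0 <= w N i x by rewrite mulr_ge0// (pou_ge0 nP).
  rewrite mxnZ cnorm_toC ger0_norm// -/(w N i x).
  have [near|far] := ltP `|x - y i| (mesh N).
    by rewrite ler_wpM2l//; apply/ltW/Hd => //; exact: lt_trans Nd.
  by rewrite /w (pou_far far) mulr0 !mul0r.
apply: (@le_lt_trans _ _ (rep_const m * (e / K))).
  apply: rep_bound => //; first by rewrite divr_ge0// ltW.
  move=> r s rm rs; rewrite (att_pB att) pS2 subr0 pa1.
  apply: le_trans (ltW (Hc r s _ rs)) _.
    by rewrite leq_max (leq_trans rm mM).
  by rewrite /e1 ler_pdivrMr// mulr_natr mulr2n lerDl divr_ge0// ltW.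
by rewrite mulrA ltr_pdivrMr// mulrC ltr_pM2l// Km.
Qed.

End SpanningAttached.

(** * Cell complexes *)

Section SetType.
Context {R : realType} {T : topologicalType} {K : set T} {m : nat}.
Local Notation C := (Cplx R).
Local Notation CK := (contmx R (set_type K) m).

Definition set_point x (Kx : K x) : set_type K := SigSub (mem_set Kx).

Definition extend0 (f : CK) (x : T) : 'M[C]_m :=
  if pselect (K x) is left Kx then contmx_fun f (set_point Kx) else 0.

Lemma extend0_point f x (Kx : K x) : extend0 f x = contmx_fun f (set_point Kx).
Proof.
rewrite /extend0; case: pselect => // Kx'.
by congr (contmx_fun f _); apply: val_inj.
Qed.

Lemma extend0_val f (y : set_type K) : extend0 f (val y) = contmx_fun f y.
Proof.
rewrite (extend0_point f (set_valP y)).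
by congr (contmx_fun f _); apply: val_inj.
Qed.

Lemma cts_on_extend0 f : cts_on K (extend0 f).
Proof.
move=> x Kx V; rewrite (extend0_point f Kx) => fV.
have := contmx_cts (f := f) fV; rewrite /= nbhsE.
move=> [W [[ G oG GW] Wx] WV]; have Gx : G x by move: Wx; rewrite -GW.
have : nbhs x G by apply: open_nbhs_nbhs.
apply: filterS => y Gy Ky; rewrite (extend0_point f Ky).
by apply: WV; rewrite -GW.
Qed.

Lemma cts_val (F : T -> 'M[C]_m) : cts_on K F ->
  continuous (fun y : set_type K => F (val y)).
Proof.
move=> cF y V FV; have Ky := set_valP y.
have H : nbhs y (val @^-1` [set x | K x -> V (F x)]).
  exact: (@initial_continuous _ _ (@set_val T K) y _ (cF _ Ky V FV)).
apply: (@filterS _ _ (@nbhs_filter (set_type K) y) _ _ _ H) => z /=.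
by apply; exact: set_valP z.
Qed.

Definition contmx_of (F : T -> 'M[C]_m) (cF : cts_on K F) : CK := mkcts (cts_val cF).

Lemma contmx_ofE F (cF : cts_on K F) y : contmx_fun (contmx_of cF) y = F (val y).
Proof. by []. Qed.

End SetType.

Lemma rep_eval (R : realType) (A : starAlgType R) (T : topologicalType) m
    (f : A -> contmx R T m) y : unital_star_hom f -> rep (fun a => contmx_fun (f a) y).
Proof.
move=> [[lf mf sf] f1]; split.
- by move=> c a b; rewrite lf.
- by move=> a b; rewrite mf.
- by move=> a; rewrite sf.
- by rewrite f1.
Qed.

Section AttachedPullback.
Context {R : realType} {A B : starAlgType R} {k n : nat}.
Local Notation C := (Cplx R).
Context {phi : B -> contmx R (set_type (unit_sphere R n)) k}.
Hypotheses (phiP : unital_star_hom phi) (pb : is_pullback A phi).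

Lemma unit_ballE (x : 'rV[R]_n) : unit_ball R n x <-> ball1 x.
Proof.
rewrite /unit_ball /ball1 /= -vrad_sqr.
by rewrite expr_le1// vrad_ge0.
Qed.

Lemma unit_sphereE (x : 'rV[R]_n) : unit_sphere R n x <-> sphere1 x.
Proof.
rewrite /unit_sphere /sphere1 /= -vrad_sqr; split; last by move=> ->; rewrite expr1n.
by move=> /eqP; rewrite sqrf_eq1 => /orP[/eqP //|/eqP x1]; have := vrad_ge0 x; rewrite x1; lra.
Qed.

(* Near the centre, where [x / vrad x] has no limit, the bound for [Phi] on the
   sphere takes over. *)
Lemma cts_on_radial (F : 'rV[R]_n -> 'M[C]_k) : cts_on (@sphere1 R n) F ->
  cts_on (@ball1 R n) (fun x => toC (vrad x) *: F ((vrad x)^-1 *: x)).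
Proof.
move=> cF x0 Dx0; have [x00|x00] := eqVneq (vrad x0) 0.
  move: x0 {Dx0} x00 => x0 r0; rewrite r0 rmorph0 scale0r => V /nbhs_mxnP[e e0 eV].
  have : \forall d \near (0 : R), [set d | 0 < d] d -> forall x, ball1 x ->
      sphere1 x -> d * mxn (F x) < e.
    apply: near_ball1 => x Dx; have [Sx|Sx] := eqVneq (vrad x) 1.
      have := cF x Sx; move=> H; have /cts_on_mxnP/(_ x Sx 1 ltr01) H1 := cF.
      pose b := mxn (F x) + 1; have b0 : 0 < b by rewrite ltr_wpDl// mxn_ge0.
      exists ([set d | d < e / b], [set y | sphere1 y -> mxn (F y - F x) < 1]).
        split => //=; apply: open_nbhs_nbhs; split; first exact: open_lt.
        by rewrite /= divr_gt0.
      move=> [d y] /= [de Hy] d0 Dy Sy; rewrite -[ltRHS](divfK (lt0r_neq0 b0)).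
      apply: ltr_pM => //; first exact: ltW; first exact: mxn_ge0.
      rewrite -[F y](subrK (F x)) /b addrC.
      by apply: le_lt_trans (mxnD _ _) _; rewrite ltrD2l; exact: Hy.
    exists (setT, [set y | vrad y != 1]).
      split => //=; first exact: filterT.
      apply: open_nbhs_nbhs; split => //.
      apply: (@open_comp _ _ (@vrad R n) [set r | r != 1]); first by move=> y _; exact: vrad_cts.
      have -> : [set r : R | r != 1] = ~` [set 1].
        by apply/funext => r /=; rewrite propeqE; split => /eqP.
      by rewrite openC.
    by move=> [d y] /= [_ y1] _ _ Sy; rewrite Sy eqxx in y1.
  have cr : (@vrad R n) @ x0 --> (0 : R) by rewrite -r0; exact: vrad_cts.
  move=> /cr H; apply: (@filterS _ _ (nbhs_filter x0) _ _ _ H) => y /= Hy Dy.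
  apply: eV; rewrite subr0 mxnZ cnorm_toC.
  rewrite ger0_norm ?vrad_ge0//; have := vrad_ge0 y; rewrite le_eqVlt.
  move=> /orP[/eqP <-|y0]; first by rewrite mul0r.
  have Sy : sphere1 ((vrad y)^-1 *: y).
    by rewrite /sphere1/= vradZ ger0_norm ?invr_ge0 ?ltW// mulVf// gt_eqF.
  exact: (Hy y0 _ (sphere_ball Sy) Sy).
pose K := [set x : 'rV[R]_n | ball1 x /\ vrad x != 0].
have cr : cts_on K (@vrad R n) by apply: cts_on_cts; exact: vrad_cts.
have cV : cts_on K (fun x => (vrad x)^-1) by apply: cts_on_rinv => // x [].
have cs : cts_on K (fun x => (vrad x)^-1 *: x).
  apply: cts_on_rV => j.
  have cj : cts_on K (fun x : 'rV[R]_n => x 0 j) by apply: cts_on_cts; exact: coord_continuous.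
  by have := cts_on_rM cV cj; apply: cts_on_ext => x _; rewrite mxE.
have KS x : K x -> sphere1 ((vrad x)^-1 *: x).
  by move=> [_ x1]; rewrite /sphere1/= vradZ ger0_norm ?invr_ge0 ?vrad_ge0// mulVf.
have cG := cts_on_scalemx (cts_on_toC cr) (cts_on_comp KS cs cF).
move=> V /(cG x0 (conj Dx0 x00) V) H.
have no : nbhs x0 [set x | vrad x != 0].
  apply: open_nbhs_nbhs; split => //.
  apply: (@open_comp _ _ (@vrad R n) [set r | r != 0]); first by move=> y _; exact: vrad_cts.
  have -> : [set r : R | r != 0] = ~` [set 0].
    by apply/funext => r /=; rewrite propeqE; split => /eqP.
  by rewrite openC.
by apply: filterS (filterI H no) => x [Hx x1] Dx; apply: Hx.
Qed.

Lemma attached_of_pullback :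
  exists (p : A -> B) (Q : A -> 'rV[R]_n -> 'M[C]_k) (Phi : B -> 'rV[R]_n -> 'M[C]_k),
    attached p Q Phi.
Proof.
have [p [q [ph qh inj rng]]] := pb; have [phh ph1] := phiP.
have r1 : restr (@sphere_sub_ball R n) (aone : contmx R (set_type (unit_ball R n)) k) = aone.
  by apply: contmxP => y.
(* The preimage [e] of the pair of units acts as a unit after applying [p] and [q], which are
   jointly injective; so it is the unit of A, and [p] and [q] are unital. *)
have one : exists2 e, p e = aone & q e = aone.
  have : range (fun a => (p a, q a)) (aone, aone) by rewrite rng /= ph1 r1.
  by move=> [e _ [pe qe]]; exists e.
have [e pe qe] := one.
have e1 : e = aone.
  have [_ mp _] := ph; have [_ mq _] := qh.
  by rewrite -(amul1r e); apply: inj; rewrite /= mp mq pe qe !amul1l.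
have qu : unital_star_hom q by split; rewrite // -e1.
exists p, (fun a => extend0 (q a)), (fun b => extend0 (phi b)); split.
- exact: ph.
- by rewrite -e1.
- move=> x /unit_ballE Dx.
  rewrite (_ : (fun a => _) = fun a => contmx_fun (q a) (set_point Dx)); last first.
    by apply/funext => a; exact: extend0_point.
  exact: rep_eval.
- move=> a; apply: (cts_on_sub (L := unit_ball R n)); last exact: cts_on_extend0.
  by move=> x /unit_ballE.
- move=> x /unit_sphereE Sx.
  rewrite (_ : (fun a => _) = fun a => contmx_fun (phi a) (set_point Sx)); last first.
    by apply/funext => a; exact: extend0_point.
  exact: rep_eval.
- move=> a x Sx; have Dx := (unit_ballE x).2 (sphere_ball Sx).
  have {}Sx := (unit_sphereE x).2 Sx.
  have : range (fun a => (p a, q a)) (p a, q a) by exists a.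
  rewrite rng /= => ->; rewrite (extend0_point _ Dx) (extend0_point _ Sx).
  by congr (contmx_fun (q a) _); apply: val_inj.
- move=> a a' pa qa; apply: inj; congr (_, _) => //; apply: contmxP => y.
  by rewrite -!extend0_val; apply: qa; apply/unit_ballE; exact: set_valP y.
- move=> b F cF FS.
  have cF' : cts_on (unit_ball R n) F by apply: cts_on_sub cF => x /unit_ballE.
  have : range (fun a => (p a, q a)) (b, contmx_of cF').
    rewrite rng /=; apply: contmxP => y; rewrite -extend0_val.
    have Sy : sphere1 (val y) by apply/unit_sphereE; exact: set_valP y.
    by rewrite -FS.
  move=> [a _ [pa qa]]; exists a; split => // x /unit_ballE Dx.
  by rewrite qa (extend0_point _ Dx).
- move=> b; apply: cts_on_radial; apply: (cts_on_sub (L := unit_sphere R n)); last exact: cts_on_extend0.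
  by move=> x /unit_sphereE.
Qed.

End AttachedPullback.

(** The two properties go through the induction together: the extension property of a pull-back
    needs coordinates on its representations, which come from its spanning family, and this is built
    from the one of B. *)
Lemma nc_cell_complex_ane (R : realType) (A : cstarType R) : nc_cell_complex A ->
  (forall m, ane R (@reps R A m)) /\ spanning A.
Proof.
elim=> {A} [A B _ [aA sA] [f fP [g fK gK]]|A fA|A B k n phi _ [aB sB] k0 phiP pb].
- split; last exact: (spanning_isomorphic fP gK sA).
  by move=> m; apply: (ane_isomorphic fP fK gK); exact: aA.
- split; last exact: spanning_finite_dimensional.
  by move=> m; exact: ane_finite_dimensional.
- have [p [Q [Phi att]]] := attached_of_pullback phiP pb.
  have sA := spanning_attached att sB; split => // m.
  exact: (ane_attached att k0 sA aB).
Qed.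

Theorem theorem2p12 (R : realType) (A : cstarType R) (m : nat)
    (X : topologicalType) (Y : set X) (phi : A -> contmx R (set_type Y) m)
    (hA : nc_cell_complex A) (hm : (1 <= m)%N)
    (Xcompact : compact [set: X]) (Xhausdorff : hausdorff_space X)
    (Yclosed : closed Y) (hphi : unital_star_hom phi) :
  exists (Z : set X) (YZ : Y `<=` Z) (psi : A -> contmx R (set_type Z) m),
    [/\ closed Z, Y `<=` interior Z, star_hom psi
      & forall a : A, phi a = restr YZ (psi a)].
Proof.
have [aA sA] := nc_cell_complex_ane hA.
have [E Egen] := spanning_cgen m sA.
(* [phi] as a map from [Y] to the space of representations, with the value 0 off [Y]. *)
pose f (x : X) : {ptws A -> 'M[Cplx R]_m} := fun a => extend0 (phi a) x.
have cf : cts_on Y f by apply/cts_on_ptws => a; exact: cts_on_extend0.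
have fr x : Y x -> reps (f x).
  move=> Yx; rewrite /reps/= (_ : f x = fun a => contmx_fun (phi a) (set_point Yx)).
    exact: rep_eval.
  by apply/funext => a; exact: extend0_point.
have [Z [g [cZ YZ cg gf gr]]] := ane_compact_hausdorff (aA m) Egen Xcompact Xhausdorff Yclosed cf fr.
have cga a : cts_on Z (fun x => g x a) by move: a; apply/cts_on_ptws.
have YZ' : Y `<=` Z by move=> y /YZ/interior_subset.
exists Z, YZ', (fun a => contmx_of (cga a)); split => //.
- have rz (z : set_type Z) : rep (g (val z)) := gr _ (set_valP z).
  split.
  + by move=> c a b; apply: contmxP => z; rewrite contmx_ofE (repD (rz z)) (repZ (rz z)).
  + by move=> a b; apply: contmxP => z; rewrite contmx_ofE (repM (rz z)).
  + by move=> a; apply: contmxP => z; rewrite contmx_ofE (repS (rz z)).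
- move=> a; apply: contmxP => y.
  have -> : contmx_fun (restr YZ' (contmx_of (cga a))) y = g (val y) a by [].
  by rewrite gf ?/f ?extend0_val//; exact: set_valP y.
Qed.
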